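(* Let $0\le p\le n$, $k\ge1$, and let $\omega$ be a smooth $p$-form in $\Omega\subset\mathbb{R}^n$. There exists a constant $C_{\omega,k}$ such that $$|\mathfrak{I}\mathcal{C}_k\omega(x)-\omega(x)|\le\frac{C_{\omega,k}}{C_{\Theta}^p}h^k\quad\text{for all }x\in\sigma\text{ in all }\sigma\in S^n(K)$$ whenever $h>0$, $C_{\Theta}>0$, and $K$ is a cubical mesh in $\Omega$ such that $\operatorname{diam}(\sigma)\le h$ and $\Theta(\sigma)\ge C_{\Theta}$ for all cells $\sigma$ of $K$. (The constant $C_{\omega,k}$ does not depend on $h$, $C_\Theta$ or $K$.)
   Context: Unit cube. $\square^n=[0,1]^n$. $\mathcal{J}(n,k-1)$ is the set of multi-indices $\mathbf{k}=(k_1,\ldots,k_n)$ of integers with $0\le k_i\le k-1$, and $\mathbf{k}_{k-1}:\square^n\to\square^n$ is $\mathbf{k}_{k-1}(x)=\frac{1}{k}(k_1+x_1,\ldots,k_n+x_n)$. The $k$th order small $p$-cubes of $\square^n$ are the sets $\mathbf{k}_{k-1}(\tau)$ with $\mathbf{k}\in\mathcal{J}(n,k-1)$ and $\tau$ a $p$-face of $\square^n$. For a $p$-face $\tau$ let $x_{i_1},\ldots,x_{i_p}$ ($i_1<\ldots<i_p$) be the coordinates whose plane is parallel to $\tau$ and $x_{i_{p+1}},\ldots,x_{i_n}$ the others, with constant values $y_{i_j}\in\{0,1\}$ on $\tau$; put $$\mathcal{W}\tau=\Big(\prod_{j=p+1}^n x_{i_j}^{y_{i_j}}(1-x_{i_j})^{1-y_{i_j}}\Big)\mathrm{d}x_{i_1}\wedge\ldots\wedge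 \mathrm{d}x_{i_p},\qquad w(\mathbf{k}_{k-1}(\tau))=\Big(\prod_{i=1}^n x_i^{k_i}(1-x_i)^{k-1-k_i}\Big)\mathcal{W}\tau .$$ Meshes. A mesh $K$ in $\Omega$ is a finite cell complex with union $\Omega$ (so $\Omega$ is compact, and smooth in $\Omega$ means smooth up to the boundary, i.e. extending smoothly to a neighbourhood of $\Omega$), in which every cell is a face of some $n$-cell and two cells meet in a common face or not at all. It is cubical if for each $n$-cell $\sigma$ of $K$ there is an affine bijection $\phi:\square^n\to\sigma$ (so $\sigma$ is a parallelotope). All cells are given fixed orientations. $S^p(K)$ is the set of $p$-cells and $C_p^*(K)$ the space of real $p$-cochains; likewise for the refinement $K_k$ below. Small cubes and forms on $K$. The $k$th order small cubes of an $n$-cell $\sigma$ are the images under $\phi$ of those of $\square^n$, and the corresponding cubical forms in $\sigma$ are the pullbacks $w(\phi(\mathbf{k}_{k-1}(\tau)))=(\phi^{-1})^*(w(\mathbf{k}_{k-1}(\tau)))$. $K_k$ is the cubical mesh whose cells are all the $k$th order small cubes (of all dimensions) of the cells of $K$. For $\upsilon\in S^p(K_k)$, $w(\upsilon)$ denotes the piecewise smooth $p$-form on $\Omega$ which on each $n$-cell $\sigma$ containing $\upsilon$ is the cubical form of $\upsilon$ regarded as a small cube of $\sigma$, with sign chosen so that its integral over the oriented cell $\upsilon$ is positive, and which is zero on the $n$-cells not containing $\upsilon$; the traces from neighbouring $n$-cells on common faces agree. $Q_k^p(K)$ is the real span of all $w(\upsilon)$, $\upsilon\in S^p(K_k)$.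 Operators. $\mathcal{C}_k$ is the de Rham map of $K_k$: $(\mathcal{C}_k\omega)(\upsilon)=\int_\upsilon\omega$ for $\upsilon\in S^p(K_k)$. The interpolation operator $\mathfrak{I}:C_p^*(K_k)\to Q_k^p(K)$ sends $X$ to the unique element $\mathfrak{I}X\in Q_k^p(K)$ with $\int_\upsilon\mathfrak{I}X=X(\upsilon)$ for all $\upsilon\in S^p(K_k)$. In the claim, for $x\in\sigma$ the value $\mathfrak{I}\mathcal{C}_k\omega(x)$ is that of the restriction of $\mathfrak{I}\mathcal{C}_k\omega$ to $\sigma$. Fullness and norms. For a $q$-cell $\sigma$, $|\sigma|$ is its $q$-dimensional volume and its fullness is $\Theta(\sigma)=|\sigma|/\operatorname{diam}(\sigma)^q$ (equal to $1$ for $q=0$). $|\cdot|$ on $p$-covectors is the comass norm (any other fixed norm changes only the constant). *)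

(* Defs.v *)
From HB Require Import structures.
From mathcomp Require Import all_boot all_order all_algebra.
From mathcomp Require Import all_classical all_reals all_analysis.
Import numFieldNormedType.Exports.

Set Implicit Arguments.
Unset Strict Implicit.
Unset Printing Implicit Defensive.
Import Order.TTheory GRing.Theory Num.Theory.

Local Open Scope classical_set_scope.
Local Open Scope ring_scope.

(* Points of R^n are row vectors.  A p-covector is a function of the p x n
   matrix whose rows are its p vector arguments. *)
Notation pform R n p := ('rV[R]_n -> 'M[R]_(p, n) -> R).

Section Forms.
Context {R : realType}.

Definition alternating_form n p (f : 'M[R]_(p, n) -> R) : Prop :=
  (forall (A B C : 'M[R]_(p, n)) (i : 'I_p) (b c : R),
     row i A = b *: row i B + c *: row i C ->
     row' i B = row' i A -> row' i C = row' i A ->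
     f A = b * f B + c * f C) /\
  (forall (A : 'M[R]_(p, n)) (i j : 'I_p), i != j -> row i A = row j A ->
     f A = 0).

Definition enorm n (v : 'rV[R]_n) : R := Num.sqrt (\sum_i v 0 i ^+ 2).

(* |v_1 /\ ... /\ v_p|, i.e. the p-dimensional volume of the parallelotope
   spanned by the rows of E (square root of the Gram determinant) *)
Definition pvolume n p (E : 'M[R]_(p, n)) : R := Num.sqrt (\det (E *m E^T)).

(* supremum over the unit simple p-vectors *)
Definition comass n p (f : 'M[R]_(p, n) -> R) : R :=
  sup [set `|f v| | v in [set v : 'M[R]_(p, n) | pvolume v = 1]].

Definition iter_partial n (s : seq 'I_n) (f : 'rV[R]_n -> R) : 'rV[R]_n -> R :=
  foldr (fun i g x => 'D_(delta_mx 0 i) g x) f s.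

(* C^oo on the open set U *)
Definition smooth_fun n (U : set 'rV[R]_n) (f : 'rV[R]_n -> R) : Prop :=
  forall (s : seq 'I_n) (x : 'rV[R]_n), U x ->
    differentiable (iter_partial s f) x.

(* smooth up to the boundary; the values of omega outside Omega are
   irrelevant *)
Definition smooth_form n p (Omega : set 'rV[R]_n) (omega : pform R n p) : Prop :=
  exists (U : set 'rV[R]_n) (omega' : pform R n p),
    [/\ open U /\ Omega `<=` U,
        forall x, U x -> alternating_form (omega' x),
        forall v, smooth_fun U (fun x => omega' x v) &
        forall x v, Omega x -> omega x v = omega' x v].

Definition unit_cube n : set 'rV[R]_n :=
  [set x | forall i, 0 <= x 0 i <= 1].

(* integral over [0,1]^p, as an iterated integral *)
Fixpoint cube_integral p : ('rV[R]_p -> R) -> R :=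
  match p return ('rV[R]_p -> R) -> R with
  | 0 => fun f => f 0
  | q.+1 => fun f =>
      (\int[lebesgue_measure]_(t in `[0, 1])
         cube_integral (fun y : 'rV[R]_q => f (row_mx (t%:M : 'rV_1) y)))%R
  end.

(* An affine map from R^p to R^n, t |-> b + t *m E, is a pair (b, E). *)
Definition affine n p (c : 'rV[R]_n * 'M[R]_(p, n)) (t : 'rV[R]_p) : 'rV[R]_n :=
  c.1 + t *m c.2.

(* integral of omega over the singular cube given by c on [0,1]^p *)
Definition integral_cell n p (c : 'rV[R]_n * 'M[R]_(p, n))
    (omega : pform R n p) : R :=
  cube_integral (fun t => omega (affine c t) c.2).

Definition diam n (A : set 'rV[R]_n) : R :=
  sup [set enorm (x.1 - x.2) | x in A `*` A].

End Forms.

(* A face of the unit cube: None marks the coordinates parallel to the face,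
   Some y those that are constant, with value y, on it. *)
Definition face n := {ffun 'I_n -> option bool}.

Definition fdim n (tau : face n) : nat := #|[set i | tau i == None]|.

Definition cube_face n : face n := [ffun=> None].

Section UnitCube.
Context {R : realType} {n : nat}.

Definition face_set (tau : face n) : set 'rV[R]_n :=
  [set x | forall i, if tau i is Some y then x 0 i = y%:R else 0 <= x 0 i <= 1].

(* row a is the unit vector e_{i_a}, where i_a is the a-th coordinate parallel
   to tau (counting from 0); meaningful when p = fdim tau *)
Definition face_edges p (tau : face n) : 'M[R]_(p, n) :=
  \matrix_(a < p, j < n)
    ((tau j == None) &&
     (#|[set i : 'I_n | (i < j)%N && (tau i == None)]| == a :> nat))%:R.

(* the form W tau; dx_{i_1} /\ ... /\ dx_{i_p} evaluated at v is the determinant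
   of the columns i_1, ..., i_p of v *)
Definition whitney_form p (tau : face n) : pform R n p := fun x v =>
  (\prod_i (if tau i is Some y then x 0 i ^+ y * (1 - x 0 i) ^+ (1 - y)
            else 1)) * \det (v *m (face_edges p tau)^T).

Definition small_map k (kk : {ffun 'I_n -> 'I_k}) (x : 'rV[R]_n) : 'rV[R]_n :=
  k%:R^-1 *: (\row_i (kk i)%:R + x).

Definition cubical_form p k (kk : {ffun 'I_n -> 'I_k}) (tau : face n) :
    pform R n p := fun x v =>
  (\prod_i (x 0 i ^+ kk i * (1 - x 0 i) ^+ (k - 1 - kk i))) *
  whitney_form tau x v.

End UnitCube.

(* The cells of the mesh are the images of the faces of the unit cube under the
   affine bijections phi s; a cell may arise from several pairs (s, tau). *)
Record cubical_mesh (R : realType) (n : nat) (Omega : set 'rV[R]_n) := CubicalMesh {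
  ncell : finType;
  phi : ncell -> 'rV[R]_n * 'M[R]_n;
  cell (s : ncell) (tau : face n) : set 'rV[R]_n :=
    affine (phi s) @` face_set tau;
  phi_unit : forall s, (phi s).2 \in unitmx;
  ncell_inj : injective (fun s => cell s (cube_face n));
  mesh_cover : \bigcup_s cell s (cube_face n) = Omega;
  mesh_meet : forall s tau s' tau',
    cell s tau `&` cell s' tau' = set0 \/
    exists rho rho' : face n,
      [/\ @face_set R n rho `<=` face_set tau,
          @face_set R n rho' `<=` face_set tau',
          cell s tau `&` cell s' tau' = cell s rho &
          cell s tau `&` cell s' tau' = cell s' rho']
}.

Section Mesh.
Context {R : realType} {n : nat} {Omega : set 'rV[R]_n}.
Context (K : cubical_mesh Omega).

Definition cell_volume (s : ncell K) (tau : face n) : R :=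
  pvolume (face_edges (fdim tau) tau *m (phi s).2).

Definition fullness (s : ncell K) (tau : face n) : R :=
  cell_volume s tau / diam (cell s tau) ^+ fdim tau.

Definition small_cell k (s : ncell K) (kk : {ffun 'I_n -> 'I_k})
    (tau : face n) : set 'rV[R]_n :=
  affine (phi s) @` (small_map kk @` face_set tau).

(* S^p(K_k) *)
Definition small_cells k p : set (set 'rV[R]_n) :=
  [set u | exists (s : ncell K) (kk : {ffun 'I_n -> 'I_k}) (tau : face n),
             fdim tau = p /\ u = small_cell s kk tau].

(* The orientation of a cell u of K_k is recorded by a positively oriented
   affine parametrization [0,1]^p -> u; vertices are positively oriented. *)
Record orientation k p := Orientation {
  ocell : set 'rV[R]_n -> 'rV[R]_n * 'M[R]_(p, n);
  ocellP : forall u, small_cells k p u ->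
    row_free (ocell u).2 /\ affine (ocell u) @` @unit_cube R p = u
}.

(* A piecewise form on Omega has one value per n-cell at the common points of
   several n-cells. *)
Definition pwform p := ncell K -> pform R n p.

(* the cubical form of u regarded as a small cube of s, up to sign; it does not
   depend on the pair (kk, tau) representing u, and is 0 if u is not a small
   cube of s *)
Definition local_form k p (u : set 'rV[R]_n) (s : ncell K) : pform R n p :=
  if [pick kt : {ffun 'I_n -> 'I_k} * face n |
        `[< fdim kt.2 = p /\ small_cell s kt.1 kt.2 = u >]] is Some kt
  then fun x v => cubical_form kt.1 kt.2 ((x - (phi s).1) *m invmx (phi s).2)
                                         (v *m invmx (phi s).2)
  else fun _ _ => 0.

Definition small_form k p (o : orientation k p) (u : set 'rV[R]_n) : pwform p :=
  fun s x v => Num.sg (integral_cell (ocell o u) (local_form k u s)) *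
               local_form k u s x v.

(* Q_k^p(K), the span of the small_form o u for u in S^p(K_k) *)
Definition Qspace k p (o : orientation k p) : set (pwform p) :=
  [set eta | exists (m : nat) (u : 'I_m -> set 'rV[R]_n) (c : 'I_m -> R),
     (forall i, small_cells k p (u i)) /\
     eta = fun s x v => \sum_i c i * small_form o (u i) s x v].

(* A p-cochain on K_k is a function of the p-cells; only its values on
   small_cells k p matter. *)
Definition deRham k p (o : orientation k p) (omega : pform R n p) :
    set 'rV[R]_n -> R := fun u => integral_cell (ocell o u) omega.

(* The integral of a piecewise form over u is computed in the n-cells
   containing u; for elements of Qspace o all of them give the same value. *)
Definition interpolates k p (o : orientation k p) (X : set 'rV[R]_n -> R) :
    set (pwform p) :=
  [set eta | Qspace o eta /\
     forall u, small_cells k p u ->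
     forall s, u `<=` cell s (cube_face n) ->
       integral_cell (ocell o u) (eta s) = X u].

Definition interpolation k p (o : orientation k p) (X : set 'rV[R]_n -> R) :
    ncell K -> pform R n p :=
  get (interpolates o X : set (ncell K -> pform R n p)).

End Mesh.

(* Main.v *)
From HB Require Import structures.
Require Import Defs.
From mathcomp Require Import all_boot all_order all_algebra all_fingroup.
From mathcomp Require Import all_classical all_reals all_analysis.
From mathcomp Require Import ring lra zify.
Import numFieldNormedType.Exports.
Import Order.TTheory GRing.Theory Num.Theory.

Set Implicit Arguments.
Unset Strict Implicit.
Unset Printing Implicit Defensive.

Local Open Scope classical_set_scope.
Local Open Scope ring_scope.

(** On an n-cell, with affine parametrization E : [0,1]^n -> cell, the interpolant
is the only form in the local span that has the same integrals as omega over
the small p-cells.  Pulled back to the unit cube, this span splits: the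
component along a set I of p directions is a tensor product of spaces of
polynomials in one variable, of degree at most k - 1 in the directions of I and
at most k in the others, and the integrals are tensor products of means over
intervals of length 1/k and of values at multiples of 1/k.  A polynomial of
degree at most k with k + 1 zeros vanishes, so the one-dimensional problems are
unisolvent ([dof1_ker]), hence so is their product ([dofs_left_inverse]), and
the coefficients are bounded by the data with a constant that depends on n and
k only ([dofs_bound]).

Every component of the span contains all polynomials of degree less than k
([poly_le_span]).  So the error in a component of the pullback is at most a
constant times its Taylor remainder ([component_bound]).  If d is the diameter
of the cell, the rows of the matrix of E are at most d long; a component of the
pullback is omega evaluated on p of these rows, and its Taylor remainder of
order k is O(d^(p+k)) ([face_component_error]).  Going back to the cell brings
in p-minors of the inverse matrix, whose entries are O(1 / (CTheta d)) by
Cramer's rule, because CTheta d^n bounds the determinant from below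
([invmx_bound]).  The powers d^p cancel and d^k / CTheta^p remains.

The interpolant must also be shown to exist ([interpolates_exists]).  Its
coefficients solve a square linear system indexed by the p-cells of the refined
mesh, and a solution of the homogeneous system vanishes on each n-cell by local
unisolvence.  This needs that the integral of a basis form over a small cell is
the same in all n-cells that contain it ([integral_small_form_indep]).  The
reason is rigidity: an affine bijection between faces of cubes is a signed
permutation of the coordinates ([signed_permutation]), and the one-dimensional
small cells, polynomials and integrals are invariant under x -> 1 - x
([common_face]).  The same rigidity shows that any affine
parametrization of a small cell moves one coordinate at a time
([cell_parametrization]), so that integrals of basis forms are products. *)

(** * Iterated integrals of Lipschitz functions over the unit cube *)

Section CubeIntegral.
Context {R : realType}.
Local Notation mu := (@lebesgue_measure R).

(** The sum of coordinate distances behaves well under fixing one coordinate,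
    which is what the induction on the dimension of the cube needs. *)
Definition cube_lipschitz p (L : R) (f : 'rV[R]_p -> R) : Prop :=
  forall x y, unit_cube x -> unit_cube y ->
    `|f x - f y| <= L * \sum_i `|x 0 i - y 0 i|.

Definition slice p (t : R) (y : 'rV[R]_p) : 'rV[R]_p.+1 :=
  row_mx (t%:M : 'rV_1) y.

Lemma slice0 p (t : R) (y : 'rV[R]_p) : slice t y 0 ord0 = t.
Proof.
rewrite /slice mxE; case: splitP => j; first by rewrite ord1 mxE eqxx.
by move=> /eqP.
Qed.

Lemma sliceS p (t : R) (y : 'rV[R]_p) i : slice t y 0 (lift ord0 i) = y 0 i.
Proof.
rewrite /slice mxE; case: splitP => [j|j] /=.
  by rewrite ord1 => /eqP.
by rewrite /bump leq0n => -[] /ord_inj ->.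
Qed.

Lemma slice_cube p (t : R) (y : 'rV[R]_p) :
  0 <= t <= 1 -> unit_cube y -> unit_cube (slice t y).
Proof.
move=> t01 y01 i; case: (unliftP ord0 i) => [j ->|->].
  by rewrite sliceS.
by rewrite slice0.
Qed.

Lemma lipschitz_integrable (L : R) (F : R -> R) :
  (forall s t, 0 <= s <= 1 -> 0 <= t <= 1 -> `|F s - F t| <= L * `|s - t|) ->
  mu.-integrable `[0, 1] (EFin \o F).
Proof.
move=> LF; apply: continuous_compact_integrable; first exact: segment_compact.
apply/subspace_continuousP => x /=; rewrite in_itv/= => x01.
apply/cvgrPdist_le => e e0.
rewrite near_withinE; near=> t => /=; rewrite in_itv/= => t01.
apply: le_trans (LF _ _ x01 t01) _.
have : `|x - t| <= e / (`|L| + 1).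
  near: t; apply: cvgr_dist_le; last by rewrite divr_gt0// ltr_wpDl.
  exact: cvg_id.
rewrite ler_pdivlMr ?ltr_wpDl//; apply: le_trans.
rewrite mulrC ler_wpM2l//.
by rewrite (le_trans (ler_norm _))// lerDl.
Unshelve. all: by end_near. Qed.

Lemma cube_lipschitz_slice p (L : R) (f : 'rV[R]_p.+1 -> R) t :
  0 <= t <= 1 -> cube_lipschitz L f -> cube_lipschitz L (f \o slice t).
Proof.
move=> t01 Lf x y x01 y01 /=.
have := Lf _ _ (slice_cube t01 x01) (slice_cube t01 y01).
rewrite big_ord_recl !slice0 subrr normr0 add0r.
by rewrite (eq_bigr (fun i => `|x 0 i - y 0 i|)) => [//|i _]; rewrite !sliceS.
Qed.

Lemma cube_integralS p (f : 'rV[R]_p.+1 -> R) :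
  cube_integral f = \int[mu]_(t in `[0, 1]) cube_integral (f \o slice t).
Proof. by []. Qed.

(** Besides bounding integrals, this gives the regularity used to go up one
    dimension: applied to two slices of f, it shows that the integral of a slice is
    a Lipschitz, hence integrable, function of the remaining variable. *)
Lemma cube_integral_dist p (L M e : R) (f g : 'rV[R]_p -> R) :
  cube_lipschitz L f -> cube_lipschitz M g ->
  (forall x, unit_cube x -> `|f x - g x| <= e) ->
  `|cube_integral f - cube_integral g| <= e.
Proof.
elim: p L M e f g => [|p IH] L M e f g Lf Lg fg /=.
  by apply: fg => -[].
have LI (K : R) (h : 'rV[R]_p.+1 -> R) : cube_lipschitz K h ->
    mu.-integrable `[0, 1] (EFin \o (fun t => cube_integral (h \o slice t))).
  move=> Lh; apply: (@lipschitz_integrable K) => s t s01 t01.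
  apply: IH; [exact: cube_lipschitz_slice Lh|exact: cube_lipschitz_slice Lh|].
  move=> x x01 /=.
  have := Lh _ _ (slice_cube s01 x01) (slice_cube t01 x01).
  rewrite big_ord_recl !slice0 big1 ?addr0//.
  by move=> i _; rewrite !sliceS subrr normr0.
rewrite -RintegralB//; [|exact: LI Lf|exact: LI Lg].
have iB : mu.-integrable `[0, 1] (EFin \o (fun t =>
    cube_integral (f \o slice t) - cube_integral (g \o slice t))).
  by apply: (integrableB _ (LI _ _ Lf) (LI _ _ Lg)).
apply: le_trans (le_normr_Rintegral _ iB) _ => //.
have ic : mu.-integrable `[0, 1] (EFin \o cst e).
  by apply: (@lipschitz_integrable 0) => s t _ _; rewrite subrr normr0 mul0r.
apply: (@le_trans _ _ (\int[mu]_(x in `[0, 1]) cst e x)).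
  apply: le_Rintegral => //; first exact: integrable_norm iB.
  move=> t /=; rewrite in_itv/= => t01.
  apply: IH; [exact: cube_lipschitz_slice Lf|exact: cube_lipschitz_slice Lg|].
  by move=> x x01; apply/fg/slice_cube.
rewrite Rintegral_cst//=; rewrite lebesgue_measure_itv/= lte_fin ltr01.
by rewrite oppr0 adde0 /= mulr1.
Qed.

Lemma cube_integral_slice_integrable p (L : R) (f : 'rV[R]_p.+1 -> R) :
  cube_lipschitz L f ->
  mu.-integrable `[0, 1] (EFin \o (fun t => cube_integral (f \o slice t))).
Proof.
move=> Lh; apply: (@lipschitz_integrable L) => s t s01 t01.
apply: cube_integral_dist;
  [exact: cube_lipschitz_slice Lh|exact: cube_lipschitz_slice Lh|].
move=> x x01 /=.
have := Lh _ _ (slice_cube s01 x01) (slice_cube t01 x01).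
rewrite big_ord_recl !slice0 big1 ?addr0//.
by move=> i _; rewrite !sliceS subrr normr0.
Qed.

Lemma eq_cube_integral p (f g : 'rV[R]_p -> R) :
  (forall x, unit_cube x -> f x = g x) -> cube_integral f = cube_integral g.
Proof.
elim: p f g => [|p IH] f g fg; first by apply: fg => -[].
rewrite !cube_integralS; apply: eq_Rintegral => t; rewrite inE/= in_itv/= => t01.
by apply: IH => x x01; exact/fg/slice_cube.
Qed.

(** A class of integrands that contains the polynomials and the smooth forms,
    is closed under products, and on which the iterated integral is linear. *)
Definition lipC p (f : 'rV[R]_p -> R) : Prop := exists L, cube_lipschitz L f.

Lemma lipC_slice p (f : 'rV[R]_p.+1 -> R) t :
  0 <= t <= 1 -> lipC f -> lipC (f \o slice t).
Proof. by move=> t01 [L Lf]; exists L; exact: cube_lipschitz_slice. Qed.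

Lemma lipC_cst p c : lipC (fun _ : 'rV[R]_p => c).
Proof. by exists 0 => x y _ _; rewrite subrr normr0 mul0r. Qed.

Lemma lipC_coord p (i : 'I_p) : lipC (fun x : 'rV[R]_p => x 0 i).
Proof.
exists 1 => x y _ _; rewrite mul1r (bigD1 i)//= lerDl.
by apply: sumr_ge0.
Qed.

Lemma lipCD p (f g : 'rV[R]_p -> R) :
  lipC f -> lipC g -> lipC (fun x => f x + g x).
Proof.
move=> [L Lf] [M Lg]; exists (L + M) => x y x01 y01.
rewrite opprD addrACA mulrDl (le_trans (ler_normD _ _))//.
by rewrite lerD// ?Lf ?Lg.
Qed.

Lemma lipC_bounded p (f : 'rV[R]_p -> R) : lipC f ->
  exists B, 0 <= B /\ forall x, unit_cube x -> `|f x| <= B.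
Proof.
move=> [L Lf]; exists (`|L| * p%:R + `|f 0|); split.
  by rewrite addr_ge0// mulr_ge0.
move=> x x01; rewrite -[X in `|X|](subrK (f 0)).
rewrite (le_trans (ler_normD _ _))// lerD2r.
have c0 : unit_cube (0 : 'rV[R]_p) by move=> i; rewrite mxE lexx ler01.
rewrite (le_trans (Lf _ _ x01 c0))//.
apply: (@le_trans _ _ (`|L| * \sum_i `|x 0 i - (0 : 'rV[R]_p) 0 i|)).
  by rewrite ler_wpM2r ?ler_norm// sumr_ge0.
rewrite ler_wpM2l//.
apply: le_trans (_ : \sum_(i < p) 1 <= _); last by rewrite sumr_const card_ord.
apply: ler_sum => i _; rewrite mxE subr0 ger0_norm; by case/andP: (x01 i).
Qed.

Lemma lipCM p (f g : 'rV[R]_p -> R) :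
  lipC f -> lipC g -> lipC (fun x => f x * g x).
Proof.
move=> lf lg.
have [B [B0 fB]] := lipC_bounded lf; have [C [C0 gC]] := lipC_bounded lg.
case: lf => L Lf; case: lg => M Lg.
exists (B * `|M| + C * `|L|) => x y x01 y01.
set S := \sum_i _.
have S0 : 0 <= S by exact: sumr_ge0.
have -> : f x * g x - f y * g y = f x * (g x - g y) + g y * (f x - f y) by ring.
rewrite (le_trans (ler_normD _ _))// !normrM mulrDl -!mulrA.
apply: lerD; apply: ler_pM => //; rewrite ?fB ?gC//.
  by rewrite (le_trans (Lg _ _ x01 y01))// ler_wpM2r// ler_norm.
by rewrite (le_trans (Lf _ _ x01 y01))// ler_wpM2r// ler_norm.
Qed.

Lemma eq_lipC p (f g : 'rV[R]_p -> R) : f =1 g -> lipC f -> lipC g.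
Proof. by move=> /funext ->. Qed.

Lemma lipCZ p c (f : 'rV[R]_p -> R) : lipC f -> lipC (fun x => c * f x).
Proof. by apply: lipCM; exact: lipC_cst. Qed.

Lemma lipC_sum p (I : Type) (r : seq I) (P : pred I) (F : I -> 'rV[R]_p -> R) :
  (forall i, P i -> lipC (F i)) -> lipC (fun x => \sum_(i <- r | P i) F i x).
Proof.
move=> lF; elim: r => [|i r IH].
  by apply: eq_lipC (lipC_cst _ 0) => x; rewrite big_nil.
have [Pi|nPi] := boolP (P i).
  by apply: eq_lipC (lipCD (lF _ Pi) IH) => x; rewrite big_cons Pi.
by apply: eq_lipC IH => x; rewrite big_cons (negbTE nPi).
Qed.

Lemma lipC_prod p (I : Type) (r : seq I) (P : pred I) (F : I -> 'rV[R]_p -> R) :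
  (forall i, P i -> lipC (F i)) -> lipC (fun x => \prod_(i <- r | P i) F i x).
Proof.
move=> lF; elim: r => [|i r IH].
  by apply: eq_lipC (lipC_cst _ 1) => x; rewrite big_nil.
have [Pi|nPi] := boolP (P i).
  by apply: eq_lipC (lipCM (lF _ Pi) IH) => x; rewrite big_cons Pi.
by apply: eq_lipC IH => x; rewrite big_cons (negbTE nPi).
Qed.

Lemma lipC_exp p (f : 'rV[R]_p -> R) m : lipC f -> lipC (fun x => f x ^+ m).
Proof.
move=> lf; elim: m => [|m IH]; first exact: lipC_cst.
by apply: eq_lipC (lipCM lf IH) => x; rewrite exprS.
Qed.

Lemma lipC_horner p (q : {poly R}) (f : 'rV[R]_p -> R) :
  lipC f -> lipC (fun x => q.[f x]).
Proof.
move=> lf; apply: (@eq_lipC _ (fun x => \sum_(i < size q) q`_i * f x ^+ i)).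
  by move=> x; rewrite horner_coef.
by apply: lipC_sum => i _; apply/lipCZ/lipC_exp.
Qed.

Lemma lipC_affine n p (c : 'rV[R]_n * 'M[R]_(p, n)) i :
  lipC (fun t : 'rV[R]_p => affine c t 0 i).
Proof.
apply: (@eq_lipC _ (fun t => c.1 0 i + \sum_j t 0 j * c.2 j i)).
  by move=> t; rewrite /affine !mxE.
apply: lipCD; first exact: lipC_cst.
by apply: lipC_sum => j _; apply: lipCM; [exact: lipC_coord|exact: lipC_cst].
Qed.

Lemma cube_integralD p (f g : 'rV[R]_p -> R) : lipC f -> lipC g ->
  cube_integral (fun x => f x + g x) = cube_integral f + cube_integral g.
Proof.
elim: p f g => [//|p IH] f g lf lg; rewrite !cube_integralS.
rewrite -RintegralD//; last 2 first.
- by case: lf => L Lf; exact: cube_integral_slice_integrable Lf.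
- by case: lg => L Lg; exact: cube_integral_slice_integrable Lg.
apply: eq_Rintegral => t; rewrite inE/= in_itv/= => t01.
by rewrite -IH//; exact: lipC_slice.
Qed.

Lemma cube_integralZ p c (f : 'rV[R]_p -> R) : lipC f ->
  cube_integral (fun x => c * f x) = c * cube_integral f.
Proof.
elim: p f => [//|p IH] f lf; rewrite !cube_integralS.
rewrite -RintegralZl//; last first.
  by case: lf => L Lf; exact: cube_integral_slice_integrable Lf.
apply: eq_Rintegral => t; rewrite inE/= in_itv/= => t01.
by rewrite -IH//; exact: lipC_slice.
Qed.

Lemma cube_integral0 p : cube_integral (fun _ : 'rV[R]_p => 0 : R) = 0.
Proof.
rewrite -[RHS](mul0r (cube_integral (fun _ : 'rV[R]_p => 1))).
rewrite -(cube_integralZ _ (lipC_cst p 1)).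
by apply: eq_cube_integral => x _; rewrite mul0r.
Qed.

Lemma cube_integral_sum p (I : Type) (r : seq I) (P : pred I)
    (F : I -> 'rV[R]_p -> R) : (forall i, P i -> lipC (F i)) ->
  cube_integral (fun x => \sum_(i <- r | P i) F i x) =
  \sum_(i <- r | P i) cube_integral (F i).
Proof.
move=> lF; elim: r => [|i r IH].
  rewrite big_nil; apply: etrans (cube_integral0 p).
  by apply: eq_cube_integral => x _; rewrite big_nil.
rewrite big_cons -IH; case: ifPn => Pi.
  rewrite -cube_integralD//; [|exact: lF|exact: lipC_sum].
  by apply: eq_cube_integral => x _; rewrite big_cons Pi.
by apply: eq_cube_integral => x _; rewrite big_cons (negbTE Pi).
Qed.

Lemma continuous_horner (q : {poly R}) : continuous (horner q).
Proof.
move=> x; apply: differentiable_continuous.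
exact/derivable1_diffP/derivable_horner.
Qed.

Lemma Rintegral_deriv_poly (q : {poly R}) :
  \int[mu]_(t in `[0, 1]) (q^`()).[t] = q.[1] - q.[0].
Proof.
rewrite /Rintegral (@continuous_FTC2 _ _ (horner q))//.
- by apply: continuous_subspaceT => x; exact: continuous_horner.
- split; first by move=> x _; exact: derivable_horner.
  + by apply: cvg_at_right_filter; exact: continuous_horner.
  + by apply: cvg_at_left_filter; exact: continuous_horner.
- by move=> x _; rewrite derivE.
Qed.

Lemma cube_integral_prod p (G : 'I_p -> {poly R}) :
  cube_integral (fun t => \prod_a (G a).[t 0 a]) =
  \prod_a \int[mu]_(t in `[0, 1]) (G a).[t].
Proof.
elim: p G => [|p IH] G; first by rewrite /= !big_ord0.
rewrite cube_integralS big_ord_recl -IH -RintegralZr//; last first.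
  apply: continuous_compact_integrable; first exact: segment_compact.
  by apply: continuous_subspaceT => x; exact: continuous_horner.
apply: eq_Rintegral => t _.
rewrite -cube_integralZ; last first.
  by apply: lipC_prod => i _; apply/lipC_horner/lipC_coord.
apply: eq_cube_integral => x _ /=; rewrite big_ord_recl slice0.
by congr (_ * _); apply: eq_bigr => i _; rewrite sliceS.
Qed.

End CubeIntegral.

(** * Taylor expansion along segments *)

Section Taylor.
Context {R : realType}.

(** G m is meant to be the m-th derivative of G 0.  The remainder of order k + 1
    vanishes at 0, and its derivative is the remainder of order k of G 1; the mean
    value theorem on a subinterval of [0,1] preserves the bound M. *)
Lemma taylor_unit (k : nat) (G : nat -> R -> R) (M : R) :
  (forall m (t : R), 0 <= t <= 1 -> is_derive t 1 (G m) (G m.+1 t)) ->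
  (forall t : R, 0 <= t <= 1 -> `|G k t| <= M) ->
  forall t : R, 0 <= t <= 1 ->
  `|G 0 t - \sum_(m < k) G m 0 * t ^+ m / m`!%:R| <= M.
Proof.
elim: k G => [|k IH] G dG GM t t01.
  by rewrite big_ord0 subr0 GM.
have {}IH := IH (fun m => G m.+1) (fun m => dG m.+1) GM.
pose D s := G 0 s - \sum_(m < k.+1) G m 0 * s ^+ m / m`!%:R.
pose dD s := G 1 s - \sum_(m < k) G m.+1 0 * s ^+ m / m`!%:R.
have dE (s : R) : 0 <= s <= 1 -> is_derive s 1 D (dD s).
  move=> s01; have d0 := dG 0 s s01.
  pose q : {poly R} := \poly_(m < k.+1) (G m 0 / m`!%:R).
  have -> : D = G 0 - horner q.
    apply/funext => u; rewrite /D /= !fctE horner_poly; congr (_ - _).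
    by apply: eq_bigr => m _; rewrite mulrAC.
  have -> : dD s = G 1 s - q^`().[s].
    rewrite /dD /q; congr (_ - _).
    rewrite (@horner_coef_wide _ k); last first.
      by rewrite (leq_trans (size_poly _ _))// -subn1 leq_subLR add1n size_poly.
    apply: eq_bigr => m _; rewrite coef_deriv coef_poly ltnS ltn_ord.
    rewrite factS natrM -[_ *+ m.+1]mulr_natr.
    have m1 : (m.+1%:R : R) != 0 by rewrite pnatr_eq0.
    have m2 : (m`!%:R : R) != 0 by rewrite pnatr_eq0 -lt0n fact_gt0.
    by field; rewrite m2 nat1r m1.
  have dq : is_derive s 1 (horner q) q^`().[s].
    by apply: DeriveDef; [exact: derivable_horner|rewrite derivE derive1E].
  exact: is_deriveB.
have D0 : D 0 = 0.
  rewrite /D big_ord_recl expr0 fact0 divr1 mulr1 big1 ?addr0 ?subrr// => i _.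
  by rewrite expr0n mulr0 mul0r.
have /andP[t0 t1] := t01.
have [c] : exists2 c, c \in `[0, t] & D t - D 0 = dD c * (t - 0).
  apply: MVT_segment => //.
  - move=> s; rewrite in_itv/= => /andP[s0 s1]; apply: dE.
    by rewrite (ltW s0) (le_trans (ltW s1)).
  - apply: derivable_within_continuous => s; rewrite in_itv/= => /andP[s0 s1].
    by case: (dE s); rewrite // s0 (le_trans s1).
rewrite in_itv/= => /andP[c0 ct]; rewrite D0 !subr0 -/(D t) => ->.
have c01 : 0 <= c <= 1 by rewrite c0 (le_trans ct).
rewrite normrM (ger0_norm t0) -[leRHS]mulr1.
by rewrite ler_pM// IH.
Qed.

(** The m-th derivative, in the direction y, of the iterated partial derivative
    along s.  The new partial derivatives are added in front of s, so mixed
    derivatives never have to be commuted. *)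
Fixpoint dirder n (y : 'rV[R]_n) (f : 'rV[R]_n -> R) m (s : seq 'I_n)
    (x : 'rV[R]_n) : R :=
  if m is m'.+1 then \sum_i y 0 i * dirder y f m' (i :: s) x
  else iter_partial s f x.

Section Directional.
Context {n : nat} (U : set 'rV[R]_n) (f : 'rV[R]_n -> R).
Hypothesis fU : smooth_fun U f.

Lemma is_derive_iter_partial s x y t : U (x + t *: y) ->
  is_derive t 1 (fun u => iter_partial s f (x + u *: y))
    (\sum_i y 0 i * iter_partial (i :: s) f (x + t *: y)).
Proof.
move=> Ut; have df := fU s Ut.
pose l : R -> 'rV[R]_n := cst x + ( *:%R ^~ y).
have lE u : l u = x + u *: y by [].
have dl : is_diff t l (0 + ( *:%R ^~ y)) by exact: is_diffD.
have dg : is_diff (l t) (iter_partial s f) ('d (iter_partial s f) (l t)).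
  exact: DiffDef.
have dc := is_diff_comp dl dg.
apply: DeriveDef; first exact: diff_derivable.
rewrite (_ : (fun u => _) = iter_partial s f \o l)// deriveE// diff_val /=.
rewrite !fctE add0r scale1r {1}(row_sum_delta y) linear_sum.
by apply: eq_bigr => i _; rewrite linearZ /= -[in RHS]lE deriveE.
Qed.

Lemma is_derive_dirder m s x y t : U (x + t *: y) ->
  is_derive t 1 (fun u => dirder y f m s (x + u *: y))
    (dirder y f m.+1 s (x + t *: y)).
Proof.
move=> Ut; elim: m s => [|m IH] s; first exact: is_derive_iter_partial.
rewrite [X in is_derive _ _ _ X]/=.
rewrite (_ : (fun u => _) = \sum_i (fun u => y 0 i * dirder y f m (i :: s) (x + u *: y))).
  have dh i := is_deriveZ (y 0 i) (IH (i :: s)).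
  exact: (is_derive_sum dh).
by apply/funext => u; rewrite fct_sumE.
Qed.

Lemma dirder_bound (B M : R) m (s : seq 'I_n) (x y : 'rV[R]_n) :
  0 <= B -> (forall i, `|y 0 i| <= B) ->
  (forall s' : seq 'I_n, size s' = (m + size s)%N -> `|iter_partial s' f x| <= M) ->
  `|dirder y f m s x| <= (n%:R * B) ^+ m * M.
Proof.
move=> B0 yB; elim: m s => [|m IH] s fM /=; first by rewrite mul1r fM.
apply: le_trans (ler_norm_sum _ _ _) _.
apply: le_trans (_ : \sum_(i < n) B * ((n%:R * B) ^+ m * M) <= _).
  apply: ler_sum => i _; rewrite normrM ler_pM// IH// => s' s'E.
  by apply: fM; rewrite s'E addSnnS.
by rewrite sumr_const card_ord -[_ *+ n]mulr_natl exprS !mulrA lexx.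
Qed.

Lemma taylor_segment k (M B : R) (x y : 'rV[R]_n) :
  0 <= B -> (forall i, `|y 0 i| <= B) ->
  (forall t : R, 0 <= t <= 1 -> U (x + t *: y)) ->
  (forall (t : R) (s : seq 'I_n), 0 <= t <= 1 -> size s = k ->
     `|iter_partial s f (x + t *: y)| <= M) ->
  `|f (x + y) - \sum_(m < k) dirder y f m [::] x / m`!%:R| <= (n%:R * B) ^+ k * M.
Proof.
move=> B0 yB xyU fM.
have := @taylor_unit k (fun m t => dirder y f m [::] (x + t *: y))
  ((n%:R * B) ^+ k * M).
move=> /(_ _ _ 1); rewrite lexx ler01 /= scale1r.
under eq_bigr do rewrite expr1n mulr1 scale0r addr0.
apply=> //.
- by move=> m t t01; apply: is_derive_dirder; exact: xyU.
- move=> t t01; apply: dirder_bound => // s'; rewrite addn0; exact: fM.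
Qed.

End Directional.

End Taylor.

(** * Bounds on a compact domain, and polynomials of bounded degree *)

Section Compactness.
Context {R : realType} {n : nat}.

Lemma continuous_affine p (c : 'rV[R]_n * 'M[R]_(p, n)) : continuous (affine c).
Proof.
have cs (r : seq 'I_p) :
    continuous (fun t : 'rV[R]_p => \sum_(i <- r) t 0 i *: row i c.2).
  elim: r => [|i r IH] t.
    rewrite (_ : (fun t => _) = cst 0); first exact: cst_continuous.
    by apply/funext => u; rewrite big_nil.
  rewrite (_ : (fun t => _) = (fun t : 'rV[R]_p => t 0 i *: row i c.2) +
      (fun t : 'rV[R]_p => \sum_(i <- r) t 0 i *: row i c.2)).
    apply: continuousD; last exact: IH.
    apply: continuousZ; last exact: cst_continuous.
    exact: (@coord_continuous R 1 p 0 i).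
  by apply/funext => u; rewrite big_cons.
have -> : affine c = (fun=> c.1) +
    (fun t : 'rV[R]_p => \sum_(i <- index_enum 'I_p) t 0 i *: row i c.2).
  by apply/funext => u; rewrite /affine mulmx_sum_row.
by move=> t; apply: continuousD; [exact: cst_continuous|exact: cs].
Qed.

Lemma face_set_cube_face : @face_set R n (cube_face n) = unit_cube (n := n).
Proof.
by apply/seteqP; split => x xc i; have := xc i; rewrite ffunE.
Qed.

(** This is why the constant of the theorem can be chosen before the mesh: either
    there is no mesh at all, or the domain is compact and the derivatives of omega
    are bounded on it. *)
Lemma mesh_compact (Omega : set 'rV[R]_n) (K : cubical_mesh Omega) :
  compact Omega.
Proof.
rewrite -(mesh_cover K).
rewrite (_ : \bigcup_s _ = \big[setU/set0]_(s : ncell K) cell s (cube_face n)).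
  apply: bigsetU_compact => s _.
  apply: continuous_compact; first exact/continuous_subspaceT/continuous_affine.
  rewrite face_set_cube_face.
  rewrite (_ : unit_cube (n := n) = [set x | forall i, [set` `[0, 1]] (x ord0 i)]).
    exact: (rV_compact (A := fun=> _) (fun=> @segment_compact _ _ _)).
  by apply/funext => x; apply: eq_forall => i; rewrite /= in_itv.
rewrite -bigcup_seq; apply/seteqP.
by split => x [s _ xs]; exists s; rewrite //= mem_index_enum.
Qed.

Lemma smooth_bounded (A U : set 'rV[R]_n) (f : 'rV[R]_n -> R) s :
  compact A -> A `<=` U -> smooth_fun U f ->
  exists M, 0 <= M /\ forall x, A x -> `|iter_partial s f x| <= M.
Proof.
move=> cA AU fU.
have cf : {within A, continuous (iter_partial s f)}.
  apply: continuous_in_subspaceT => x; rewrite inE => Ax.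
  exact: differentiable_continuous (fU s x (AU _ Ax)).
have /compact_bounded[M [_ HM]] := continuous_compact cf cA.
exists (`|M| + 1); split; first by rewrite addr_ge0.
move=> x Ax; apply: HM; last by exists x.
by rewrite (le_lt_trans (ler_norm _))// ltrDl.
Qed.

Lemma smooth_bounded_order (A U : set 'rV[R]_n) (f : 'rV[R]_n -> R) k :
  compact A -> A `<=` U -> smooth_fun U f ->
  exists M, 0 <= M /\ forall s x, size s = k -> A x -> `|iter_partial s f x| <= M.
Proof.
move=> cA AU fU.
have /choice[M HM] : forall s : k.-tuple 'I_n, exists M,
   0 <= M /\ forall x, A x -> `|iter_partial s f x| <= M.
  by move=> s; exact: smooth_bounded fU.
exists (\sum_s M s); split; first by apply: sumr_ge0 => s _; case: (HM s).
move=> s x /eqP sk Ax; case: (HM (Tuple sk)) => _ /(_ _ Ax) /= /le_trans; apply.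
rewrite (bigD1 (Tuple sk))//= lerDl sumr_ge0// => s' _; by case: (HM s').
Qed.

End Compactness.

(** An inductive description, rather than coefficients, because Taylor
    polynomials are built by exactly these operations. *)
Inductive poly_le (R : realType) (n : nat) : nat -> ('rV[R]_n -> R) -> Prop :=
| poly_le_cst d c : poly_le d (fun _ => c)
| poly_leD d f g : poly_le d f -> poly_le d g -> poly_le d (fun x => f x + g x)
| poly_leZ d c f : poly_le d f -> poly_le d (fun x => c * f x)
| poly_leX d i f : poly_le d f -> poly_le d.+1 (fun x => x 0 i * f x).

Section PolyLe.
Context {R : realType} {n : nat}.

Lemma poly_le_sum d (I : Type) (r : seq I) (P : pred I) (F : I -> 'rV[R]_n -> R) :
  (forall i, P i -> poly_le d (F i)) ->
  poly_le d (fun x => \sum_(i <- r | P i) F i x).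
Proof.
move=> dF; elim: r => [|i r IH].
  rewrite (_ : (fun x => _) = fun=> 0); first exact: poly_le_cst.
  by apply/funext => x; rewrite big_nil.
have [Pi|nPi] := boolP (P i).
  rewrite (_ : (fun x => _) = fun x => F i x + \sum_(j <- r | P j) F j x).
    by apply: poly_leD => //; exact: dF.
  by apply/funext => x; rewrite big_cons Pi.
rewrite (_ : (fun x => _) = fun x => \sum_(j <- r | P j) F j x)//.
by apply/funext => x; rewrite big_cons (negbTE nPi).
Qed.

Lemma poly_le_leq d e (f : 'rV[R]_n -> R) : (d <= e)%N -> poly_le d f -> poly_le e f.
Proof.
move=> de df; elim: df e de => {d f} [d c|d f g _ IHf _ IHg|d c f _ IHf|d i f _ IHf] e de.
- exact: poly_le_cst.
- by apply: poly_leD; [exact: IHf|exact: IHg].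
- by apply: poly_leZ; exact: IHf.
- by case: e de => // e de; apply: poly_leX; exact: IHf.
Qed.

(** A directional derivative of order m at a fixed point is homogeneous of
    degree m in the direction, and the direction is linear in t. *)
Lemma poly_le_dirder q (E : 'M[R]_(n, q)) (f : 'rV[R]_q -> R) m s x :
  poly_le m (fun t : 'rV[R]_n => dirder (t *m E) f m s x).
Proof.
elim: m s => [|m IH] s /=; first exact: poly_le_cst.
apply: poly_le_sum => i _.
rewrite (_ : (fun t => _) = fun t : 'rV[R]_n =>
    \sum_j t 0 j * (E j i * dirder (t *m E) f m (i :: s) x)).
  by apply: poly_le_sum => j _; apply/poly_leX/poly_leZ.
by apply/funext => t; rewrite mxE big_distrl; apply: eq_bigr => j _ /=; rewrite mulrA.
Qed.

End PolyLe.

(** * Alternating forms and determinants *)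

Section Alternating.
Context {R : realType}.

Definition setrow p n (i : 'I_p) (w : 'M[R]_(p, n)) (r : 'rV[R]_n) : 'M[R]_(p, n) :=
  \matrix_(a, j) if a == i then r 0 j else w a j.

Definition consrow p n (r : 'rV[R]_n) (w : 'M[R]_(p, n)) : 'M[R]_(p.+1, n) :=
  \matrix_(a, j) if unlift ord0 a is Some b then w b j else r 0 j.

Definition unit_rows p n (f : 'I_p -> 'I_n) : 'M[R]_(p, n) :=
  \matrix_(a, j) (f a == j)%:R.

Lemma row'_eq p n (i : 'I_p) (A B : 'M[R]_(p, n)) :
  (row' i B = row' i A) <-> (forall b j, b != i -> B b j = A b j).
Proof.
split=> [e b j bi|e].
  case: (unliftP i b) bi => [c ->|->]; last by rewrite eqxx.
  by move=> _; move/matrixP: e => /(_ c j); rewrite !mxE.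
by apply/matrixP => b j; rewrite !mxE e// eq_sym neq_lift.
Qed.

Lemma row_setrow p n (i : 'I_p) (w : 'M[R]_(p, n)) r : row i (setrow i w r) = r.
Proof. by apply/rowP => j; rewrite !mxE eqxx. Qed.

Lemma setrow_id p n (i : 'I_p) (w : 'M[R]_(p, n)) : setrow i w (row i w) = w.
Proof. by apply/matrixP => a j; rewrite !mxE; case: eqP => // ->. Qed.

Section Form.
Context {p n : nat} (g : 'M[R]_(p, n) -> R) (ag : alternating_form g).

Lemma alt_setrow_lin i w (b c : R) x y :
  g (setrow i w (b *: x + c *: y)) = b * g (setrow i w x) + c * g (setrow i w y).
Proof.
apply: (ag.1 _ _ _ i); rewrite ?row_setrow//;
by apply/row'_eq => a j /negbTE ai; rewrite !mxE ai.
Qed.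

Lemma alt_setrow0 i w : g (setrow i w 0) = 0.
Proof.
have := alt_setrow_lin i w 0 0 0 0.
by rewrite !scale0r addr0 !mul0r addr0.
Qed.

Lemma alt_setrow_sum i w (I : Type) (s : seq I) (b : I -> R) (x : I -> 'rV[R]_n) :
  g (setrow i w (\sum_(j <- s) b j *: x j)) = \sum_(j <- s) b j * g (setrow i w (x j)).
Proof.
elim: s => [|j s IH]; first by rewrite !big_nil alt_setrow0.
by rewrite !big_cons -[X in _ + X]scale1r alt_setrow_lin mul1r IH.
Qed.

Lemma alt_swap i j w : i != j -> g (row_perm (tperm i j) w) = - g w.
Proof.
move=> ij.
(* S x y puts x in row i and y in row j; S (x + y) (x + y) = 0 gives S x y + S y x = 0 *)
pose S x y := g (setrow i (setrow j w y) x).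
have S2 x y : S x y = g (setrow j (setrow i w x) y).
  congr g; apply/matrixP => a l; rewrite !mxE.
  by case: eqP => [->|//]; rewrite (negbTE ij).
have Sxx x : S x x = 0.
  apply: (ag.2 _ i j) => //; rewrite /S row_setrow.
  by apply/rowP => l; rewrite !mxE eq_sym (negbTE ij) eqxx.
have SDl x y z : S (x + y) z = S x z + S y z.
  by have := alt_setrow_lin i (setrow j w z) 1 1 x y; rewrite !scale1r !mul1r.
have SDr x y z : S z (x + y) = S z x + S z y.
  rewrite !S2.
  by have := alt_setrow_lin j (setrow i w z) 1 1 x y; rewrite !scale1r !mul1r.
have := Sxx (row i w + row j w).
rewrite SDl !SDr !Sxx add0r addr0.
have -> : S (row i w) (row j w) = g w by rewrite /S setrow_id setrow_id.
have -> : S (row j w) (row i w) = g (row_perm (tperm i j) w).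
  congr g; apply/matrixP => a l; rewrite !mxE.
  case: tpermP => [->|->|/eqP/negbTE ai /eqP/negbTE aj].
  - by rewrite eqxx.
  - by rewrite eq_sym (negbTE ij) eqxx.
  - by rewrite ai aj.
by move=> /eqP; rewrite addrC addr_eq0 => /eqP.
Qed.

Lemma alt_perm (s : 'S_p) w : g (row_perm s w) = (-1) ^+ s * g w.
Proof.
case: (prod_tpermP s) => ts -> {s}.
elim: ts w => [|[i j] ts IH] w /=.
  by rewrite big_nil row_perm1 odd_perm1 mul1r.
case/andP => ij dts; rewrite big_cons row_permM alt_swap// IH//.
by rewrite odd_permM odd_tperm ij /= signrN mulNr.
Qed.

End Form.

Lemma unit_rows_comp p n (f : 'I_p -> 'I_n) (s : 'S_p) :
  unit_rows (f \o s) = row_perm s (unit_rows f).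
Proof. by apply/matrixP => a j; rewrite !mxE. Qed.

Lemma mul_unit_rowsT p n (w : 'M[R]_(p, n)) q (f : 'I_q -> 'I_n) a b :
  (w *m (unit_rows f)^T) a b = w a (f b).
Proof.
rewrite mxE (bigD1 (f b))//= !mxE eqxx mulr1 big1 ?addr0// => j jf.
by rewrite !mxE eq_sym (negbTE jf) mulr0.
Qed.

Definition ffun_cons p n (u : 'I_n * {ffun 'I_p -> 'I_n}) : {ffun 'I_p.+1 -> 'I_n} :=
  [ffun a => if unlift ord0 a is Some b then u.2 b else u.1].

Lemma ffun_cons_bij p n : bijective (@ffun_cons p n).
Proof.
exists (fun f : {ffun 'I_p.+1 -> 'I_n} => (f ord0, [ffun b => f (lift ord0 b)])).
  move=> [j f]; rewrite /ffun_cons ffunE unlift_none /=; congr pair.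
  by apply/ffunP => b; rewrite !ffunE liftK.
move=> f; apply/ffunP => a; rewrite ffunE.
by case: unliftP => [b ->|->] //=; rewrite ffunE.
Qed.

(** Fixing the first row of a (p+1)-form leaves a p-form; this drives the
    induction in [alt_expand]. *)
Lemma alternating_consrow p n (g : 'M[R]_(p.+1, n) -> R) r :
  alternating_form g -> alternating_form (fun w => g (consrow r w)).
Proof.
move=> ag; split.
  move=> A B C i b c Ai /row'_eq BA /row'_eq CB.
  apply: (ag.1 _ _ _ (lift ord0 i)).
  - apply/rowP => j; rewrite !mxE liftK.
    by move/rowP: Ai => /(_ j); rewrite !mxE.
  - apply/row'_eq => a j; rewrite !mxE; case: unliftP => [a' ->|//] ai.
    by apply: BA; apply: contraNneq ai => ->.
  - apply/row'_eq => a j; rewrite !mxE; case: unliftP => [a' ->|//] ai.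
    by apply: CB; apply: contraNneq ai => ->.
move=> A i j ij Aij; apply: (ag.2 _ (lift ord0 i) (lift ord0 j)).
  by rewrite (inj_eq (@lift_inj _ _)).
by apply/rowP => l; rewrite !mxE !liftK; move/rowP: Aij => /(_ l); rewrite !mxE.
Qed.

Lemma alt_expand p n (g : 'M[R]_(p, n) -> R) w : alternating_form g ->
  g w = \sum_(f : {ffun 'I_p -> 'I_n}) (\prod_a w a (f a)) * g (unit_rows f).
Proof.
elim: p g w => [|p IH] g w ag.
  have g1 : forall v, g v = g w by move=> v; congr g; apply/matrixP => -[].
  under eq_bigr do rewrite big_ord0 mul1r g1.
  rewrite sumr_const -[X in _ *+ X]/(#|predT|) card_ffun card_ord /=.
  by rewrite card_ord expn0.
rewrite -{1}(setrow_id ord0 w) {1}(row_sum_delta (row ord0 w)).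
rewrite (alt_setrow_sum ag).
rewrite (reindex (@ffun_cons p n)) /=; last exact/onW_bij/ffun_cons_bij.
rewrite -(pair_bigA _ (fun j f => (\prod_a w a (ffun_cons (j, f) a)) * g (unit_rows (ffun_cons (j, f))))) /=.
apply: eq_bigr => j _.
have -> : setrow ord0 w (delta_mx 0 j) = consrow (delta_mx 0 j) (row' ord0 w).
  apply/matrixP => a l; rewrite !mxE.
  by case: unliftP => [b ->|->] //=; rewrite !mxE.
rewrite (IH (fun v => g (consrow (delta_mx 0 j) v)) _ (alternating_consrow _ ag)).
rewrite big_distrr; apply: eq_bigr => f _ /=.
rewrite big_ord_recl ffunE unlift_none !mxE /= !mulrA; congr (_ * _ * g _).
  by apply: eq_bigr => a _; rewrite !mxE ffunE liftK.
apply/matrixP => a l; rewrite !mxE ffunE.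
by case: unliftP => [b _|_] /=; rewrite ?mxE //= eq_sym.
Qed.

(** Averaging the expansion of g w over all permutations of the vectors e_(f a)
    collects the products of entries of w into minors of w.  Summing over all maps
    f instead of increasing ones is harmless: each minor is counted p! times. *)
Lemma alt_avg p n (g : 'M[R]_(p, n) -> R) w : alternating_form g ->
  p`!%:R * g w = \sum_(f : {ffun 'I_p -> 'I_n}) \det (w *m (unit_rows f)^T) * g (unit_rows f).
Proof.
move=> ag.
(* precomposing the indices with a permutation only changes the sign of g *)
have gs (s : 'S_p) : g w = \sum_(f : {ffun 'I_p -> 'I_n})
    (-1) ^+ s * (\prod_a w a (f (s a))) * g (unit_rows f).
  pose h (t : 'S_p) (f : {ffun 'I_p -> 'I_n}) : {ffun 'I_p -> 'I_n} := [ffun a => f (t a)].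
  have hb : bijective (h s).
    by exists (h s^-1%g) => f; apply/ffunP => a; rewrite !ffunE ?permK ?permKV.
  rewrite (alt_expand w ag) (reindex (h s)) /=; last exact/onW_bij.
  apply: eq_bigr => f _.
  have -> : unit_rows (h s f) = row_perm s (unit_rows f).
    by rewrite -unit_rows_comp; apply/matrixP => a j; rewrite !mxE ffunE.
  rewrite (alt_perm ag) mulrCA mulrA; congr (_ * _ * _).
  by apply: eq_bigr => a _; rewrite ffunE.
transitivity (\sum_(s : 'S_p) g w).
  by rewrite sumr_const card_Sn mulr_natl.
rewrite (eq_bigr _ (fun s _ => gs s)) exchange_big; apply: eq_bigr => f _ /=.
rewrite /determinant big_distrl; apply: eq_bigr => s _ /=.
by congr (_ * _ * _); apply: eq_bigr => a _; rewrite mul_unit_rowsT.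
Qed.

Lemma alternating_mulmxr p n m (g : 'M[R]_(p, n) -> R) (E : 'M[R]_(m, n)) :
  alternating_form g -> alternating_form (fun w => g (w *m E)).
Proof.
move=> ag; split.
  move=> A B C i b c Ai /row'_eq BA /row'_eq CB.
  apply: (ag.1 _ _ _ i).
  - by rewrite !row_mul Ai mulmxDl !scalemxAl.
  - by apply/row'_eq => a j ai; rewrite !mxE; apply: eq_bigr => l _; rewrite BA.
  - by apply/row'_eq => a j ai; rewrite !mxE; apply: eq_bigr => l _; rewrite CB.
move=> A i j ij Aij; apply: (ag.2 _ i j ij).
by rewrite !row_mul Aij.
Qed.

Lemma alternating_det p : alternating_form (fun w : 'M[R]_p => \det w).
Proof.
split.
  by move=> A B C i b c Ai BA CA; exact: determinant_multilinear Ai BA CA.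
move=> A i j ij Aij; apply: (determinant_alternate ij) => l.
by move/rowP: Aij => /(_ l); rewrite !mxE.
Qed.

Lemma alternating_lin p n (f g : 'M[R]_(p, n) -> R) a b :
  alternating_form f -> alternating_form g ->
  alternating_form (fun w => a * f w + b * g w).
Proof.
move=> af ag; split.
  move=> A B C i c d Ai BA CB.
  by rewrite (af.1 _ _ _ _ _ _ Ai BA CB) (ag.1 _ _ _ _ _ _ Ai BA CB); ring.
by move=> A i j ij Aij; rewrite (af.2 _ _ _ ij Aij) (ag.2 _ _ _ ij Aij) !mulr0 addr0.
Qed.

Lemma alternating0 p n : alternating_form (fun _ : 'M[R]_(p, n) => 0 : R).
Proof. by split=> [*|//]; rewrite !mulr0 addr0. Qed.

Lemma alternating_sum p n (I : Type) (r : seq I) (P : pred I)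
    (F : I -> 'M[R]_(p, n) -> R) (c : I -> R) :
  (forall i, P i -> alternating_form (F i)) ->
  alternating_form (fun w => \sum_(i <- r | P i) c i * F i w).
Proof.
move=> aF; elim: r => [|i r IH].
  rewrite (_ : (fun w => _) = fun=> 0); first exact: alternating0.
  by apply/funext => w; rewrite big_nil.
have [Pi|nPi] := boolP (P i).
  rewrite (_ : (fun w => _) = fun w => c i * F i w +
      1 * \sum_(i <- r | P i) c i * F i w).
    by apply: alternating_lin => //; exact: aF.
  by apply/funext => w; rewrite big_cons Pi mul1r.
rewrite (_ : (fun w => _) = fun w => \sum_(i <- r | P i) c i * F i w)//.
by apply/funext => w; rewrite big_cons (negbTE nPi).
Qed.

Lemma fact_neq0 p : (p`!%:R : R) != 0.
Proof. by rewrite pnatr_eq0 -lt0n fact_gt0. Qed.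

(** Both sides have the same expansion [alt_avg], because every minor of D is
    det D times the minor of the identity matrix. *)
Lemma alt_mulmxl p n (g : 'M[R]_(p, n) -> R) (D : 'M[R]_p) w :
  alternating_form g -> g (D *m w) = \det D * g w.
Proof.
move=> ag; have ah := alternating_mulmxr w ag.
apply: (mulfI (fact_neq0 p)); rewrite mulrCA -{2}[w]mul1mx.
rewrite (alt_avg D ah) (alt_avg 1%:M ah) big_distrr; apply: eq_bigr => f _ /=.
by rewrite det_mulmx mul1mx mulrA.
Qed.

(** By [alt_avg], p! times the Gram determinant of v is the sum of the squares of
    the minors of v over all choices f of the columns. *)
Lemma det_unit_rows_bound p n (v : 'M[R]_(p, n)) (f : 'I_p -> 'I_n) :
  pvolume v = 1 -> `|\det (unit_rows f *m v^T)| <= p`!%:R.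
Proof.
move=> v1.
have d1 : \det (v *m v^T) = 1.
  move: v1; rewrite /pvolume; case: (lerP 0 (\det (v *m v^T))) => [d0 e|d0].
    by rewrite -[LHS](sqr_sqrtr d0) e expr1n.
  by rewrite ltr0_sqrtr// => /eqP; rewrite eq_sym oner_eq0.
have ah := alternating_mulmxr v^T (@alternating_det p).
have := alt_avg v ah; rewrite /= d1 mulr1 => e.
have p1 : 1 <= p`!%:R :> R by rewrite ler1n fact_gt0.
rewrite -(@ler_sqr R) ?nnegrE// real_normK ?num_real//.
apply: (@le_trans _ _ p`!%:R); last by rewrite expr2 ler_peMl.
have detE (h : 'I_p -> 'I_n) : \det (v *m (unit_rows h)^T) = \det (unit_rows h *m v^T).
  by rewrite -det_tr trmx_mul trmxK.
rewrite e (bigD1 (finfun f))//=.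
rewrite (_ : unit_rows (finfun f) = unit_rows f); last first.
  by apply/matrixP => a j; rewrite !mxE ffunE.
rewrite detE -expr2 lerDl sumr_ge0// => h _.
by rewrite detE -expr2 sqr_ge0.
Qed.

(** The determinant of v Z is alternating in the transpose of Z, so it expands into
    minors of v, which are bounded by [det_unit_rows_bound]. *)
Lemma det_mul_bound p n (v : 'M[R]_(p, n)) (Z : 'M[R]_(n, p)) (z : R) :
  pvolume v = 1 -> (forall i a, `|Z i a| <= z) ->
  `|\det (v *m Z)| <= (n ^ p)%:R * (z ^+ p * p`!%:R).
Proof.
move=> v1 Zz.
rewrite -det_tr trmx_mul.
rewrite (alt_expand Z^T (alternating_mulmxr v^T (@alternating_det p))).
rewrite (le_trans (ler_norm_sum _ _ _))//.
apply: (@le_trans _ _ (\sum_(f : {ffun 'I_p -> 'I_n}) (z ^+ p * p`!%:R))).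
  apply: ler_sum => f _; rewrite normrM ler_pM// ?det_unit_rows_bound//.
  rewrite normr_prod -[X in z ^+ X](card_ord p) -prodr_const.
  by apply: ler_prod => a _; rewrite normr_ge0 !mxE Zz.
rewrite sumr_const -[X in _ *+ X]/(#|predT|) card_ffun !card_ord.
by rewrite -[_ *+ _]mulr_natl.
Qed.

End Alternating.

(** * Edge matrices of the faces of a cube *)

(** Dimensions and edges of faces are defined by counting classical sets; as
    finite sets they can be compared by inclusions and images. *)
Lemma card_classical_set (T : finType) (P : pred T) :
  #|[set x | P x]%classic| = #|[set x | P x]%SET|.
Proof. by apply: eq_card => x; apply/idP/idP; rewrite !inE. Qed.

Section FaceEdges.
Context {R : realType} {n : nat}.

(** The rank of a free coordinate, the number of free coordinates below it, maps
    the free coordinates injectively to 'I_p, hence bijectively; f is the inverse. *)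
Lemma face_edges_unit_rows p (tau : face n) : fdim tau = p ->
  exists f : 'I_p -> 'I_n,
    [/\ injective f, forall a, tau (f a) = None,
        forall j, tau j = None -> exists a, f a = j &
        face_edges p tau = unit_rows f :> 'M[R]_(p, n)].
Proof.
move=> tp; pose S := [set i | tau i == None]%SET.
pose rk (j : 'I_n) := #|[set i : 'I_n | (i < j)%N && (tau i == None)]%SET|.
have Sp : #|S| = p by rewrite -card_classical_set.
have rk_lt j : tau j = None -> (rk j < p)%N.
  move=> tj; rewrite -Sp; apply: proper_card; apply/properP; split.
    by apply/fintype.subsetP => i; rewrite !inE => /andP[].
  by exists j; rewrite !inE ?tj ?ltnn.
have rk_mono (i j : 'I_n) : (i < j)%N -> tau i = None -> (rk i < rk j)%N.
  move=> ij ti; apply: proper_card; apply/properP; split.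
    by apply/fintype.subsetP => l; rewrite !inE => /andP[/ltn_trans->].
  by exists i; rewrite !inE ?ti ?ij ?ltnn.
have rk_inj i j : tau i = None -> tau j = None -> rk i = rk j -> i = j.
  move=> ti tj rij; apply: val_inj => /=.
  case: (ltngtP i j) => // [ij|ji]; [have := rk_mono _ _ ij ti|have := rk_mono _ _ ji tj];
    by rewrite rij ltnn.
have rk_surj (a : 'I_p) : exists j, tau j = None /\ rk j = a.
  case: p tp Sp rk_lt a => [_ _ _ []//|p] tp Sp rk_lt a.
  have : a \in [set (inord (rk j) : 'I_p.+1) | j in S]%SET.
    rewrite (_ : [set _ | _ in _]%SET = [set: 'I_p.+1]%SET) ?inE//.
    apply/eqP; rewrite eqEcard finset.subsetT/= cardsT card_ord card_in_imset ?Sp//.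
    move=> i j; rewrite !inE => /eqP ti /eqP tj /(congr1 val) /=.
    by rewrite !inordK ?rk_lt//; exact: rk_inj.
  case/imsetP => j; rewrite inE => /eqP tj ->; exists j; split => //.
  by rewrite inordK// rk_lt.
have /choice[f Hf] := rk_surj.
exists f; split.
- by move=> a b fab; apply: val_inj; rewrite /= -(Hf a).2 -(Hf b).2 fab.
- by move=> a; case: (Hf a).
- move=> j tj; exists (Ordinal (rk_lt _ tj)); case: (Hf (Ordinal (rk_lt _ tj))).
  by move=> tf rf; apply: rk_inj.
- apply/matrixP => a j; rewrite !mxE card_classical_set; congr (nat_of_bool _)%:R.
  case: (Hf a) => tf rf; apply/andP/eqP => [[/eqP tj /eqP rj]|<-].
    by apply: rk_inj => //; rewrite rf.
  by rewrite tf; split=> //; apply/eqP.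
Qed.

Lemma face_edges_mulT p (tau : face n) : fdim tau = p ->
  face_edges p tau *m (face_edges p tau)^T = 1%:M :> 'M[R]_p.
Proof.
move=> /face_edges_unit_rows[f [fi _ _ ->]].
by apply/matrixP => a b; rewrite mul_unit_rowsT !mxE (inj_eq fi).
Qed.

Lemma mulmx_face_edges p q (tau : face n) (M : 'M[R]_(q, n)) : fdim tau = p ->
  (forall i j, tau j <> None -> M i j = 0) ->
  M *m (face_edges p tau)^T *m face_edges p tau = M.
Proof.
move=> /face_edges_unit_rows[f [fi ft fs ->]] M0.
apply/matrixP => i j; rewrite mxE.
have [tj|tj] := eqVneq (tau j) None; last first.
  rewrite M0; last exact/eqP.
  rewrite big1// => a _; rewrite !mxE; case: eqP => [faj|_]; last by rewrite mulr0.
  by rewrite -faj ft eqxx in tj.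
have [a aj] := fs _ tj; rewrite (bigD1 a)//= mul_unit_rowsT mxE aj eqxx mulr1.
rewrite big1 ?addr0// => c ca; rewrite !mxE -aj (inj_eq fi) (negbTE ca).
by rewrite mulr0.
Qed.

Lemma det_face_edges_neq p (tau tau' : face n) : fdim tau = p ->
  (exists i, tau i = None /\ tau' i <> None) ->
  \det (face_edges p tau *m (face_edges p tau')^T) = 0 :> R.
Proof.
move=> /face_edges_unit_rows[f [fi ft fs ->]] [i [ti ti']].
have [a ai] := fs _ ti.
rewrite (expand_det_row _ a) big1// => b _; rewrite mxE big1 ?mul0r// => l _.
rewrite !mxE; case: eqP => [<-|_]; last by rewrite mul0r.
by rewrite ai; case: (tau' i) ti' => //= y _; rewrite mulr0.
Qed.

End FaceEdges.

(** * Affine bijections between faces of cubes *)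

Section SignedPermutation.
Context {R : realType} {q n : nat} (tau : face q) (tau' : face n).
Context (b : 'rV[R]_n) (E : 'M[R]_(q, n)) (rE : row_free E).
Hypothesis H : affine (b, E) @` face_set tau = face_set tau'.

Definition face_vertex m (t : face m) (s : {set 'I_m}) : 'rV[R]_m :=
  \row_i (if t i is Some y then y else i \in s)%:R.

Lemma face_vertex_in m (t : face m) s : face_set t (face_vertex t s).
Proof.
move=> i; rewrite mxE; case: (t i) => // ; case: (i \in s) => /=.
  by rewrite ler01 lexx.
by rewrite ler01 lexx.
Qed.

Let a := affine (b, E).

Let aB x y : a x - a y = (x - y) *m E.
Proof. by rewrite /a /affine /= mulmxBl opprD addrACA subrr add0r. Qed.

Let aface x : face_set tau x -> face_set tau' (a x).
Proof. by rewrite -H => xt; exists x. Qed.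

Let E0 i j : tau' j <> None -> tau i = None -> E i j = 0.
Proof.
case tj: (tau' j) => [y|//] _ ti.
have := aface (face_vertex_in tau [set i]%SET) j; have := aface (face_vertex_in tau finset.set0) j.
rewrite tj => e0 e1.
have : (a (face_vertex tau [set i]%SET) - a (face_vertex tau finset.set0)) 0 j = 0.
  by rewrite !mxE in e0 e1 *; rewrite e0 e1 subrr.
rewrite aB (_ : face_vertex _ _ - _ = delta_mx 0 i) -?rowE ?mxE//.
apply/rowP => l; rewrite !mxE eqxx /=.
have [->|li] := eqVneq l i; first by rewrite ti !inE eqxx subr0.
by case: (tau l) => [z|]; rewrite ?subrr// !inE (negbTE li) subrr.
Qed.

Let Esum j : tau' j = None -> \sum_(i | tau i == None) `|E i j| <= 1.
Proof.
move=> tj.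
pose P := [set i | 0 < E i j]%SET; pose N := [set i | E i j < 0]%SET.
have := aface (face_vertex_in tau P) j; have := aface (face_vertex_in tau N) j.
rewrite tj => /andP[n0 _] /andP[_ p1].
have <- : (a (face_vertex tau P) - a (face_vertex tau N)) 0 j = \sum_(i | tau i == None) `|E i j|.
  rewrite aB mxE [RHS]big_mkcond /=; apply: eq_bigr => i _; rewrite !mxE.
  case: (tau i) => [y|] /=; first by rewrite subrr mul0r.
  by rewrite !inE; case: (ltrgt0P (E i j)); rewrite ?subr0 ?sub0r ?mul1r ?mulN1r ?mul0r.
by rewrite !mxE; rewrite !mxE in n0 p1; lra.
Qed.

Let pre_ex (s : {set 'I_n}) : exists x, face_set tau x /\ a x = face_vertex tau' s.
Proof. by have := face_vertex_in tau' s; rewrite -H => -[x xt xs]; exists x. Qed.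

Let Einj (u v : 'rV[R]_q) : u *m E = v *m E -> u = v.
Proof. exact: row_free_inj. Qed.

(** Let A and B be the sets of free coordinates of tau and tau'.  As the image lies
    in the unit cube, the free entries of each column of E have absolute sum at most
    1.  The inverse map, with matrix F, has the same property.  As F E is the identity
    on B, equality holds in 1 = sum_i F j i E i j <= sum_i |E i j| <= 1, so every
    nonzero E i j has |F j i| = 1; then F has no other nonzero entry in the
    column of i, and E F = 1 leaves only one nonzero entry, of absolute value 1, in
    each column of E. *)
Lemma signed_permutation :
  [/\ forall j, tau' j = None -> exists i e, [/\ tau i = None,
        forall x, face_set tau x ->
          affine (b, E) x 0 j = if e then 1 - x 0 i else x 0 i &
        forall i', tau i' = None -> E i' j = (i' == i)%:R * (-1) ^+ (e : bool)],
      forall i, tau i = None -> exists j, tau' j = None /\ E i j != 0,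
      forall i j j', tau i = None -> tau' j = None -> tau' j' = None ->
        E i j != 0 -> E i j' != 0 -> j = j' &
      forall i j, tau' j <> None -> tau i = None -> E i j = 0].
Proof.
have /choice[pre Hpre] := pre_ex.
(* F is the matrix of the inverse map, read off from preimages of vertices *)
pose F j := pre [set j]%SET - pre finset.set0.
have preB s t i : tau i = None -> `|(pre s - pre t) 0 i| <= 1.
  move=> ti; have := (Hpre s).1 i; have := (Hpre t).1 i; rewrite ti !mxE ler_norml.
  by move=> /andP[? ?] /andP[? ?]; apply/andP; split; lra.
have pre0 s t i : tau i <> None -> (pre s - pre t) 0 i = 0.
  case ti: (tau i) => [y|//] _; have := (Hpre s).1 i; have := (Hpre t).1 i.
  by rewrite ti !mxE => -> ->; rewrite subrr.
have FE j : tau' j = None -> F j *m E = delta_mx 0 j.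
  move=> tj; rewrite -aB (Hpre _).2 (Hpre _).2; apply/rowP => l; rewrite !mxE eqxx /=.
  have [->|lj] := eqVneq l j; first by rewrite tj !inE eqxx subr0.
  by case: (tau' l) => [z|]; rewrite ?subrr// !inE (negbTE lj) subrr.
have preF s : pre s - pre finset.set0 = \sum_(j | (tau' j == None) && (j \in s)) F j.
  apply: Einj; rewrite -aB (Hpre _).2 (Hpre _).2 mulmx_suml.
  rewrite (eq_bigr (fun j => delta_mx 0 j)); last by move=> j /andP[/eqP /FE].
  apply/rowP => l; rewrite summxE !mxE.
  case tl: (tau' l) => [z|].
    rewrite subrr big1// => j /andP[/eqP tj _]; rewrite mxE eqxx /=.
    by case: eqP => // lj; rewrite lj tj in tl.
  rewrite inE subr0; case: (boolP (l \in s)) => ls.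
    rewrite (bigD1 l) ?tl ?eqxx//= mxE !eqxx big1 ?addr0// => j /andP[_ jl].
    by rewrite mxE eqxx eq_sym (negbTE jl).
  rewrite big1// => j /andP[_ js]; rewrite mxE eqxx /=.
  by case: eqP => // lj; rewrite lj js in ls.
(* the vertices P and N of tau' maximize and minimize the coordinate i of the preimage *)
have Fsum i : tau i = None -> \sum_(j | tau' j == None) `|F j 0 i| <= 1.
  move=> ti.
  pose P := [set j | 0 < F j 0 i]%SET; pose N := [set j | F j 0 i < 0]%SET.
  apply: le_trans (preB P N i ti); apply: le_trans (ler_norm _).
  have -> : pre P - pre N = (pre P - pre finset.set0) - (pre N - pre finset.set0).
    by rewrite opprB addrA subrK.
  rewrite !preF [in leRHS]mxE [X in _ <= _ + X]mxE !summxE.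
  rewrite [X in _ <= X - _]big_mkcondr [X in _ <= _ - X]big_mkcondr -sumrB /=.
  apply: ler_sum => j _; rewrite !inE.
  by case: (ltrgt0P (F j 0 i)); rewrite ?subr0 ?sub0r.
have EF i : tau i = None -> delta_mx 0 i = \sum_(j | tau' j == None) E i j *: F j.
  move=> ti; apply: Einj; rewrite -rowE mulmx_suml.
  rewrite (eq_bigr (fun j => E i j *: delta_mx 0 j)); last first.
    by move=> j /eqP/FE <-; rewrite scalemxAl.
  rewrite {1}(row_sum_delta (row i E)) [RHS]big_mkcond /=; apply: eq_bigr => j _.
  by rewrite mxE; case: eqP => // tj; rewrite E0// scale0r.
have key j : tau' j = None -> exists i, [/\ tau i = None, `|E i j| = 1,
    F j 0 i = E i j, forall i', tau i' = None -> i' != i -> E i' j = 0 &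
    forall j', tau' j' = None -> j' != j -> F j' 0 i = 0].
  move=> tj.
  have FE1 : \sum_(i | tau i == None) F j 0 i * E i j = 1.
    have <- : \sum_i F j 0 i * E i j = 1.
      by have /rowP/(_ j) := FE j tj; rewrite mxE [in RHS]mxE !eqxx.
    rewrite [LHS]big_mkcond /=; apply: eq_bigr => i _.
    by case: eqP => // ti; rewrite /F pre0// mul0r.
  (* equality in 1 = sum_i F j i E i j <= sum_i |E i j| <= 1 *)
  have FEE i : tau i = None -> `|E i j| = F j 0 i * E i j.
    move=> ti.
    have ge l : tau l == None -> 0 <= `|E l j| - F j 0 l * E l j.
      move=> /eqP tl; rewrite subr_ge0 (le_trans (ler_norm _))// normrM.
      by rewrite ler_piMl// preB.
    have s0 : \sum_(i | tau i == None) (`|E i j| - F j 0 i * E i j) = 0.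
      apply/eqP; rewrite eq_le sumr_ge0// andbT sumrB FE1 subr_le0.
      exact: Esum.
    have /eqP := s0; rewrite psumr_eq0// => /allP/(_ i); rewrite mem_index_enum ti eqxx /=.
    by move=> /(_ isT) /eqP /subr0_eq.
  have [i ti Ei] : exists2 i, tau i = None & E i j != 0.
    apply/not_exists2P => h.
    have : \sum_(i | tau i == None) F j 0 i * E i j = 0.
      apply: big1 => i /eqP ti; case: (h i) => [//|/negP/negPn/eqP ->].
      by rewrite mulr0.
    by rewrite FE1 => /eqP; rewrite oner_eq0.
  have F1 : `|F j 0 i| = 1.
    have /(congr1 Num.norm) := FEE i ti; rewrite normr_id normrM => /eqP.
    by rewrite -{1}[`|E i j|]mul1r (inj_eq (mulIf _)) ?normr_eq0// => /eqP.
  have F0 j' : tau' j' = None -> j' != j -> F j' 0 i = 0.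
    move=> tj' jj'; apply/eqP; rewrite -normr_eq0 eq_le normr_ge0 andbT.
    have := Fsum i ti; rewrite (bigD1 j) ?tj ?eqxx//= F1.
    rewrite (bigD1 j') ?tj' ?eqxx//= => h.
    have : 0 <= \sum_(i0 | [&& tau' i0 == None, i0 != j & i0 != j']) `|F i0 0 i|.
      exact: sumr_ge0.
    by move: h; under [X in 0 <= X]eq_bigl do rewrite andbA; lra.
  have sumF i' : tau i' = None -> E i' j * F j 0 i = (i == i')%:R.
    move=> ti'; have /rowP/(_ i) := EF i' ti'; rewrite mxE eqxx /= summxE => ->.
    rewrite (bigD1 j) ?tj ?eqxx//= [(E i' j *: F j) 0 i]mxE big1 ?addr0// => j' /andP[/eqP tj' jj'].
    by rewrite [LHS]mxE F0// mulr0.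
  have Fn0 : F j 0 i != 0 by rewrite -normr_eq0 F1 oner_eq0.
  have E1 : `|E i j| = 1.
    by have := sumF i ti; rewrite eqxx => /(congr1 Num.norm); rewrite normrM F1 mulr1 normr1.
  exists i; split => //.
    apply: (mulIf Ei); rewrite -FEE// E1 -expr2 -[LHS](expr1n _ 2) -E1.
    by rewrite real_normK// num_real.
  move=> i' ti' ii'; apply/eqP; have /eqP := sumF i' ti'.
  by rewrite eq_sym in ii'; rewrite (negbTE ii') mulf_eq0 (negbTE Fn0) orbF.
split.
- move=> j tj; have [i [ti E1 FEi E'0 _]] := key j tj.
  exists i, (E i j < 0); split => //; last first.
    move=> i' ti'; have [->|ii'] := eqVneq i' i; last by rewrite mul0r E'0.
    move: E1; case: (ltrP (E i j) 0) => [e0|e0].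
      by rewrite ltr0_norm// mul1r expr1 => /(congr1 -%R); rewrite opprK.
    by rewrite ger0_norm// mul1r expr0.
  move=> x xt.
  have ax y : face_set tau y -> (a y) 0 j = (a (face_vertex tau finset.set0)) 0 j + y 0 i * E i j.
    move=> yt; rewrite addrC; apply/eqP; rewrite -subr_eq; apply/eqP.
    transitivity ((a y - a (face_vertex tau finset.set0)) 0 j).
      by rewrite [RHS]mxE [X in _ = _ + X]mxE.
    rewrite aB mxE (bigD1 i)//= big1 ?addr0.
      by rewrite !mxE ti inE subr0.
    move=> l li; case tl: (tau l) => [z|]; last by rewrite E'0// mulr0.
    by have := yt l; rewrite tl !mxE tl => ->; rewrite subrr mul0r.
  have := aface (face_vertex_in tau [set i]%SET) j; have := aface (face_vertex_in tau finset.set0) j.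
  rewrite tj (ax _ (face_vertex_in tau [set i]%SET)) => c0.
  have -> : face_vertex tau [set i]%SET 0 i = 1 by rewrite mxE ti inE eqxx.
  rewrite -/a (ax _ xt) mul1r; move: c0.
  set c := (a _) 0 j.
  move: E1; case: (ltrP (E i j) 0) => [e0|e0].
    rewrite ltr0_norm// => /(congr1 -%R); rewrite opprK => ->.
    move=> /andP[? ?] /andP[? ?]; have -> : c = 1 by lra.
    by rewrite mulrN1.
  rewrite ger0_norm// => ->.
  move=> /andP[? ?] /andP[? ?]; have -> : c = 0 by lra.
  by rewrite mulr1 add0r.
- move=> i ti; apply/not_existsP => h.
  have /rowP/(_ i) := EF i ti; rewrite mxE !eqxx summxE big1 => [/eqP|j /eqP tj].
    by rewrite oner_eq0.
  rewrite mxE; have [->|Ej] := eqVneq (E i j) 0; first by rewrite mul0r.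
  by case: (h j).
- move=> i j j' ti tj tj' Ej Ej'.
  have [l [tl El Fl El0 Fl0]] := key j tj; have [l' [tl' El' Fl' El0' Fl0']] := key j' tj'.
  have il : i = l by apply/eqP/negPn/negP => /(El0 _ ti) e; rewrite e eqxx in Ej.
  have il' : i = l' by apply/eqP/negPn/negP => /(El0' _ ti) e; rewrite e eqxx in Ej'.
  apply/eqP/negPn/negP => jj'.
  have := Fl0' j tj jj'; rewrite -il' il Fl => /eqP.
  by rewrite -normr_eq0 El oner_eq0.
- by move=> i j; exact: E0.
Qed.

End SignedPermutation.

(** * Integrals of polynomials over the unit interval *)

Section PolyIntegral.
Context {R : realType}.
Local Notation mu := (@lebesgue_measure R).

Definition poly_integral (q : {poly R}) : R := \int[mu]_(t in `[0, 1]) q.[t].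

Lemma antiderivative (q : {poly R}) :
  exists Q : {poly R}, [/\ Q^`() = q, Q.[0] = 0 & (size Q <= (size q).+1)%N].
Proof.
exists (\poly_(i < (size q).+1) (if i is j.+1 then q`_j / j.+1%:R else 0)); split.
- apply/polyP => i; rewrite coef_deriv coef_poly ltnS.
  case: ltnP => iq; last by rewrite mul0rn nth_default.
  by rewrite -[_ *+ _]mulr_natr divfK// pnatr_eq0.
- by rewrite horner_coef0 coef_poly.
- exact: size_poly.
Qed.

Lemma poly_integral_deriv (Q : {poly R}) : poly_integral Q^`() = Q.[1] - Q.[0].
Proof. exact: Rintegral_deriv_poly. Qed.

Lemma poly_integralZ c q : poly_integral (c *: q) = c * poly_integral q.
Proof.
have [Q [<- _ _]] := antiderivative q.
by rewrite -derivZ !poly_integral_deriv !hornerZ mulrBr.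
Qed.

Lemma poly_integralC (c : R) : poly_integral c%:P = c.
Proof.
have -> : c%:P = (c *: 'X)^`() by rewrite derivZ derivX alg_polyC.
by rewrite poly_integral_deriv !hornerE /=; ring.
Qed.

Lemma poly_integral_sum (I : Type) (r : seq I) (P : pred I) (F : I -> {poly R}) :
  poly_integral (\sum_(i <- r | P i) F i) = \sum_(i <- r | P i) poly_integral (F i).
Proof.
elim/big_rec2 : _ => [|i x q _ <-]; first exact: poly_integralC.
have [Q [<- _ _]] := antiderivative q; have [Q' [<- _ _]] := antiderivative (F i).
by rewrite -derivD !poly_integral_deriv !hornerD; ring.
Qed.

Lemma poly_integral_reflect q : poly_integral (q \Po (1 - 'X)) = poly_integral q.
Proof.
have [Q [<- _ _]] := antiderivative q.
have -> : Q^`() \Po (1 - 'X) = (- (Q \Po (1 - 'X)))^`().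
  by rewrite derivN deriv_comp derivB derivX derivC sub0r mulrN1 opprK.
by rewrite !poly_integral_deriv !hornerN !horner_comp !hornerE subrr subr0; ring.
Qed.

(** The mean value theorem for an antiderivative; it shows that integrals of
    positive polynomials are positive. *)
Lemma poly_integral_mean q : exists2 x, 0 < x < 1 & poly_integral q = q.[x].
Proof.
have [Q [<- _ _]] := antiderivative q; rewrite poly_integral_deriv.
have [x x01 e] : exists2 x, x \in `]0, 1[ & Q.[1] - Q.[0] = Q^`().[x] * (1 - 0).
  apply: (MVT ltr01).
  by apply: continuous_subspaceT => y; exact: continuous_horner.
by exists x; [move: x01; rewrite in_itv|rewrite e subr0 mulr1].
Qed.

End PolyIntegral.

(** * The one-dimensional small cells, basis polynomials and integrals *)

Section OneDim.
Context {R : realType} (k : nat).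

(** The small cells of [0,1]: the intervals [m/k, (m+1)/k] on the left and the
    points m/k on the right.  Small cells of the cube are products of these. *)
Definition cell1 : Type := ('I_k + 'I_k.+1)%type.
HB.instance Definition _ := Finite.on cell1.

Definition is_edge (t : cell1) : bool := if t is inl _ then true else false.
Definition lo (t : cell1) : nat := match t with inl m => m | inr m => m end.
Definition hi (t : cell1) : nat := match t with inl m => m.+1 | inr m => m end.

(** The factor that a coordinate contributes to the basis form of a small cell. *)
Definition bernp (t : cell1) : {poly R} :=
  match t with
  | inl m => 'X^m * (1 - 'X) ^+ (k - 1 - m)
  | inr m => 'X^m * (1 - 'X) ^+ (k - m)
  end.

Definition cell_param (t : cell1) : {poly R} :=
  k%:R^-1 *: ((lo t)%:R%:P + (hi t - lo t)%:R *: 'X).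

(** The integral over the cell t of the basis form of t'.  It is 0 when one is an
    interval and the other a point, as for forms of different degrees. *)
Definition dof1 (t t' : cell1) : R :=
  if is_edge t == is_edge t' then poly_integral (bernp t' \Po cell_param t) else 0.

Lemma hi_lo t : hi t = (lo t + is_edge t)%N.
Proof. by case: t => m /=; rewrite ?addn1 ?addn0. Qed.

Lemma hi_le t : (hi t <= k)%N.
Proof. by case: t => m /=; [|rewrite -ltnS]; exact: ltn_ord. Qed.

Lemma lo_hi_inj t t' : lo t = lo t' -> hi t = hi t' -> t = t'.
Proof.
by case: t => m; case: t' => m' /= e1 e2; rewrite ?(ord_inj e1)//; exfalso; lia.
Qed.

Lemma cell_paramE t x : (cell_param t).[x] = ((lo t)%:R + (is_edge t)%:R * x) / k%:R.
Proof.
rewrite /cell_param hornerZ hornerD hornerZ hornerC hornerX mulrC.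
by rewrite hi_lo addKn.
Qed.

Definition rev1 (t : cell1) : cell1 :=
  match t with inl m => inl (rev_ord m) | inr m => inr (rev_ord m) end.

Lemma is_edge_rev t : is_edge (rev1 t) = is_edge t.
Proof. by case: t. Qed.

Lemma lo_rev t : lo (rev1 t) = (k - hi t)%N.
Proof. by case: t => m /=; rewrite ?subSS. Qed.

Lemma hi_rev t : hi (rev1 t) = (k - lo t)%N.
Proof. by case: t => m /=; rewrite ?subSS// subnSK. Qed.

Lemma bernp_rev t : bernp (rev1 t) = bernp t \Po (1 - 'X).
Proof.
have e (a b : nat) : ('X^a * (1 - 'X) ^+ b) \Po (1 - 'X) = 'X^b * (1 - 'X) ^+ a :> {poly R}.
  rewrite rmorphM /= !rmorphXn /= comp_polyX rmorphB /= comp_polyX comp_polyC.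
  by rewrite subKr mulrC.
case: t => m /=; rewrite e; congr ('X^_ * _ ^+ _); have := ltn_ord m; lia.
Qed.

Lemma bernp_horner t x : (bernp t).[x] =
  match t with
  | inl m => x ^+ m * (1 - x) ^+ (k - 1 - m)
  | inr m => x ^+ m * (1 - x) ^+ (k - m)
  end.
Proof. by case: t => m /=; rewrite !hornerE. Qed.

Lemma dof1_vertex (m : 'I_k.+1) t : dof1 (inr m) t =
  if is_edge t then 0 else (bernp t).[m%:R / k%:R].
Proof.
rewrite /dof1; case: t => [//|j] /=.
have -> : cell_param (inr m) = (m%:R / k%:R)%:P.
  by rewrite /cell_param /= subnn scale0r addr0 -mul_polyC -polyCM mulrC.
by rewrite comp_polyCr poly_integralC.
Qed.

(** At an end point of [0,1], only the vertex polynomial of that point is not 0.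
    This makes forms of cells off a face of the cube invisible on that face. *)
Lemma dof1_left t : dof1 (inr ord0) t = (t == inr ord0)%:R.
Proof.
rewrite dof1_vertex mul0r bernp_horner; case: t => [j|j] //=.
rewrite subr0 expr1n mulr1 expr0n; congr (nat_of_bool _)%:R.
Qed.

(** The lowest coefficient of the j-th polynomial is that of X^j, so the system is
    triangular. *)
Lemma bernstein_free m (x : 'I_m -> R) :
  \sum_(j < m) x j *: ('X^j * (1 - 'X) ^+ (m - 1 - j)) = 0 -> forall j, x j = 0.
Proof.
move=> e j.
have [b] := ubnP (nat_of_ord j); elim: b j => // b IH j; rewrite ltnS => jb.
have /(congr1 (fun q : {poly R} => q`_j)) := e.
rewrite coef0 coef_sum (bigD1 j)//= coefZ coefXnM ltnn subnn.
rewrite -horner_coef0 !hornerE ?subr0 ?expr1n ?mulr1 big1 ?addr0// => i ij.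
rewrite coefZ coefXnM; case: ltnP => ji; first by rewrite mulr0.
by rewrite IH ?mul0r// (leq_trans _ jb)// ltn_neqAle ij.
Qed.

Lemma size_bernp_term (a b : nat) : size ('X^a * (1 - 'X) ^+ b : {poly R}) = (a + b).+1.
Proof.
have X1 : (1 - 'X : {poly R}) = - ('X - 1%:P) by rewrite opprB.
rewrite size_monicM ?monicXn//; last by rewrite X1 expf_neq0// oppr_eq0 polyXsubC_eq0.
by rewrite size_polyXn X1 exprNn size_Msign size_exp_XsubC addSn addnS.
Qed.

Lemma bernp_le1 t x : 0 <= x <= 1 -> `|(bernp t).[x]| <= 1.
Proof.
move=> /andP[x0 x1]; rewrite bernp_horner.
have y0 : 0 <= 1 - x by rewrite subr_ge0.
have y1 : 1 - x <= 1 by rewrite lerBlDr lerDl.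
by case: t => m; rewrite normrM !normrX !ger0_norm// mulr_ile1 ?exprn_ge0// exprn_ile1.
Qed.

(** Expand x^a ((1 - x) + x)^(m - 1 - a). *)
Lemma monomial_bernstein m a (x : R) : (a < m)%N ->
  x ^+ a = \sum_(j < m) (if (a <= j)%N then 'C(m - 1 - a, j - a)%:R else 0) *
                          (x ^+ j * (1 - x) ^+ (m - 1 - j)).
Proof.
move=> am.
have := exprDn (1 - x) x (m - 1 - a); rewrite subrK expr1n => e.
rewrite -[LHS]mulr1 [X in _ * X = _]e big_distrr /=.
have mE : (m = a + (m - 1 - a).+1)%N by lia.
rewrite [in RHS]mE big_split_ord /= [X in _ = X + _]big1 ?add0r; last first.
  by move=> i _; rewrite leqNgt ltn_ord mul0r.
apply: eq_bigr => i _; rewrite leq_addr addKn -mE exprD.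
have -> : (m - 1 - (a + i) = m - 1 - a - i)%N by lia.
by rewrite -mulr_natl; ring.
Qed.

Lemma monomial_span (e : bool) a : (a < k)%N ->
  exists beta : cell1 -> R, (forall t, is_edge t != e -> beta t = 0) /\
    forall x : R, x ^+ a = \sum_t beta t * (bernp t).[x].
Proof.
move=> ak; case: e.
  exists (fun t : cell1 => if t is inl j then
    (if (a <= j)%N then 'C(k - 1 - a, j - a)%:R else 0 : R) else 0).
  split=> [[]//|x]; rewrite big_sumType /= [X in _ + X]big1 ?addr0; last first.
    by move=> j _; rewrite mul0r.
  rewrite (monomial_bernstein x ak); apply: eq_bigr => j _; congr (_ * _).
  by rewrite -[RHS]/((bernp (inl j)).[x]) bernp_horner.
exists (fun t : cell1 => if t is inr j then
  (if (a <= j)%N then 'C(k.+1 - 1 - a, j - a)%:R else 0 : R) else 0).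
split=> [[]//|x]; rewrite big_sumType /= [X in X + _]big1 ?add0r; last first.
  by move=> j _; rewrite mul0r.
rewrite (@monomial_bernstein k.+1 _ x); last by rewrite ltnW.
apply: eq_bigr => j _; congr (_ * _).
by rewrite -[RHS]/((bernp (inr j)).[x]) bernp_horner subn1.
Qed.

Definition cell1_of (m : 'I_k) (o : option bool) : cell1 :=
  if o is Some y then inr (inord (m + y)) else inl m.

Lemma is_edge_cell1_of m o : is_edge (cell1_of m o) = (o == None).
Proof. by case: o. Qed.

Lemma lo_cell1_of m o : lo (cell1_of m o) = (m + odflt false o)%N.
Proof.
case: o => [y|] /=; last by rewrite addn0.
by rewrite inordK// ltnS; case: y; have := ltn_ord m; lia.
Qed.

Lemma bernp_cell1_of m o x : (bernp (cell1_of m o)).[x] =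
  x ^+ m * (1 - x) ^+ (k - 1 - m) *
  (if o is Some y then x ^+ y * (1 - x) ^+ (1 - y) else 1).
Proof.
rewrite bernp_horner; case: o => [y|] /=; last by rewrite mulr1.
have mk := ltn_ord m.
rewrite inordK ?ltnS; last by case: y; lia.
rewrite exprD -!mulrA; congr (_ * _); rewrite mulrCA; congr (_ * _).
by rewrite -exprD; congr (_ ^+ _); case: y => /=; lia.
Qed.

Hypothesis k0 : (0 < k)%N.

Lemma cell1_of_surj t : exists m o, cell1_of m o = t.
Proof.
case: t => [m|m]; first by exists m, None.
have [mk|mk] := ltnP m k.
  exists (Ordinal mk), (Some false) => /=; congr inr; apply: val_inj.
  by rewrite /= addn0 inordK.
have pk : (k.-1 < k)%N by rewrite prednK.
exists (Ordinal pk), (Some true) => /=; congr inr; apply: val_inj.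
by rewrite /= inordK addn1 prednK//; have := ltn_ord m; lia.
Qed.


Let kR0 : k%:R != 0 :> R. Proof. by rewrite pnatr_eq0 -lt0n. Qed.

Lemma cell_param_rev t : cell_param (rev1 t) = 1 - (cell_param t \Po (1 - 'X)).
Proof.
have ptp_lin u : cell_param u = ((lo u)%:R / k%:R)%:P + ((is_edge u)%:R / k%:R)%:P * 'X.
  by rewrite /cell_param hi_lo addKn scalerDr scalerA -!mul_polyC -polyCM !(mulrC k%:R^-1).
rewrite !ptp_lin is_edge_rev lo_rev comp_polyD comp_polyM comp_polyX !comp_polyC.
have -> : (k - hi t)%:R / k%:R = 1 - (lo t)%:R / k%:R - (is_edge t)%:R / k%:R :> R.
  by rewrite natrB ?hi_le// hi_lo natrD; field; rewrite kR0.
by rewrite !polyCB polyC1; ring.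
Qed.

Lemma dof1_rev t t' : dof1 (rev1 t) (rev1 t') = dof1 t t'.
Proof.
rewrite /dof1 !is_edge_rev; case: ifP => // _.
rewrite bernp_rev cell_param_rev -(poly_integral_reflect (bernp t' \Po cell_param t)); congr poly_integral.
by rewrite -!comp_polyA; congr (_ \Po _); rewrite rmorphB /= comp_polyX comp_polyC subKr.
Qed.

Lemma dof1_right t : dof1 (inr ord_max) t = (t == inr ord_max)%:R.
Proof.
rewrite dof1_vertex divff// bernp_horner; case: t => [j|j] //=.
rewrite expr1n subrr mul1r expr0n; congr (nat_of_bool _)%:R.
apply/idP/idP => [/eqP j0|/eqP[->] /=]; last by rewrite subnn.
by apply/eqP; congr inr; apply: val_inj => /=; have := ltn_ord j; lia.
Qed.

Lemma dof1_diag_gt0 t : 0 < dof1 t t.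
Proof.
rewrite /dof1 eqxx; have [x /andP[x0 x1] ->] := poly_integral_mean (bernp t \Po cell_param t).
rewrite horner_comp cell_paramE bernp_horner.
have kp : (0 : R) < k%:R by rewrite ltr0n.
case: t => m /=.
  rewrite mul1r mulr_gt0// exprn_gt0//.
    by rewrite divr_gt0// ltr_wpDl.
  rewrite subr_gt0 ltr_pdivrMr// mul1r.
  apply: (@lt_le_trans _ _ (m.+1%:R)); first by rewrite -natr1 ltrD2l.
  by rewrite ler_nat.
rewrite mul0r addr0 mulr_gt0//.
  have [->|m0] := posnP m; first by rewrite expr0.
  by rewrite exprn_gt0// divr_gt0// ltr0n.
have [e|m0] := posnP (k - m)%N; first by rewrite e expr0.
by rewrite exprn_gt0// subr_gt0 ltr_pdivrMr// mul1r ltr_nat -subn_gt0.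
Qed.

Lemma grid_root_eq0 (q : {poly R}) : (size q <= k.+1)%N ->
  (forall m : 'I_k.+1, q.[m%:R / k%:R] = 0) -> q = 0.
Proof.
move=> sq q0.
pose rs := [seq (m%:R / k%:R : R) | m : 'I_k.+1].
apply: (@roots_geq_poly_eq0 _ q rs).
- by apply/allP => r /mapP[m _ ->]; apply/eqP.
- rewrite map_inj_uniq ?enum_uniq// => a b.
  by move=> /(mulIf (invr_neq0 kR0)) /eqP; rewrite eqr_nat => /eqP /ord_inj.
- by rewrite size_map size_enum_ord.
Qed.

(** A combination of vertex polynomials has degree at most k and k + 1 zeros.  A
    combination of edge polynomials has degree less than k and mean 0 on k
    intervals, so an antiderivative takes the same value at k + 1 points. *)
Lemma dof1_ker (x : cell1 -> R) :
  (forall t, \sum_t' x t' * dof1 t t' = 0) -> forall t, x t = 0.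
Proof.
move=> x0.
have x0v (m : 'I_k.+1) : \sum_j x (inr j) * (bernp (inr j)).[m%:R / k%:R] = 0.
  rewrite -[RHS](x0 (inr m)) big_sumType /= [X in _ = X + _]big1 ?add0r.
    by apply: eq_bigr => j _; rewrite dof1_vertex.
  by move=> j _; rewrite dof1_vertex mulr0.
have x0e (m : 'I_k) : \sum_j x (inl j) * poly_integral (bernp (inl j) \Po cell_param (inl m)) = 0.
  rewrite -[RHS](x0 (inl m)) big_sumType /= [X in _ = _ + X]big1 ?addr0//.
  by move=> j _; rewrite /dof1 mulr0.
case=> [j|j].
  pose q : {poly R} := \sum_j x (inl j) *: bernp (inl j).
  suff q0 : q = 0 by apply: (bernstein_free q0).
  have sq : (size q <= k)%N.
    apply: (leq_trans (size_sum _ _ _)); apply/bigmax_leqP => i _.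
    rewrite (leq_trans (size_scale_leq _ _))// size_bernp_term.
    by have := ltn_ord i; lia.
  have [Q [Qq Q0 sQ]] := antiderivative q.
  rewrite -Qq (_ : Q = 0) ?deriv0//.
  apply: grid_root_eq0; first by rewrite (leq_trans sQ).
  case=> m mk /=; elim: m mk => [|m IH] mk; first by rewrite mul0r.
  have mk' : (m < k)%N by [].
  have : poly_integral (q \Po cell_param (inl (Ordinal mk'))) = 0.
    rewrite -[RHS](x0e (Ordinal mk')) /q raddf_sum /= poly_integral_sum.
    by apply: eq_bigr => i _; rewrite comp_polyZ poly_integralZ.
  have dpt : (cell_param (inl (Ordinal mk')))^`() = k%:R^-1%:P.
    by rewrite /cell_param derivZ derivD derivC add0r derivZ derivX /= subSnn scale1r alg_polyC.
  have -> : q \Po cell_param (inl (Ordinal mk')) = k%:R *: (Q \Po cell_param (inl (Ordinal mk')))^`().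
    by rewrite deriv_comp dpt Qq mulrC mul_polyC scalerA divff// scale1r.
  rewrite poly_integralZ poly_integral_deriv !horner_comp !cell_paramE /= mulr0 addr0 mul1r natr1.
  rewrite IH ?subr0; last by rewrite ltnW.
  by move=> /eqP; rewrite mulf_eq0 (negbTE kR0) => /eqP.
pose q : {poly R} := \sum_j x (inr j) *: bernp (inr j).
have q0 : q = 0.
  apply: grid_root_eq0.
    apply: (leq_trans (size_sum _ _ _)); apply/bigmax_leqP => i _.
    rewrite (leq_trans (size_scale_leq _ _))// size_bernp_term.
    by have := ltn_ord i; lia.
  move=> m; rewrite -[RHS](x0v m) /q horner_sum.
  by apply: eq_bigr => i _; rewrite hornerZ.
apply: (@bernstein_free k.+1 (fun j => x (inr j))).
by rewrite -[RHS]q0; apply: eq_bigr => i _; rewrite subn1.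
Qed.

Lemma dof1_left_inverse : exists G : cell1 -> cell1 -> R,
  forall t t'', \sum_t' G t t' * dof1 t' t'' = (t == t'')%:R.
Proof.
pose N := #|{: cell1}|.
pose M : 'M[R]_N := \matrix_(i, j) dof1 (enum_val i) (enum_val j).
have uM : M \in unitmx.
  rewrite -unitmx_tr -row_free_unit; apply: inj_row_free => v vM.
  apply/rowP => i; rewrite [RHS]mxE.
  have := @dof1_ker (fun t => v 0 (enum_rank t)) _ (enum_val i).
  rewrite enum_valK; apply => t.
  have /rowP/(_ (enum_rank t)) := vM; rewrite mxE [in RHS]mxE => e.
  rewrite -[RHS]e (reindex (@enum_val _ predT)); last exact/onW_bij/enum_val_bij.
  by apply: eq_bigr => j _; rewrite !mxE enum_rankK enum_valK.
exists (fun t t' => invmx M (enum_rank t) (enum_rank t')) => t t''.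
have /matrixP/(_ (enum_rank t) (enum_rank t'')) := mulVmx uM.
rewrite mxE [in RHS]mxE (inj_eq enum_rank_inj) => <-.
rewrite (reindex (@enum_val _ predT)); last exact/onW_bij/enum_val_bij.
by apply: eq_bigr => j _; rewrite enum_valK [in RHS]mxE enum_rankK.
Qed.

End OneDim.

(** * Small cells of the unit cube *)

Lemma face_edges_eq (R : realType) n p (tau tau' : face n) :
  (forall i, (tau i == None) = (tau' i == None)) ->
  face_edges p tau = face_edges p tau' :> 'M[R]_(p, n).
Proof.
move=> e; apply/matrixP => a j; rewrite !mxE e; congr ((_ && (_ == _))%:R).
by rewrite !card_classical_set; apply: eq_card => i; rewrite !inE e.
Qed.

Lemma fdim_eq n (tau tau' : face n) :
  (forall i, (tau i == None) = (tau' i == None)) -> fdim tau = fdim tau'.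
Proof.
by move=> e; rewrite /fdim !card_classical_set; apply: eq_card => i; rewrite !inE e.
Qed.

Section SmallCubes.
Context {R : realType} {n k : nat} (k0 : (0 < k)%N).
Local Notation scell := {ffun 'I_n -> cell1 k}.
Implicit Types (c : scell) (x : 'rV[R]_n).

Let kR : (0 : R) < k%:R. Proof. by rewrite ltr0n. Qed.
Let kR0 : k%:R != 0 :> R. Proof. by rewrite gt_eqF. Qed.

Definition smallset c : set 'rV[R]_n :=
  [set x | forall i, (lo (c i))%:R <= k%:R * x 0 i <= (hi (c i))%:R].

(** The image of c under scaling by k and a translation.  The constant
    coordinates are moved to 0; only the set of free ones matters for the edges. *)
Definition dirface c : face n :=
  [ffun i => if is_edge (c i) then None else Some false].

Definition bernprod c x : R := \prod_i (bernp (c i)).[x 0 i].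

Definition basis_form p c : pform R n p := fun x v =>
  bernprod c x * \det (v *m (face_edges p (dirface c))^T).

(** The coordinates kk and tau describe some small cells several times; this is
    the description without repetition. *)
Definition small_index (kk : {ffun 'I_n -> 'I_k}) (tau : face n) : scell :=
  [ffun i => cell1_of (kk i) (tau i)].

Definition dofs c c' : R := \prod_i dof1 (c i) (c' i).

Lemma dirface_None c i : (dirface c i == None) = is_edge (c i).
Proof. by rewrite ffunE; case: ifP. Qed.

Lemma dirface_small_index kk (tau : face n) i : (tau i == None) = (dirface (small_index kk tau) i == None).
Proof. by rewrite dirface_None ffunE is_edge_cell1_of. Qed.

Lemma small_map_face_set kk (tau : face n) :
  small_map kk @` face_set tau = smallset (small_index kk tau).
Proof.
apply/seteqP; split=> [_ [x xt <-] i|x xc].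
  rewrite /small_map !mxE ffunE hi_lo is_edge_cell1_of lo_cell1_of mulrA divff// mul1r.
  have := xt i; case: (tau i) => [y|] /=; first by move=> ->; rewrite addn0 -natrD lexx.
  by move=> /andP[? ?]; rewrite addn0 natrD; apply/andP; split; lra.
exists (\row_i (k%:R * x 0 i - (kk i)%:R)).
  move=> i; have := xc i; rewrite mxE ffunE hi_lo is_edge_cell1_of lo_cell1_of.
  case: (tau i) => [y|] /=; rewrite addn0 natrD; move=> /andP[? ?]; last first.
    by apply/andP; split; lra.
  by apply/eqP; rewrite eq_le; apply/andP; split; lra.
by apply/rowP => i; rewrite /small_map !mxE addrC subrK mulrA mulVf// mul1r.
Qed.

Lemma cubical_form_basis p kk (tau : face n) (x : 'rV[R]_n) (v : 'M[R]_(p, n)) :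
  cubical_form kk tau x v = basis_form (small_index kk tau) x v.
Proof.
rewrite /cubical_form /basis_form /whitney_form mulrA -big_split /=.
rewrite -(face_edges_eq R p (dirface_small_index kk tau)); congr (_ * _).
by apply: eq_bigr => i _; rewrite ffunE bernp_cell1_of.
Qed.

Lemma small_index_surj c : exists kk tau, small_index kk tau = c.
Proof.
have /choice[m Hm] : forall i, exists mo : 'I_k * option bool, cell1_of mo.1 mo.2 = c i.
  by move=> i; have [m [y e]] := cell1_of_surj k0 (c i); exists (m, y).
exists [ffun i => (m i).1], [ffun i => (m i).2].
by apply/ffunP => i; rewrite !ffunE.
Qed.

Definition small_point c (t : 'rV[R]_n) : 'rV[R]_n := \row_i (cell_param (c i)).[t 0 i].

Lemma small_point_smallset c t : unit_cube t -> smallset c (small_point c t).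
Proof.
move=> t01 i; rewrite mxE cell_paramE mulrC divfK// hi_lo natrD.
have /andP[a0 a1] := t01 i.
case: (is_edge _); rewrite ?mul1r ?mul0r ?addr0 ?lexx//.
by rewrite lerDl a0 lerD2l.
Qed.

Lemma smallset_range c c' : smallset c `<=` smallset c' ->
  forall i, (lo (c' i) <= lo (c i))%N /\ (hi (c i) <= hi (c' i))%N.
Proof.
move=> cc' i.
have u0 : unit_cube (0 : 'rV[R]_n) by move=> j; rewrite mxE lexx ler01.
have u1 : unit_cube (const_mx 1 : 'rV[R]_n) by move=> j; rewrite mxE lexx ler01.
have := cc' _ (small_point_smallset c u0) i; have := cc' _ (small_point_smallset c u1) i.
rewrite !mxE !cell_paramE !(mulrC k%:R) !divfK// mulr1 mulr0 addr0 -natrD -hi_lo !ler_nat.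
by move=> /andP[_ ->] /andP[-> _].
Qed.

Lemma smallset_inj c c' : smallset c = smallset c' -> c = c'.
Proof.
move=> e; apply/ffunP => i.
have [l1 h1] : (lo (c' i) <= lo (c i))%N /\ (hi (c i) <= hi (c' i))%N.
  by apply: smallset_range; rewrite e.
have [l2 h2] : (lo (c i) <= lo (c' i))%N /\ (hi (c' i) <= hi (c i))%N.
  by apply: smallset_range; rewrite e.
by apply: lo_hi_inj; apply/eqP; rewrite eqn_leq ?l1 ?l2 ?h1 ?h2.
Qed.

Lemma smallset_cube c : smallset c `<=` @unit_cube R n.
Proof.
move=> x xc i; have /andP[l h] := xc i.
rewrite -(@ler_pM2l _ k%:R)// mulr0 (le_trans _ l)//=.
rewrite -(@ler_pM2l _ k%:R)// mulr1 (le_trans h)// ler_nat.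
exact: hi_le.
Qed.

Definition infaceb (rho : face n) c : bool :=
  [forall i, if rho i is Some y then c i == inr (if y then ord_max else ord0) else true].

Lemma infaceP rho c : reflect (smallset c `<=` face_set rho) (infaceb rho c).
Proof.
apply: (iffP forallP) => [h x xc i|h i].
  have := h i; case: (rho i) => [y /eqP e|_]; last exact: (smallset_cube xc).
  have := xc i; rewrite e /=; case: y {e} => /= /andP[l u].
    apply: (mulfI kR0); rewrite mulr1; apply/eqP; rewrite eq_le u l//.
  by apply: (mulfI kR0); rewrite mulr0; apply/eqP; rewrite eq_le u l.
case ri: (rho i) => [y|//].
have u0 : unit_cube (0 : 'rV[R]_n) by move=> j; rewrite mxE lexx ler01.
have u1 : unit_cube (const_mx 1 : 'rV[R]_n) by move=> j; rewrite mxE lexx ler01.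
have := h _ (small_point_smallset c u0) i; have := h _ (small_point_smallset c u1) i.
rewrite ri !mxE !cell_paramE mulr1 mulr0 addr0.
move=> /(congr1 ( *%R^~ k%:R)) /=; rewrite divfK// => e1.
move=> /(congr1 ( *%R^~ k%:R)) /=; rewrite divfK// => e0.
have : is_edge (c i) = false.
  by apply/negP => ce; move: e1; rewrite -e0 ce => /eqP; rewrite -subr_eq0 addrAC subrr add0r oner_eq0.
case ci: (c i) => [//|m] _; apply/eqP; congr inr; apply: val_inj.
move: e0; rewrite ci /=; case: (y); rewrite ?mul1r ?mul0r => /eqP.
  by rewrite eqr_nat => /eqP.
by rewrite (eqr_nat _ _ 0) => /eqP.
Qed.

(** After scaling and translating the small cell to a face of the unit cube,
    [signed_permutation] applies.  In the coordinates of the face the edge matrix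
    is then 1/k times an orthogonal one, which gives the determinant. *)
Lemma cell_parametrization p c (b : 'rV[R]_n) (E : 'M[R]_(p, n)) :
  fdim (dirface c) = p -> row_free E ->
  affine (b, E) @` @unit_cube R p = smallset c ->
  exists (f : 'I_p -> 'I_n) (e : 'I_p -> bool),
    [/\ injective f /\ (forall i, is_edge (c i) <-> exists a, f a = i),
        forall t a, unit_cube t -> affine (b, E) t 0 (f a) =
          (cell_param (c (f a))).[if e a then 1 - t 0 a else t 0 a],
        forall t i, unit_cube t -> ~~ is_edge (c i) ->
          affine (b, E) t 0 i = (lo (c i))%:R / k%:R,
        E = E *m (face_edges p (dirface c))^T *m face_edges p (dirface c) &
        `|\det (E *m (face_edges p (dirface c))^T)| = k%:R ^- p].
Proof.
move=> cp rE Ec.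
pose b2 := k%:R *: b - \row_i (lo (c i))%:R; pose E2 := k%:R *: E.
have aff2 t i : affine (b2, E2) t 0 i = k%:R * affine (b, E) t 0 i - (lo (c i))%:R.
  by rewrite /affine /b2 /E2 /= -scalemxAr !mxE; ring.
have rE2 : row_free E2 by rewrite /E2 /row_free (eqmx_scale _ kR0).
have H : affine (b2, E2) @` face_set (cube_face p) = face_set (dirface c).
  rewrite face_set_cube_face; apply/seteqP; split=> [_ [t t01 <-] i|x xc].
    have : smallset c (affine (b, E) t) by rewrite -Ec; exists t.
    move=> /(_ i); rewrite aff2 ffunE hi_lo natrD.
    case: (is_edge _) => /= /andP[l h]; first by apply/andP; split; lra.
    by apply/eqP; rewrite eq_le; apply/andP; split; lra.
  have : smallset c (k%:R^-1 *: (x + \row_i (lo (c i))%:R)).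
    move=> i; have := xc i; rewrite !mxE mulrA divff// mul1r ffunE hi_lo natrD.
    case: (is_edge _) => /=; first by move=> /andP[? ?]; apply/andP; split; lra.
    by move=> ->; rewrite !add0r addr0 lexx.
  rewrite -Ec => -[t t01 te]; exists t => //.
  by apply/rowP => i; rewrite aff2 te !mxE mulrA divff// mul1r addrK.
have [s1 s2 s3 s4] := signed_permutation rE2 H.
have Nn i : (dirface c i = None) <-> is_edge (c i).
  by rewrite -dirface_None; split=> /eqP.
have cN a : cube_face p a = None by rewrite ffunE.
have /choice[g Hg] : forall a : 'I_p, exists je : 'I_n * bool,
   [/\ is_edge (c je.1), E2 a je.1 != 0 & forall t, unit_cube t ->
     affine (b2, E2) t 0 je.1 = if je.2 then 1 - t 0 a else t 0 a].
  move=> a; have [j [tj Eaj]] := s2 a (cN a).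
  have [i [e [ti hx hE]]] := s1 j tj.
  have ia : i = a.
    by move: Eaj; rewrite (hE a (cN a)); case: (eqVneq a i) => [->//|_]; rewrite mul0r eqxx.
  exists (j, e); split=> //; first exact/Nn.
  by move=> t t01; rewrite /= hx ?ia// face_set_cube_face.
exists (fun a => (g a).1), (fun a => (g a).2).
have surj i : is_edge (c i) -> exists a, (g a).1 = i.
  move=> /Nn ci; have [a [e [_ _ hE]]] := s1 i ci; exists a.
  have [ga Ea _] := Hg a; apply: (s3 a); rewrite ?cN//; first exact/Nn.
  by rewrite hE ?cN// eqxx mul1r signr_eq0.
have Ecol i j : dirface c j <> None -> E i j = 0.
  by move=> /s4 /(_ (cN i)) /eqP; rewrite mxE mulf_eq0 (negbTE kR0) => /eqP.
split.
- split; last first.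
    move=> i; split; first exact: surj.
    by case=> a <-; case: (Hg a).
  move=> a a' aa'; have [ga Ea _] := Hg a; have [ga' Ea' _] := Hg a'.
  have [i [e [_ _ hE]]] := s1 _ ((Nn _).2 ga).
  move: Ea' Ea; rewrite -aa' !hE ?cN//.
  case: (eqVneq a' i) => [->|_]; last by rewrite mul0r eqxx.
  by case: (eqVneq a i) => [->|_]; last by rewrite mul0r eqxx.
- move=> t a t01; rewrite cell_paramE; have [ga _ /(_ t t01)] := Hg a.
  rewrite aff2 ga mul1r => <-; rewrite addrC subrK mulrAC divff// mul1r//.
- move=> t i t01 ci.
  have : face_set (dirface c) (affine (b2, E2) t).
    by rewrite -H; exists t => //; rewrite face_set_cube_face.
  move=> /(_ i); rewrite aff2 ffunE (negbTE ci) => /eqP; rewrite subr_eq0 => /eqP <-.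
  by rewrite mulrAC divff// mul1r.
- by rewrite mulmx_face_edges.
have [f0 [f0i f0n f0s FEs]] := face_edges_unit_rows (R := R) cp.
set D := E *m _.
have D2 : (k%:R *: D)^T *m (k%:R *: D) = 1%:M.
  apply/matrixP => a a'; rewrite mxE.
  have DE i l : (k%:R *: D) i l = E2 i (f0 l).
    by rewrite mxE /D FEs mul_unit_rowsT mxE.
  have [i [e [_ _ hE]]] := s1 _ (f0n a).
  rewrite (bigD1 i)//= big1 ?addr0; last first.
    move=> l li; rewrite mxE DE hE ?cN// (negbTE li) !mul0r//.
  rewrite mxE !DE [RHS]mxE; have [<-|aa'] := eqVneq a a'.
    by rewrite hE ?cN// eqxx mul1r -expr2 sqrr_sign.
  have [->|Ea'] := eqVneq (E2 i (f0 a')) 0; first by rewrite mulr0.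
  have Ea : E2 i (f0 a) != 0 by rewrite hE ?cN// eqxx mul1r signr_eq0.
  have := f0i _ _ (s3 i _ _ (cN i) (f0n a) (f0n a') Ea Ea').
  by move=> e'; rewrite e' eqxx in aa'.
have := congr1 (fun M : 'M[R]_p => \det M) D2; rewrite det_mulmx det_tr det1 detZ.
rewrite -expr2 => /eqP; rewrite sqrf_eq1 => /orP h.
have : `|k%:R ^+ p * \det D| = 1.
  by case: h => /eqP ->; rewrite ?normrN normr1.
rewrite normrM normrX ger0_norm ?ltW// => e.
apply: (mulfI (expf_neq0 p kR0)); rewrite e divff// expf_neq0//.
Qed.

Lemma lipC_bernprod p c (a : 'rV[R]_n * 'M[R]_(p, n)) :
  lipC (fun t => bernprod c (affine a t)).
Proof. by apply: lipC_prod => i _; apply/lipC_horner/lipC_affine. Qed.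

Lemma dofs_neq c c' i : is_edge (c i) != is_edge (c' i) -> dofs c c' = 0.
Proof.
by move=> h; rewrite /dofs (bigD1 i)//= /dof1 (negbTE h) mul0r.
Qed.

(** Each coordinate of the parametrized cell depends on one parameter, up to
    reflection, so the iterated integral is a product of integrals over [0,1]. *)
Lemma integral_bernprod p c c' (b : 'rV[R]_n) (E : 'M[R]_(p, n)) :
  fdim (dirface c) = p -> row_free E ->
  affine (b, E) @` @unit_cube R p = smallset c ->
  (forall i, is_edge (c i) = is_edge (c' i)) ->
  cube_integral (fun t => bernprod c' (affine (b, E) t)) = dofs c c'.
Proof.
move=> cp rE Ec ee.
have [f [e [[fi fs] fE fV _ _]]] := cell_parametrization cp rE Ec.
pose V : R := \prod_(i | ~~ is_edge (c i)) dof1 (c i) (c' i).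
pose G a : {poly R} := bernp (c' (f a)) \Po cell_param (c (f a)) \Po (if e a then 1 - 'X else 'X).
have prodE (F : 'I_n -> R) : \prod_i F i =
    (\prod_a F (f a)) * \prod_(i | ~~ is_edge (c i)) F i.
  rewrite (bigID (fun i => is_edge (c i))) /=; congr (_ * _).
  rewrite (eq_bigl (mem [set f a | a in 'I_p]%SET)); last first.
    move=> i; apply/idP/imsetP => [/fs[a <-]|[a _ ->]]; first by exists a.
    by apply/fs; exists a.
  by rewrite big_imset //; exact: in2W.
rewrite (@eq_cube_integral _ _ _ (fun t => V * \prod_a (G a).[t 0 a])); last first.
  move=> t t01; rewrite /bernprod prodE mulrC; congr (_ * _).
    apply: eq_bigr => i ci; rewrite fV//.
    move: (ee i) ci; case: (c i) => [m|m] //= ei _.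
    by rewrite dof1_vertex -ei.
  apply: eq_bigr => a _; rewrite fE// /G !horner_comp; congr (_.[_.[_]]).
  by case: (e a); rewrite !hornerE.
rewrite cube_integralZ; last first.
  by apply: lipC_prod => a _; apply/lipC_horner/lipC_coord.
rewrite cube_integral_prod /dofs prodE mulrC; congr (_ * _).
apply: eq_bigr => a _; rewrite -/(poly_integral (G a)) /dof1 ee eqxx /G.
by case: (e a); rewrite ?poly_integral_reflect// comp_polyXr.
Qed.

Lemma edge_set_neq c c' i0 : fdim (dirface c) = fdim (dirface c') ->
  is_edge (c i0) != is_edge (c' i0) ->
  exists i, dirface c i = None /\ dirface c' i <> None.
Proof.
move=> cc' ne; apply/not_existsP => h.
have sub : [set i | dirface c i == None]%SET \subset [set i | dirface c' i == None]%SET.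
  apply/fintype.subsetP => i; rewrite !inE => /eqP ci; apply/negPn/negP => /eqP ci'.
  exact: (h i).
have /eqP eq : [set i | dirface c i == None]%SET == [set i | dirface c' i == None]%SET.
  rewrite eqEcard sub /=; move: cc'; rewrite /fdim.
  by rewrite -!card_classical_set => ->.
have : (i0 \in [set i | dirface c i == None]%SET) = (i0 \in [set i | dirface c' i == None]%SET).
  by rewrite eq.
by rewrite !inE !dirface_None => e; rewrite e eqxx in ne.
Qed.

Lemma integral_basis_form p c c' (b : 'rV[R]_n) (E : 'M[R]_(p, n)) :
  fdim (dirface c) = p -> fdim (dirface c') = p -> row_free E ->
  affine (b, E) @` @unit_cube R p = smallset c ->
  integral_cell (b, E) (basis_form c') =
  \det (E *m (face_edges p (dirface c))^T) * dofs c c'.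
Proof.
move=> cp c'p rE Ec; rewrite /integral_cell /basis_form /=.
have [/forallP ee|/forallPn[i ei]] := boolP [forall i, is_edge (c i) == is_edge (c' i)].
  rewrite -(integral_bernprod cp rE Ec (fun i => eqP (ee i))).
  rewrite -cube_integralZ; last exact: lipC_bernprod.
  rewrite (@face_edges_eq _ _ p _ (dirface c)); last first.
    by move=> i; rewrite !dirface_None (eqP (ee i)).
  by apply: eq_cube_integral => t _; rewrite mulrC.
rewrite (dofs_neq ei) mulr0 -(cube_integral0 p); apply: eq_cube_integral => t _.
have [f [e [_ _ _ -> _]]] := cell_parametrization cp rE Ec.
rewrite -[X in \det X]mulmxA det_mulmx det_face_edges_neq ?mulr0//.
by apply: (edge_set_neq _ ei); rewrite cp c'p.
Qed.

Lemma dofs_left_inverse : exists G : scell -> scell -> R,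
  forall c c'', \sum_c' G c c' * dofs c' c'' = (c == c'')%:R.
Proof.
have [G HG] := @dof1_left_inverse R k k0.
exists (fun c c' => \prod_i G (c i) (c' i)) => c c''.
transitivity (\sum_(c' : scell) \prod_i (G (c i) (c' i) * dof1 (c' i) (c'' i))).
  by apply: eq_bigr => c' _; rewrite big_split.
rewrite -(bigA_distr_bigA (fun i t => G (c i) t * dof1 t (c'' i))) /=.
under eq_bigr do rewrite HG.
have [->|cc] := eqVneq c c''; first by rewrite big1// => i _; rewrite eqxx.
have [i ci] : exists i, c i != c'' i.
  apply/not_existsP => h; move/eqP: cc; apply; apply/ffunP => i.
  by apply/eqP/negPn/negP => /h.
by rewrite (bigD1 i)//= (negbTE ci) mul0r.
Qed.

(** Each monomial is a product of monomials in one variable, which are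
    combinations of edge polynomials as well as of vertex polynomials. *)
Lemma poly_le_span (c0 : scell) d (q : 'rV[R]_n -> R) : poly_le d q -> (d < k)%N ->
  exists beta : scell -> R,
    (forall c, (exists i, is_edge (c i) != is_edge (c0 i)) -> beta c = 0) /\
    forall x, q x = \sum_c beta c * bernprod c x.
Proof.
move=> dq dk.
suff : forall al : 'I_n -> nat, (forall i, al i + d < k)%N ->
   exists beta : scell -> R,
    (forall c, (exists i, is_edge (c i) != is_edge (c0 i)) -> beta c = 0) /\
    forall x, \prod_i x 0 i ^+ al i * q x = \sum_c beta c * bernprod c x.
  move=> /(_ (fun=> 0%N)) [//|beta [b0 bq]]; exists beta; split => // x.
  by rewrite -bq big1 ?mul1r.
elim: dq {dk} => {d q} [d a|d f g _ IHf _ IHg|d a f _ IHf|d i f _ IHf] al ald.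
- have /choice[be Hbe] : forall i, exists be : cell1 k -> R,
      (forall t, is_edge t != is_edge (c0 i) -> be t = 0) /\
      forall x : R, x ^+ al i = \sum_t be t * (bernp t).[x].
    by move=> i; apply: monomial_span; rewrite // (leq_ltn_trans _ (ald i))// leq_addr.
  exists (fun c => a * \prod_i be i (c i)); split.
    move=> c [i ci]; rewrite (bigD1 i)//= (Hbe i).1// mul0r mulr0//.
  move=> x; rewrite mulrC (eq_bigr _ (fun i _ => (Hbe i).2 (x 0 i))).
  rewrite bigA_distr_bigA /= big_distrr; apply: eq_bigr => c _ /=.
  by rewrite big_split /= mulrA.
- have [bf [bf0 Hf]] := IHf al ald; have [bg [bg0 Hg]] := IHg al ald.
  exists (fun c => bf c + bg c); split=> [c ci|x]; first by rewrite bf0// bg0// addr0.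
  by rewrite mulrDr Hf Hg -big_split; apply: eq_bigr => c _ /=; rewrite mulrDl.
- have [bf [bf0 Hf]] := IHf al ald.
  exists (fun c => a * bf c); split=> [c ci|x]; first by rewrite bf0// mulr0.
  by rewrite mulrCA Hf big_distrr; apply: eq_bigr => c _ /=; rewrite mulrA.
- have [|bf [bf0 Hf]] := IHf (fun j => al j + (j == i))%N.
    move=> j; apply: leq_ltn_trans (ald j).
    by rewrite -addnA leq_add2l; case: (_ == _); rewrite ?add1n ?add0n.
  exists bf; split=> // x; rewrite -Hf mulrA; congr (_ * _).
  under [in RHS]eq_bigr do rewrite exprD.
  rewrite big_split /=; congr (_ * _).
  rewrite (bigD1 i)//= eqxx expr1 big1 ?mulr1// => j ji.
  by rewrite (negbTE ji) expr0.
Qed.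

End SmallCubes.

(** * Small cells of a mesh *)

Section MeshCells.
Context {R : realType} {n : nat} {Omega : set 'rV[R]_n} (K : cubical_mesh Omega).
Context {k : nat} (k0 : (0 < k)%N).
Local Notation scell := {ffun 'I_n -> cell1 k}.
Implicit Types (s : ncell K) (c d : scell).

Definition mcell s c : set 'rV[R]_n := affine (phi s) @` smallset c.

Definition ref_coord s (x : 'rV[R]_n) : 'rV[R]_n := (x - (phi s).1) *m invmx (phi s).2.

Lemma affK s : cancel (affine (phi s)) (ref_coord s).
Proof. by move=> x; rewrite /ref_coord /affine addrC addKr mulmxK// phi_unit. Qed.

Lemma refK s : cancel (ref_coord s) (affine (phi s)).
Proof. by move=> x; rewrite /ref_coord /affine mulmxKV ?phi_unit// addrC subrK. Qed.

Definition ref_param p s (a : 'rV[R]_n * 'M[R]_(p, n)) : 'rV[R]_n * 'M[R]_(p, n) :=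
  ((a.1 - (phi s).1) *m invmx (phi s).2, a.2 *m invmx (phi s).2).

Lemma ref_affine p s (a : 'rV[R]_n * 'M[R]_(p, n)) t :
  ref_coord s (affine a t) = affine (ref_param s a) t.
Proof. by rewrite /ref_coord /affine /ref_param /= addrAC mulmxDl mulmxA. Qed.

Lemma image_affine_sub s (A B : set 'rV[R]_n) :
  affine (phi s) @` A `<=` affine (phi s) @` B -> A `<=` B.
Proof.
move=> AB x Ax; have [|y By yx] := AB (affine (phi s) x); first by exists x.
by rewrite -(can_inj (affK s) yx).
Qed.

Lemma mcell_inj s c c' : mcell s c = mcell s c' -> c = c'.
Proof.
move=> e; apply: (smallset_inj k0); apply/seteqP.
by split; apply: (@image_affine_sub s); rewrite -/(mcell s c) e.
Qed.

Lemma mcell_cell s c : mcell s c `<=` cell s (cube_face n).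
Proof.
apply: image_subset; rewrite face_set_cube_face; exact: smallset_cube.
Qed.

Lemma mcell_face s c rho : mcell s c `<=` cell s rho <-> infaceb rho c.
Proof.
split=> [h|/(infaceP (R := R) k0) h]; last exact: image_subset.
by apply/(infaceP (R := R) k0); exact: (@image_affine_sub s).
Qed.

Lemma mcell_nonempty s c : mcell s c !=set0.
Proof.
exists (affine (phi s) (small_point c 0)); exists (small_point c 0) => //; apply: small_point_smallset => //.
by move=> i; rewrite mxE lexx ler01.
Qed.

Lemma small_cell_mcell s (kk : {ffun 'I_n -> 'I_k}) tau :
  small_cell s kk tau = mcell s (small_index kk tau).
Proof. by rewrite /small_cell small_map_face_set. Qed.

Lemma fdim_small_index kk (tau : face n) : fdim (dirface (small_index (k := k) kk tau)) = fdim tau.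
Proof. by apply: fdim_eq => i; rewrite -dirface_small_index. Qed.

Lemma small_cellsP p u : small_cells K k p u <->
  exists s c, fdim (dirface c) = p /\ u = mcell s c.
Proof.
split=> [[s [kk [tau [tp ->]]]]|[s [c [cp ->]]]].
  by exists s, (small_index kk tau); rewrite fdim_small_index small_cell_mcell.
have [kk [tau e]] := small_index_surj k0 c; exists s, kk, tau.
by rewrite small_cell_mcell -(fdim_small_index kk) e.
Qed.

Lemma mcell_small p s c : fdim (dirface c) = p -> small_cells K k p (mcell s c).
Proof. by move=> cp; apply/small_cellsP; exists s, c. Qed.

Lemma local_formE p s c : fdim (dirface c) = p ->
  local_form (K := K) k (p := p) (mcell s c) s =
  fun x v => basis_form c (ref_coord s x) (v *m invmx (phi s).2).
Proof.
move=> cp; rewrite /local_form; case: pickP => [[kk tau] /asboolP [/= tp e]|h].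
  have -> : c = small_index kk tau by apply: (@mcell_inj s); rewrite -e small_cell_mcell.
  by apply/funext => x; apply/funext => v; rewrite cubical_form_basis.
have [kk [tau e]] := small_index_surj k0 c; have := h (kk, tau) => /= /asboolP[].
by rewrite small_cell_mcell e -(fdim_small_index kk) e.
Qed.

Lemma local_form0 p s u :
  (forall c, fdim (dirface c) = p -> mcell s c <> u) ->
  local_form (K := K) k (p := p) u s = fun _ _ => 0.
Proof.
move=> h; rewrite /local_form; case: pickP => // -[kk tau] /asboolP [/= tp e].
by case: (h (small_index kk tau)); rewrite ?fdim_small_index// -small_cell_mcell.
Qed.

Lemma local_form_cases p s u :
  (exists c, [/\ fdim (dirface c) = p, u = mcell s c &
     local_form (K := K) k (p := p) u s =
     fun x v => basis_form c (ref_coord s x) (v *m invmx (phi s).2)]) \/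
  ((forall c, fdim (dirface c) = p -> mcell s c <> u) /\
     local_form (K := K) k (p := p) u s = fun _ _ => 0).
Proof.
have [[c [cp e]]|h] := pselect (exists c, fdim (dirface c) = p /\ u = mcell s c).
  by left; exists c; rewrite e local_formE.
right; have h' c : fdim (dirface c) = p -> mcell s c <> u.
  by move=> cp e; apply: h; exists c.
by split=> //; rewrite local_form0.
Qed.

Lemma lipC_local_form p q s u (a : 'rV[R]_n * 'M[R]_(q, n)) (v : 'M[R]_(p, n)) :
  lipC (fun t => local_form (K := K) k u s (affine a t) v).
Proof.
have [[c [cp _ ->]]|[_ ->]] := local_form_cases p s u; last exact: lipC_cst.
rewrite /basis_form; apply: lipCM; last exact: lipC_cst.
by apply: eq_lipC (lipC_bernprod c (ref_param s a)) => t; rewrite ref_affine.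
Qed.

Section Orientation.
Context {p : nat} (o : orientation K k p).

Lemma ocell_ref s c : fdim (dirface c) = p ->
  row_free (ref_param s (ocell o (mcell s c))).2 /\
  affine (ref_param s (ocell o (mcell s c))) @` @unit_cube R p = smallset c.
Proof.
move=> cp; have [rE Eu] := ocellP o (mcell_small s cp); split.
  rewrite /= /row_free mxrankMfree; first exact: rE.
  by rewrite row_free_unit unitmx_inv phi_unit.
move/seteqP: Eu => [E1 E2].
apply/seteqP; split=> [_ [t t01 <-]|x xc].
  have [|y yc] := E1 (affine (ocell o (mcell s c)) t); first by exists t.
  by rewrite -ref_affine => <-; rewrite affK.
have [|t t01 te] := E2 (affine (phi s) x); first by exists x.
exists t => //.
by rewrite -ref_affine te affK.
Qed.

(** Compares the orientation of u with the coordinates of s; its absolute value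
    is k^-p when u is the small cell c of s. *)
Definition orient_det u s c : R :=
  \det ((ocell o u).2 *m invmx (phi s).2 *m (face_edges p (dirface c))^T).

Lemma integral_local_form s c c' :
  fdim (dirface c) = p -> fdim (dirface c') = p ->
  integral_cell (ocell o (mcell s c)) (local_form (K := K) k (mcell s c') s) =
  orient_det (mcell s c) s c * dofs c c'.
Proof.
move=> cp c'p; have [rE Ec] := ocell_ref s cp.
rewrite -(integral_basis_form k0 cp c'p rE Ec) local_formE//.
by apply: eq_cube_integral => t _; rewrite ref_affine.
Qed.

Lemma normr_orient_det s c : fdim (dirface c) = p ->
  `|orient_det (mcell s c) s c| = k%:R ^- p.
Proof.
move=> cp; have [rE Ec] := ocell_ref s cp.
by have [f [e [_ _ _ _ h]]] := cell_parametrization k0 cp rE Ec.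
Qed.

Lemma orient_det_neq0 s c : fdim (dirface c) = p -> orient_det (mcell s c) s c != 0.
Proof.
by move=> cp; rewrite -normr_eq0 normr_orient_det// invr_eq0 expf_neq0// pnatr_eq0 -lt0n.
Qed.

Lemma dofs_diag_gt0 c : 0 < dofs c c :> R.
Proof. by apply: prodr_gt0 => i _; exact: dof1_diag_gt0. Qed.

Lemma small_form_mcell s c : fdim (dirface c) = p ->
  small_form o (mcell s c) s = fun x v =>
    Num.sg (orient_det (mcell s c) s c) * local_form (K := K) k (mcell s c) s x v.
Proof.
move=> cp; apply/funext => x; apply/funext => v; rewrite /small_form.
by rewrite integral_local_form// sgrM (gtr0_sg (dofs_diag_gt0 c)) mulr1.
Qed.

Lemma lipC_small_form q s u (a : 'rV[R]_n * 'M[R]_(q, n)) (v : 'M[R]_(p, n)) :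
  lipC (fun t => small_form o u s (affine a t) v).
Proof. by apply: lipCZ; exact: lipC_local_form. Qed.

Lemma integral_small_form s c c' :
  fdim (dirface c) = p -> fdim (dirface c') = p ->
  integral_cell (ocell o (mcell s c)) (small_form o (mcell s c') s) =
  Num.sg (orient_det (mcell s c') s c') * (orient_det (mcell s c) s c * dofs c c').
Proof.
move=> cp c'p; rewrite small_form_mcell// -integral_local_form//.
by rewrite -cube_integralZ//; exact: lipC_local_form.
Qed.

Lemma integral_small_form0 s u a :
  (forall c, fdim (dirface c) = p -> mcell s c <> u) ->
  integral_cell a (small_form o u s) = 0.
Proof.
move=> h; rewrite /small_form local_form0//.
apply: etrans (cube_integral0 p).
by apply: eq_cube_integral => t _; rewrite mulr0.
Qed.

End Orientation.

(** By [signed_permutation], the change of coordinates on the common face permutes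
    and reflects the free coordinates; theta permutes and reflects the factors of c
    accordingly.  The fixed coordinates contribute factors 1 to the degrees of
    freedom. *)
Lemma common_face s s' rho rho' : cell s rho = cell s' rho' ->
  exists theta : scell -> scell, forall c, infaceb rho c ->
    [/\ infaceb rho' (theta c), mcell s' (theta c) = mcell s c,
        fdim (dirface (theta c)) = fdim (dirface c) &
        forall c', infaceb rho c' -> dofs (theta c) (theta c') = dofs c c' :> R].
Proof.
move=> eF; pose E := (phi s).2 *m invmx (phi s').2.
pose b := ((phi s).1 - (phi s').1) *m invmx (phi s').2.
have fE x : affine (b, E) x = ref_coord s' (affine (phi s) x) by rewrite ref_affine.
have rE : row_free E.
  by rewrite row_free_unit unitmx_mul unitmx_inv !phi_unit.
have H : affine (b, E) @` face_set rho = face_set rho'.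
  apply/seteqP; split=> [_ [x xr <-]|x xr].
    have : cell s' rho' (affine (phi s) x) by rewrite -eF; exists x.
    by rewrite fE => -[y yr <-]; rewrite affK.
  have : cell s rho (affine (phi s') x) by rewrite eF; exists x.
  by case=> y yr e; exists y => //; rewrite fE e affK.
have [s1 s2 s3 s4] := signed_permutation rE H.
have /choice[g Hg] : forall j, exists ie : 'I_n * bool, rho' j = None ->
    [/\ rho ie.1 = None,
        forall x, face_set rho x ->
          affine (b, E) x 0 j = if ie.2 then 1 - x 0 ie.1 else x 0 ie.1 &
        E ie.1 j != 0].
  move=> j; case rj: (rho' j) => [y|]; first by exists (j, false).
  have [i [e [ri hx hE]]] := s1 j rj; exists (i, e) => _; split=> //=.
  by rewrite hE// eqxx mul1r signr_eq0.
have gi j j' : rho' j = None -> rho' j' = None -> (g j).1 = (g j').1 -> j = j'.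
  move=> rj rj' e; have [ri _ Ej] := Hg j rj; have [_ _ Ej'] := Hg j' rj'.
  by apply: (s3 (g j).1) => //; rewrite e.
have gs i : rho i = None -> exists2 j, rho' j = None & (g j).1 = i.
  move=> ri; have [j [rj Eij]] := s2 i ri; exists j => //.
  have [l [e [rl _ hE]]] := s1 j rj; have [rg _ Eg] := Hg j rj.
  have il : i = l.
    by move: Eij; rewrite hE//; case: (eqVneq i l) => [->//|_]; rewrite mul0r eqxx.
  have gl : (g j).1 = l.
    by move: Eg; rewrite hE//; case: (eqVneq (g j).1 l) => [->//|_]; rewrite mul0r eqxx.
  by rewrite gl.
pose theta c : scell := [ffun j => if rho' j is Some y
  then inr (if y then ord_max else ord0)
  else (if (g j).2 then rev1 (c (g j).1) else c (g j).1)].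
have thin c : infaceb rho' (theta c).
  by apply/forallP => j; rewrite ffunE; case: (rho' j) => [y|].
have kR : (0 : R) < k%:R by rewrite ltr0n.
have coord c (x : 'rV[R]_n) j : face_set rho x -> rho' j = None ->
  ((lo (theta c j))%:R <= k%:R * affine (b, E) x 0 j <= (hi (theta c j))%:R) =
  ((lo (c (g j).1))%:R <= k%:R * x 0 (g j).1 <= (hi (c (g j).1))%:R).
  move=> xr rj; have [_ gx _] := Hg j rj; rewrite ffunE rj gx//.
  case: (g j).2 => //; have := hi_le (c (g j).1); have := hi_lo (c (g j).1).
  move=> h1 h2; rewrite lo_rev hi_rev !natrB//; last by rewrite (leq_trans _ h2)// h1 leq_addr.
  by rewrite mulrBr mulr1; apply/andP/andP => -[? ?]; split; lra.
have thset c : infaceb rho c -> smallset (theta c) = affine (b, E) @` smallset c :> set 'rV[R]_n.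
  move=> cr; have /(infaceP (R := R) k0) cF := cr.
  have /(infaceP (R := R) k0) tF := thin c.
  apply/seteqP; split=> [y yt|_ [x xc <-] j].
    have := tF _ yt; rewrite -H => -[x xr xy]; exists x => // i.
    case ri: (rho i) => [z|].
      have := forallP cr i; rewrite ri => /eqP ->; have := xr i; rewrite ri => ->.
      by case: z {ri} => /=; rewrite ?mulr1 ?mulr0 lexx.
    have [j rj <-] := gs i ri.
    by rewrite -coord// xy; exact: yt.
  case rj: (rho' j) => [y|]; last by rewrite coord//; exact: cF.
  have : face_set rho' (affine (b, E) x) by rewrite -H; exists x => //; exact: cF.
  move=> /(_ j); rewrite rj => ->; rewrite ffunE rj.
  by case: y {rj} => /=; rewrite ?mulr1 ?mulr0 lexx.
exists theta => c cr; split => //.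
- rewrite /mcell thset//; apply/seteqP; split=> [_ [_ [x xc <-] <-]|_ [x xc <-]].
    by exists x => //; rewrite fE refK.
  by exists (affine (b, E) x); [exists x|rewrite fE refK].
- rewrite /fdim !card_classical_set.
  rewrite -(@card_in_imset _ _ (fun j => (g j).1)
    [set j | dirface (theta c) j == None]%SET); last first.
    move=> j j'; rewrite !inE !dirface_None !ffunE.
    case rj: (rho' j) => [//|]; case rj': (rho' j') => [//|] _ _; exact: gi.
  apply: eq_card => i; rewrite !inE dirface_None; apply/imsetP/idP.
    case=> j; rewrite inE dirface_None ffunE; case rj: (rho' j) => [//|] e ->.
    by move: e; case: ifP => // _; rewrite is_edge_rev.
  move=> ci; have ri : rho i = None.
    by have := forallP cr i; case: (rho i) => // y /eqP ce; rewrite ce in ci.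
  have [j rj ji] := gs i ri; exists j => //; rewrite inE dirface_None ffunE rj.
  by case: ifP => _; rewrite ?is_edge_rev ji.
move=> c' c'r; rewrite /dofs.
have cut (r : face n) (F : 'I_n -> R) : (forall i, r i <> None -> F i = 1) ->
    \prod_i F i = \prod_(i | r i == None) F i.
  move=> F1; rewrite (bigID (fun i => r i == None)) /= [X in _ * X]big1 ?mulr1//.
  by move=> i /eqP ri; exact: F1.
(* the factors at the fixed coordinates are 1, by [dof1_left] and [dof1_right] *)
have d1 (y : bool) (t : cell1 k) : t = inr (if y then ord_max else ord0) ->
    dof1 t t = 1 :> R.
  by move=> ->; case: y; rewrite ?dof1_left ?dof1_right// eqxx.
rewrite (cut rho'); last first.
  by move=> j; rewrite !ffunE; case: (rho' j) => // y _; exact: d1.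
rewrite [RHS](cut rho); last first.
  move=> i; have := forallP cr i; have := forallP c'r i.
  by case: (rho i) => // y /eqP -> /eqP -> _; exact: d1.
rewrite [RHS](eq_bigl (mem [set (g j).1 | j in [set j | rho' j == None]]%SET)); last first.
  move=> i; apply/eqP/imsetP => [ri|[j]].
    by have [j rj <-] := gs i ri; exists j; rewrite ?inE ?rj.
  by rewrite inE => /eqP rj ->; case: (Hg j rj).
rewrite big_imset /=; last by move=> j j'; rewrite !inE => /eqP rj /eqP rj'; exact: gi.
rewrite (eq_bigl (fun j => j \in [set j | rho' j == None]%SET)); last by move=> j; rewrite inE.
apply: eq_bigr => j; rewrite inE => /eqP rj; rewrite !ffunE rj.
by case: ifP => _ //; rewrite dof1_rev.
Qed.

Lemma mcell_meet s s' d : mcell s' d `<=` cell s (cube_face n) ->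
  exists rho rho', [/\ cell s rho = cell s' rho', infaceb rho' d &
    cell s (cube_face n) `&` cell s' (cube_face n) = cell s rho].
Proof.
move=> ds; case: (mesh_meet s (cube_face n) s' (cube_face n)) => [e|].
  have [x xd] := mcell_nonempty s' d.
  have : (cell s (cube_face n) `&` cell s' (cube_face n)) x.
    by split; [exact: ds|exact: mcell_cell xd].
  by rewrite e.
case=> rho [rho' [_ _ e e']]; exists rho, rho'; rewrite -e -e'; split=> //.
by apply/(mcell_face s'); rewrite -e' => x xd; split;
  [exact: ds|exact: mcell_cell xd].
Qed.

(** The small cell lies in the intersection of two n-cells, which is a common face
    of both; there [common_face] translates between the two subdivisions. *)
Lemma mcell_in p s u : small_cells K k p u -> u `<=` cell s (cube_face n) ->
  exists2 c, fdim (dirface c) = p & u = mcell s c.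
Proof.
move=> /small_cellsP[s' [d [dp ->]]] us.
have [rho [rho' [e dr _]]] := mcell_meet us.
have [theta /(_ d dr)[_ th1 th2 _]] := common_face (esym e).
by exists (theta d); rewrite ?th2.
Qed.

Section Independence.
Context {p : nat} (o : orientation K k p).

Lemma integral_small_form_off_face s c rho u : fdim (dirface c) = p ->
  infaceb rho c -> ~ (u `<=` cell s rho) ->
  integral_cell (ocell o (mcell s c)) (small_form o u s) = 0.
Proof.
move=> cp cr ur; have [[c' [c'p uE _]]|[h _]] := local_form_cases p s u; last first.
  exact: integral_small_form0.
rewrite uE integral_small_form//.
have /forallPn[i] : ~~ infaceb rho c'.
  by apply/negP => /(mcell_face s); rewrite -uE.
have := forallP cr i; case: (rho i) => [y /eqP ci /negbTE c'i|//].
by rewrite /dofs (bigD1 i)//= ci; case: y c'i {ci} => c'i;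
  rewrite ?dof1_left ?dof1_right// c'i mul0r !mulr0.
Qed.

(** If u' is not in the common face of s and s', both integrals vanish.  Otherwise
    [common_face] identifies the degrees of freedom, and it remains to compare the
    signs.  When the integral is not 0, u and u' are parallel, so their edge matrices
    differ by a matrix M that does not involve s; the product of the signs of u and
    u' in s is the sign of det M. *)
Lemma integral_small_form_indep s s' u u' :
  small_cells K k p u -> small_cells K k p u' ->
  u `<=` cell s (cube_face n) -> u `<=` cell s' (cube_face n) ->
  integral_cell (ocell o u) (small_form o u' s) =
  integral_cell (ocell o u) (small_form o u' s').
Proof.
move=> us u's uss uss'.
have [c cp uE] := mcell_in us uss; rewrite uE in uss'.
have [rho' [rho [e cr eI]]] := mcell_meet uss'.
have [theta Hth] := common_face (esym e).
have [dr' dE dp ddof] := Hth c cr; rewrite cp in dp.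
have [u'F|u'F] := pselect (u' `<=` cell s rho); last first.
  rewrite [in LHS]uE (integral_small_form_off_face cp cr)// uE -dE.
  by rewrite (integral_small_form_off_face dp dr')// e.
have sub (r : face n) t : cell t r `<=` cell t (cube_face n).
  apply: image_subset => x xr i; rewrite ffunE; have := xr i.
  by case: (r i) => // y ->; case: y; rewrite lexx ler01.
have [c' c'p u'E] : exists2 c', fdim (dirface c') = p & u' = mcell s c'.
  by apply: mcell_in => // x /u'F; exact: sub.
have c'r : infaceb rho c' by apply/(mcell_face s); rewrite -u'E.
have [dr'' dE' dp' _] := Hth c' c'r; rewrite c'p in dp'.
have intE t (f f' : scell) : fdim (dirface f) = p -> fdim (dirface f') = p ->
    u = mcell t f -> u' = mcell t f' ->
  integral_cell (ocell o u) (small_form o u' t) =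
    Num.sg (orient_det o u' t f') * (orient_det o u t f * dofs f f').
  by move=> fp fp' -> ->; rewrite integral_small_form.
rewrite (intE s c c')// (intE s' (theta c) (theta c')) ?dE ?dE'// ddof//.
have [->|dn0] := eqVneq (dofs c c') (0 : R); first by rewrite !mulr0.
have types (f f' : scell) : dofs f f' != 0 :> R ->
    face_edges p (dirface f) = face_edges p (dirface f') :> 'M[R]_(p, n).
  move=> fn0; apply: face_edges_eq => i; rewrite !dirface_None; apply/eqP/negPn/negP.
  by move=> /dofs_neq fi; rewrite fi eqxx in fn0.
pose D := (ocell o u).2 *m invmx (phi s).2 *m (face_edges p (dirface c))^T.
pose D' := (ocell o u').2 *m invmx (phi s).2 *m (face_edges p (dirface c'))^T.
pose M := D *m invmx D'.
have param t f : fdim (dirface f) = p -> forall w, w = mcell t f ->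
    (ocell o w).2 *m invmx (phi t).2 = (ocell o w).2 *m invmx (phi t).2 *m
      (face_edges p (dirface f))^T *m face_edges p (dirface f).
  move=> fp w ->; have [rE Ec] := ocell_ref o t fp.
  by have [g [e' [_ _ _ h _]]] := cell_parametrization k0 fp rE Ec.
have uM : (ocell o u).2 = M *m (ocell o u').2.
  have cancel_phi (A B : 'M[R]_(p, n)) : A *m invmx (phi s).2 = B *m invmx (phi s).2 -> A = B.
    by move/(congr1 (mulmx^~ (phi s).2)); rewrite !mulmxKV ?phi_unit.
  have uD' : D' \in unitmx by rewrite unitmxE unitfE /D' u'E orient_det_neq0.
  apply: cancel_phi; rewrite -mulmxA (param s c cp _ uE) (param s c' c'p _ u'E).
  by rewrite -/D -/D' /M mulmxA mulmxKV// (types c c').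
(* M was defined from s, but the relation between u and u' is intrinsic *)
clearbody M; have oM t f f' : face_edges p (dirface f) = face_edges p (dirface f') :> 'M[R]_(p, n) ->
    orient_det o u t f = \det M * orient_det o u' t f'.
  by move=> ff'; rewrite /orient_det uM ff' -!mulmxA det_mulmx.
rewrite (oM s c c'); last exact: types.
rewrite (oM s' (theta c) (theta c')); last by apply: types; rewrite ddof.
have sgE t f : fdim (dirface f) = p -> u' = mcell t f ->
    Num.sg (orient_det o u' t f) * (\det M * orient_det o u' t f * dofs c c') =
    k%:R ^- p * (\det M * dofs c c').
  by move=> fp ->; rewrite -(normr_orient_det o t fp) [in RHS]normrEsg; ring.
by rewrite (sgE s c')// (sgE s' (theta c')) ?dE'.
Qed.

End Independence.

End MeshCells.

(** * Unisolvence on the unit cube *)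

Section Unisolvence.
Context {R : realType} {n k : nat} (k0 : (0 < k)%N).
Local Notation scell := {ffun 'I_n -> cell1 k}.

Lemma dofs_inversion : exists G : scell -> scell -> R,
  forall (y : scell -> R) c,
    y c = \sum_c' G c c' * \sum_c'' y c'' * dofs c' c''.
Proof.
have [G HG] := @dofs_left_inverse R n k k0; exists G => y c.
under [in RHS]eq_bigr do rewrite mulr_sumr.
rewrite exchange_big /= (bigD1 c)//= [X in _ = _ + X]big1 ?addr0; last first.
  move=> c'' cc''; under eq_bigr do rewrite mulrCA.
  by rewrite -mulr_sumr HG eq_sym (negbTE cc'') mulr0.
by under [in RHS]eq_bigr do rewrite mulrCA; rewrite -mulr_sumr HG eqxx mulr1.
Qed.

(** The constant is the sum of the absolute values of the entries of the inverse
    matrix, as the basis functions are bounded by 1 on the cube. *)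
Lemma dofs_bound : exists C : R, 0 <= C /\ forall (kap : scell -> R) (e : R),
  (forall c, `|\sum_c' kap c' * dofs c c'| <= e) ->
  forall x, unit_cube x -> `|\sum_c kap c * bernprod c x| <= C * e.
Proof.
have [G HG] := dofs_inversion.
exists (\sum_c \sum_c' `|G c c'|); split.
  by apply: sumr_ge0 => c _; apply: sumr_ge0.
move=> kap e He x x01.
rewrite (le_trans (ler_norm_sum _ _ _))// mulr_suml; apply: ler_sum => c _.
have bx : `|bernprod c x| <= 1.
  rewrite normr_prod; apply: prodr_ile1 => i _.
  by rewrite normr_ge0 bernp_le1//; exact: x01.
rewrite (HG kap c).
rewrite normrM -[leRHS]mulr1 ler_pM//.
rewrite (le_trans (ler_norm_sum _ _ _))// mulr_suml; apply: ler_sum => c' _.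
by rewrite normrM ler_wpM2l.
Qed.

Lemma dofs_types (c c' : scell) :
  (forall i, is_edge (c i) = is_edge (c' i)) \/
  (exists i, is_edge (c i) != is_edge (c' i)).
Proof.
have [/forallP h|/forallPn[i h]] := boolP [forall i, is_edge (c i) == is_edge (c' i)].
  by left=> i; exact/eqP.
by right; exists i.
Qed.

Lemma fdim_types (c c' : scell) :
  (forall i, is_edge (c i) = is_edge (c' i)) -> fdim (dirface c) = fdim (dirface c').
Proof. by move=> h; apply: fdim_eq => i; rewrite !dirface_None h. Qed.

(** The matrix of degrees of freedom is block diagonal with respect to the
    dimension of the cells, so each block is injective too. *)
Lemma dofs_unisolvent p (y : scell -> R) :
  (forall c, fdim (dirface c) = p ->
     \sum_(c' | fdim (dirface c') == p) y c' * dofs c c' = 0) ->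
  forall c, fdim (dirface c) = p -> y c = 0.
Proof.
move=> h c cp.
have [G HG] := dofs_inversion.
pose z c := if fdim (dirface c) == p then y c else 0.
have hz c1 : \sum_c' z c' * dofs c1 c' = 0.
  transitivity (\sum_(c' | fdim (dirface c') == p) y c' * dofs c1 c').
    rewrite [RHS]big_mkcond; apply: eq_bigr => c' _; rewrite /z.
    by case: ifP; rewrite ?mul0r.
  have [/h//|/eqP c1p] := eqVneq (fdim (dirface c1)) p.
  (* cells of different dimensions differ in the type of some coordinate *)
  apply: big1 => c' /eqP c'p; have [/fdim_types e|[i /dofs_neq ->]] := dofs_types c1 c'.
    by case: c1p; rewrite e.
  by rewrite mulr0.
have <- : z c = y c by rewrite /z cp eqxx.
by rewrite (HG z c) big1// => c' _; rewrite hz mulr0.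
Qed.

End Unisolvence.

(** * Existence of the interpolant *)

Section Existence.
Context {R : realType} {n : nat} {Omega : set 'rV[R]_n} (K : cubical_mesh Omega).
Context {k p : nat} (k0 : (0 < k)%N) (o : orientation K k p).
Local Notation scell := {ffun 'I_n -> cell1 k}.

Definition cell_list : seq (set 'rV[R]_n) :=
  undup [seq mcell sc.1 sc.2 | sc <- enum {: ncell K * scell} & fdim (dirface sc.2) == p].

Lemma mem_cell_list u : u \in cell_list <-> small_cells K k p u.
Proof.
rewrite mem_undup small_cellsP//; split.
  case/mapP => -[s c]; rewrite mem_filter => /andP[/eqP cp _] ->.
  by exists s, c.
case=> s [c [cp ->]]; apply/mapP; exists (s, c) => //.
by rewrite mem_filter cp eqxx /= mem_enum.
Qed.

(** Distinct small cells of s are distinct as sets, so a sum over all small cells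
    that only sees those of s can be taken over their indices. *)
Lemma sum_cell_list (s : ncell K) (F : set 'rV[R]_n -> R) :
  (forall u, (forall c : scell, fdim (dirface c) = p -> mcell s c <> u) -> F u = 0) ->
  \sum_(u <- cell_list) F u = \sum_(c : scell | fdim (dirface c) == p) F (mcell s c).
Proof.
move=> F0.
pose Ls := [seq mcell s c | c <- enum {: scell} & fdim (dirface c) == p].
rewrite (bigID (fun u => u \in Ls)) /= [X in _ + X]big1 ?addr0; last first.
  move=> u /negP uL; apply: F0 => c cp e; apply: uL; rewrite -e.
  by apply: map_f; rewrite mem_filter cp eqxx mem_enum.
rewrite -big_filter (perm_big Ls) /=.
  by rewrite big_map big_filter big_enum_cond.
apply: uniq_perm; first by rewrite filter_uniq ?undup_uniq.
  rewrite map_inj_uniq ?filter_uniq -?enumT ?enum_uniq// => c c'; exact: (mcell_inj k0).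
move=> u; rewrite mem_filter andb_idr// => /mapP[c]; rewrite mem_filter => /andP[/eqP cp _] ->.
by apply/mem_cell_list; exact: (mcell_small k0).
Qed.

(** The system is square, so it suffices that a combination of the small forms whose
    integrals all vanish is trivial.  Restricted to an n-cell s, it is a combination
    of the basis forms of s, and [dofs_unisolvent] applies. *)
Lemma interpolates_exists (X : set 'rV[R]_n -> R) : exists eta, interpolates o X eta.
Proof.
pose N := size cell_list; pose uu (a : 'I_N) := nth set0 cell_list a.
have uuL a : uu a \in cell_list by rewrite mem_nth.
have uuS a : small_cells K k p (uu a) by apply/mem_cell_list.
have uuI a b : uu a = uu b -> a = b.
  by move=> /eqP; rewrite nth_uniq ?undup_uniq// => /eqP /ord_inj.
have uuP u : small_cells K k p u -> exists a, uu a = u.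
  move/mem_cell_list => uL; have iN : (index u cell_list < N)%N by rewrite index_mem.
  by exists (Ordinal iN); rewrite /uu /= nth_index.
have /choice[ss Hss] : forall a, exists s : ncell K, uu a `<=` cell s (cube_face n).
  by move=> a; have /small_cellsP[//|s [c [_ ->]]] := uuS a; exists s; exact: mcell_cell.
pose M : 'M[R]_N := \matrix_(b, a) integral_cell (ocell o (uu a)) (small_form o (uu b) (ss a)).
have Mind a b s : uu a `<=` cell s (cube_face n) ->
    M b a = integral_cell (ocell o (uu a)) (small_form o (uu b) s).
  by move=> us; rewrite mxE; apply: integral_small_form_indep.
have uM : M \in unitmx.
  rewrite -row_free_unit; apply: inj_row_free => v vM.
  (* xi u is the coefficient of the cell u *)
  pose xi u := \sum_b v 0 b * (uu b == u)%:R.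
  have xiE b : xi (uu b) = v 0 b.
    rewrite /xi (bigD1 b)//= eqxx mulr1 big1 ?addr0// => b' b'b.
    by case: eqP => [/uuI e|_]; rewrite ?mulr0//; rewrite e eqxx in b'b.
  have loc (s : ncell K) (c : scell) : fdim (dirface c) = p -> xi (mcell s c) = 0.
    move=> cp.
    suff : xi (mcell s c) * Num.sg (orient_det o (mcell s c) s c) = 0.
      by move/eqP; rewrite mulf_eq0 sgr_eq0 (negbTE (orient_det_neq0 k0 o s cp)) orbF => /eqP.
    apply: (dofs_unisolvent k0 (p := p)
      (y := fun c => xi (mcell s c) * Num.sg (orient_det o (mcell s c) s c)) _ cp).
    move=> c1 c1p; have [a ua] := uuP _ (mcell_small k0 s c1p).
    have /rowP/(_ a) := vM; rewrite mxE [in RHS]mxE => e.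
    apply: (mulfI (orient_det_neq0 k0 o s c1p)); rewrite mulr0 -[RHS]e.
    transitivity (\sum_(u <- cell_list) xi u *
        integral_cell (ocell o (mcell s c1)) (small_form o u s)); last first.
      rewrite (big_nth set0) big_mkord; apply: eq_bigr => b _.
      by rewrite -/(uu b) xiE (Mind a b s) ua//; exact: mcell_cell.
    rewrite (sum_cell_list (s := s)); last first.
      by move=> u hu; rewrite integral_small_form0// mulr0.
    rewrite mulr_sumr; apply: eq_bigr => c2 /eqP c2p.
    by rewrite integral_small_form//; ring.
  apply/rowP => b; rewrite -xiE [RHS]mxE.
  by have /small_cellsP[//|s [c [cp ->]]] := uuS b; exact: loc.
pose v := (\row_a X (uu a)) *m invmx M.
have vM : v *m M = \row_a X (uu a) by rewrite mulmxKV.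
exists (fun s x w => \sum_b v 0 b * small_form o (uu b) s x w); split.
  by exists N, uu, (fun b => v 0 b).
move=> u us s uss; have [a ua] := uuP _ us.
rewrite /integral_cell cube_integral_sum; last first.
  by move=> b _; apply: lipCZ; exact: lipC_small_form.
have /rowP/(_ a) := vM; rewrite mxE [in RHS]mxE ua => <-.
apply: eq_bigr => b _; rewrite cube_integralZ; last exact: lipC_small_form.
by rewrite (Mind a b s) ua// uss.
Qed.

Lemma interpolationP (X : set 'rV[R]_n -> R) : interpolates o X (interpolation o X).
Proof.
exact: (@getPex _ (interpolates o X : set (ncell K -> pform R n p))
  (interpolates_exists X)).
Qed.

(** On a fixed n-cell, the cells of other n-cells contribute nothing and a sign is
    absorbed in the coefficient. *)
Lemma Qspace_local eta (s : ncell K) : Qspace o eta ->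
  exists gam : scell -> R, (forall c, fdim (dirface c) <> p -> gam c = 0) /\
    forall x v, eta s x v = \sum_c gam c * basis_form c (ref_coord s x) (v *m invmx (phi s).2).
Proof.
case=> m [u [a [_ ->]]].
have /choice[g Hg] : forall i : 'I_m, exists gam : scell -> R,
    (forall c, fdim (dirface c) <> p -> gam c = 0) /\
    forall x v, small_form o (u i) s x v =
      \sum_c gam c * basis_form c (ref_coord s x) (v *m invmx (phi s).2).
  move=> i; rewrite /small_form.
  have [[c [cp _ ->]]|[_ ->]] := local_form_cases k0 p s (u i); last first.
    exists (fun=> 0); split=> // x v; rewrite mulr0 big1// => c _; exact: mul0r.
  set sg := Num.sg _; exists (fun c' => if c' == c then sg else 0); split.
    by move=> c' c'p; case: eqP => // e; rewrite e in c'p.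
  move=> x v; rewrite (bigD1 c)//= eqxx big1 ?addr0// => c' /negbTE ->.
  exact: mul0r.
exists (fun c => \sum_i a i * g i c); split.
  by move=> c cp; rewrite big1// => i _; rewrite (Hg i).1// mulr0.
move=> x v; under [in RHS]eq_bigr do rewrite mulr_suml.
rewrite exchange_big; apply: eq_bigr => i _ /=.
by rewrite (Hg i).2 mulr_sumr; apply: eq_bigr => c _; rewrite mulrA.
Qed.

End Existence.

(** * Diameter, fullness and the inverse of the edge matrix *)

Section Geometry.
Context {R : realType} {n : nat}.

Lemma enorm_ge0 (v : 'rV[R]_n) : 0 <= enorm v.
Proof. exact: sqrtr_ge0. Qed.

Lemma le_enorm (v : 'rV[R]_n) i : `|v 0 i| <= enorm v.
Proof.
rewrite -sqrtr_sqr ler_wsqrtr// (bigD1 i)//= lerDl.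
by apply: sumr_ge0 => j _; exact: sqr_ge0.
Qed.

Lemma enorm_bound (v : 'rV[R]_n) B : (forall i, `|v 0 i| <= B) ->
  enorm v <= Num.sqrt (n%:R * B ^+ 2).
Proof.
move=> vB; rewrite ler_wsqrtr//.
apply: (@le_trans _ _ (\sum_(i < n) B ^+ 2)).
  apply: ler_sum => i _; rewrite -real_normK ?num_real//.
  by rewrite lerXn2r ?nnegrE// (le_trans _ (vB i)).
by rewrite sumr_const card_ord mulr_natl.
Qed.

Context {Omega : set 'rV[R]_n} (K : cubical_mesh Omega) (s : ncell K).
Local Notation E := (phi s).2.
Local Notation d := (diam (cell s (cube_face n))).

Lemma diam_has_ub :
  has_ubound [set enorm (x.1 - x.2) | x in cell s (cube_face n) `*` cell s (cube_face n)].
Proof.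
exists (Num.sqrt (n%:R * (\sum_i \sum_j `|E i j|) ^+ 2)) => _ [[_ _] /= [[x xc <-] [y yc <-]] <-].
apply: enorm_bound => j.
have -> : affine (phi s) x - affine (phi s) y = (x - y) *m E.
  by rewrite /affine mulmxBl opprD addrACA subrr add0r.
rewrite mxE (le_trans (ler_norm_sum _ _ _))//; apply: ler_sum => i _.
have h : `|(x - y) 0 i| <= 1.
  have := xc i; have := yc i; rewrite ffunE !mxE ler_norml.
  by move=> /andP[? ?] /andP[? ?]; apply/andP; split; lra.
rewrite normrM (le_trans (ler_wpM2r _ h))// mul1r (bigD1 j)//= lerDl.
exact: sumr_ge0.
Qed.

Lemma le_diam x y : unit_cube x -> unit_cube y -> enorm ((x - y) *m E) <= d.
Proof.
move=> xc yc; apply: (ub_le_sup diam_has_ub).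
exists (affine (phi s) x, affine (phi s) y); last first.
  by rewrite /= /affine mulmxBl opprD addrACA subrr add0r.
by split; [exists x|exists y]; rewrite ?face_set_cube_face.
Qed.

Lemma diam_ge0 : 0 <= d.
Proof.
have c0 : unit_cube (0 : 'rV[R]_n) by move=> i; rewrite mxE lexx ler01.
exact: le_trans (enorm_ge0 _) (le_diam c0 c0).
Qed.

Lemma entry_le_diam i j : `|E i j| <= d.
Proof.
have c0 : unit_cube (0 : 'rV[R]_n) by move=> l; rewrite mxE lexx ler01.
have c1 : unit_cube (delta_mx 0 i : 'rV[R]_n).
  by move=> l; rewrite mxE /=; case: (l == i); rewrite lexx ler01.
apply: le_trans (le_diam c1 c0); rewrite subr0 -rowE.
by apply: le_trans (le_enorm _ j); rewrite mxE.
Qed.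

Lemma diam_gt0 : (0 < n)%N -> 0 < d.
Proof.
move=> n0; rewrite lt_neqAle diam_ge0 andbT eq_sym; apply/eqP => d0.
have E0 : E = 0.
  apply/matrixP => i j; apply/eqP; rewrite mxE -normr_le0 -d0; exact: entry_le_diam.
have /matrixP/(_ (Ordinal n0) (Ordinal n0)) := mulmxV (phi_unit s).
by rewrite E0 mul0mx !mxE eqxx => /eqP; rewrite eq_sym oner_eq0.
Qed.

(** The volume of an n-cell is the absolute value of the determinant of its edges. *)
Lemma det_ge_fullness (CT : R) : 0 < CT -> CT <= fullness s (cube_face n) ->
  CT * d ^+ n <= `|\det E|.
Proof.
move=> CT0; rewrite /fullness /cell_volume.
have fn : fdim (cube_face n) = n.
  rewrite /fdim card_classical_set -[RHS]card_ord; apply: eq_card => i.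
  by rewrite !inE ffunE.
have vol q (e : q = n) : fdim (cube_face n) = q ->
    pvolume (face_edges q (cube_face n) *m E) = `|\det E|.
  move=> fq; rewrite /pvolume; have := face_edges_mulT (R := R) fq.
  move: (face_edges q _) => F; subst q => FF.
  rewrite trmx_mul !mulmxA -[X in \det (X *m _)]mulmxA det_mulmx !det_mulmx.
  rewrite !det_tr; have := congr1 (fun A : 'M[R]_n => \det A) FF.
  rewrite det_mulmx det_tr det1 => D1.
  by rewrite mulrC !mulrA D1 mul1r -expr2 sqrtr_sqr.
rewrite vol// fn.
have pow_gt0 m (x : R) : ((0 < m)%N -> 0 < x) -> 0 < x ^+ m.
  by case: m => [_|m /(_ isT)]; [rewrite expr0|exact: exprn_gt0].
by rewrite ler_pdivlMr// pow_gt0//; exact: diam_gt0.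
Qed.

Lemma det_bound m (A : 'M[R]_m) B : (forall i j, `|A i j| <= B) ->
  `|\det A| <= m`!%:R * B ^+ m.
Proof.
move=> AB; rewrite (le_trans (ler_norm_sum _ _ _))//.
apply: (@le_trans _ _ (\sum_(t : 'S_m) B ^+ m)).
  apply: ler_sum => t _; rewrite normrM normrX normrN1 expr1n mul1r normr_prod.
  rewrite -[X in _ ^+ X](card_ord m) -prodr_const; apply: ler_prod => i _.
  by rewrite normr_ge0 AB.
by rewrite sumr_const card_Sn mulr_natl.
Qed.

(** Cramer's rule: the cofactors are sums of (n-1)! products of entries of size at
    most d, and the determinant is bounded below by the fullness. *)
Lemma invmx_bound (CT : R) i j : 0 < CT -> CT <= fullness s (cube_face n) ->
  `|invmx E i j| <= (n.-1)`!%:R / (CT * d).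
Proof.
move=> CT0 h; have D := det_ge_fullness CT0 h.
have n0 : (0 < n)%N by case: (n) i => [[]|].
have d0 := diam_gt0 n0.
rewrite /invmx phi_unit !mxE normrM normfV.
have cb : `|cofactor E j i| <= (n.-1)`!%:R * d ^+ n.-1.
  rewrite /cofactor normrM normrX normrN1 expr1n mul1r; apply: det_bound => a b.
  by rewrite !mxE; exact: entry_le_diam.
have CTd : 0 < CT * d ^+ n by rewrite mulr_gt0// exprn_gt0.
rewrite mulrC ler_pdivrMr; last by rewrite (lt_le_trans CTd).
apply: (le_trans cb); rewrite mulrAC ler_pdivlMr ?mulr_gt0//.
rewrite -mulrA ler_wpM2l// (le_trans _ D)//.
by rewrite mulrCA -exprSr prednK.
Qed.

End Geometry.

(** * The interpolation error *)

Section FormEstimates.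
Context {R : realType} {n : nat}.

(** The segment between two points of the image is the image of a segment in the
    cube, so it stays in A, where the gradient is bounded. *)
Lemma lipC_smooth p (A U : set 'rV[R]_n) (f : 'rV[R]_n -> R)
    (a : 'rV[R]_n * 'M[R]_(p, n)) :
  compact A -> A `<=` U -> smooth_fun U f ->
  (forall t, unit_cube t -> A (affine a t)) -> lipC (fun t => f (affine a t)).
Proof.
move=> cA AU fU aA; have [M [M0 HM]] := smooth_bounded_order 1 cA AU fU.
pose B := \sum_i \sum_j `|a.2 i j|.
have B0 : 0 <= B by apply: sumr_ge0 => i _; exact: sumr_ge0.
exists (n%:R * B * M) => x y x01 y01.
set S := \sum_i `|x 0 i - y 0 i|.
have S0 : 0 <= S by exact: sumr_ge0.
have yE t : affine a y + t *: ((x - y) *m a.2) = affine a (y + t *: (x - y)).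
  by rewrite /affine [(y + _) *m _]mulmxDl -scalemxAl addrA.
have cx t : 0 <= t <= 1 -> unit_cube (y + t *: (x - y)).
  move=> t01 i; rewrite !mxE; have := x01 i; have := y01 i.
  move: t01 => /andP[t0 t1] /andP[y0 y1] /andP[x0 x1]; apply/andP; split; nra.
have := @taylor_segment R n U f fU 1 M (B * S) (affine a y) ((x - y) *m a.2).
rewrite big_ord_recl big_ord0 fact0 divr1 addr0 /= expr1 -[X in f (_ + X)]scale1r yE.
rewrite scale1r (addrC y) subrK => h.
rewrite (_ : n%:R * B * M * S = n%:R * (B * S) * M); last by ring.
apply: h; first exact: mulr_ge0.
- move=> j; rewrite mxE (le_trans (ler_norm_sum _ _ _))// mulr_suml.
  apply: ler_sum => i _; rewrite normrM mulrC; apply: ler_pM => //.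
    by rewrite (bigD1 j)//= lerDl sumr_ge0.
  by rewrite !mxE /S (bigD1 i)//= lerDl sumr_ge0.
- by move=> t t01; rewrite yE; apply/AU/aA/cx.
- by move=> t s t01 s1; rewrite yE; apply: HM => //; apply/aA/cx.
Qed.

End FormEstimates.

Lemma unit_rows_mul (R : realType) p n m (f : 'I_p -> 'I_n) (E : 'M[R]_(n, m)) a j :
  (unit_rows f *m E) a j = E (f a) j.
Proof.
rewrite mxE (bigD1 (f a))//= !mxE eqxx mul1r big1 ?addr0// => i ia.
by rewrite !mxE eq_sym (negbTE ia) mul0r.
Qed.

Lemma cell_sub (R : realType) (n : nat) (Omega : set 'rV[R]_n)
    (K : cubical_mesh Omega) (s : ncell K) : cell s (cube_face n) `<=` Omega.
Proof. by move=> x xs; have /seteqP[h _] := mesh_cover K; apply: h; exists s. Qed.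

Section Error.
Context {R : realType} {n : nat} {Omega : set 'rV[R]_n} (K : cubical_mesh Omega).
Context {k p : nat} (k0 : (0 < k)%N) (o : orientation K k p).
Local Notation scell := {ffun 'I_n -> cell1 k}.
Context (Cdof : R) (Cdof0 : 0 <= Cdof).
Hypothesis HCdof : forall (kap : scell -> R) (e : R),
  (forall c, `|\sum_c' kap c' * dofs c c'| <= e) ->
  forall x, unit_cube x -> `|\sum_c kap c * bernprod c x| <= Cdof * e.

(** Let q be a polynomial close to a.  The combination interpolating a - q has
    integrals bounded by e, hence is bounded by a multiple of e, and q itself is
    reproduced by the interpolation. *)
Lemma component_bound (s : ncell K) (c0 : scell) (a q : 'rV[R]_n -> R) d e
    (gam : scell -> R) :
  fdim (dirface c0) = p -> (forall x, unit_cube x -> `|a x - q x| <= e) ->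
  poly_le d q -> (d < k)%N ->
  (forall c : scell, (exists i, is_edge (c i) != is_edge (c0 i)) -> gam c = 0) ->
  (forall c : scell, (forall i, is_edge (c i) = is_edge (c0 i)) ->
     lipC (fun t => a (affine (ref_param s (ocell o (mcell s c))) t)) /\
     cube_integral (fun t => \sum_c' gam c' *
       bernprod c' (affine (ref_param s (ocell o (mcell s c))) t)) =
     cube_integral (fun t => a (affine (ref_param s (ocell o (mcell s c))) t))) ->
  forall x, unit_cube x -> `|\sum_c gam c * bernprod c x - a x| <= (Cdof + 1) * e.
Proof.
move=> c0p aq dq dk g0 Hc x x01.
have e0 : 0 <= e by apply: le_trans (aq x x01).
have [be [be0 qE]] := poly_le_span c0 dq dk.
pose kap c := gam c - be c.
have kapE y : \sum_c kap c * bernprod c y = \sum_c gam c * bernprod c y - q y.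
  by rewrite qE -sumrB; apply: eq_bigr => c _; rewrite mulrBl.
have Hk c : `|\sum_c' kap c' * dofs c c'| <= e.
  have [cc0|[i ci]] := dofs_types c c0; last first.
    rewrite big1 ?normr0// => c' _; have [c'c0|c'c0] := dofs_types c' c0.
      by rewrite (@dofs_neq _ _ _ c c' i) ?mulr0// c'c0.
    by rewrite /kap g0// be0// subrr mul0r.
  have cp : fdim (dirface c) = p by rewrite (fdim_types cc0).
  have [lipa inta] := Hc c cc0; have [rE Ec] := ocell_ref k0 o s cp.
  set rp := ref_param s _ in lipa inta rE Ec.
  have lipb c' : lipC (fun t => bernprod c' (affine rp t)) by exact: lipC_bernprod.
  have lips (g : scell -> R) : lipC (fun t => \sum_c' g c' * bernprod c' (affine rp t)).
    by apply: lipC_sum => c' _; exact: lipCZ.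
  have -> : \sum_c' kap c' * dofs c c' =
      cube_integral (fun t => a (affine rp t)) - cube_integral (fun t => q (affine rp t)).
    rewrite -inta -[X in _ - X](@eq_cube_integral _ _
      (fun t => \sum_c be c * bernprod c (affine rp t))); last first.
      by move=> t _; rewrite qE.
    rewrite !cube_integral_sum; try by move=> c' _; exact: lipCZ.
    rewrite -sumrB; apply: eq_bigr => c' _; rewrite !cube_integralZ// -mulrBl.
    have [c'c0|c'c0] := dofs_types c' c0; last by rewrite /kap g0// be0// subrr !mul0r.
    congr (_ * _); apply/esym; apply: (integral_bernprod k0 cp rE Ec).
    by move=> i; rewrite cc0 c'c0.
  have [La HLa] := lipa; have [Lq HLq] := lips be.
  apply: (@cube_integral_dist _ _ La Lq) => //.
    by move=> t t' t01 t'01; rewrite !qE; exact: HLq.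
  move=> t t01; apply: aq.
  have : smallset c (affine rp t) by rewrite -Ec; exists t.
  exact: smallset_cube.
have := HCdof Hk x01; rewrite kapE => h.
rewrite (_ : _ - a x = (\sum_c gam c * bernprod c x - q x) - (a x - q x)); last by ring.
by rewrite (le_trans (ler_normB _ _))// mulrDl mul1r lerD// aq.
Qed.

Context (U : set 'rV[R]_n) (om : pform R n p).
Hypothesis OU : Omega `<=` U.
Hypothesis om_alt : forall x, U x -> alternating_form (om x).
Hypothesis om_smooth : forall v, smooth_fun U (fun x => om x v).
Context (M : R) (M0 : 0 <= M).
Hypothesis HM : forall (f : {ffun 'I_p -> 'I_n}) sq y, size sq = k -> Omega y ->
  `|iter_partial sq (fun x => om x (unit_rows f)) y| <= M.
Context (eta : pwform K p) (Qeta : Qspace o eta).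
Hypothesis eta_int : forall u, small_cells K k p u ->
  forall s, u `<=` cell s (cube_face n) ->
  integral_cell (ocell o u) (eta s) = integral_cell (ocell o u) om.

Variable s : ncell K.
Local Notation E := (phi s).2.
Local Notation d := (diam (cell s (cube_face n))).

Let cellO x : unit_cube x -> Omega (affine (phi s) x).
Proof.
by move=> x01; apply: (@cell_sub _ _ _ _ s); exists x; rewrite ?face_set_cube_face.
Qed.

(** The Taylor polynomial of degree k - 1 at the corner of the cell that is the
    image of 0, in the coordinates of the unit cube. *)
Definition taylor_poly (f : {ffun 'I_p -> 'I_n}) (x : 'rV[R]_n) : R :=
  \sum_(m < k) dirder (x *m E) (fun y => om y (unit_rows f)) m [::] (phi s).1 / m`!%:R.

Lemma poly_le_taylor f : poly_le k.-1 (taylor_poly f).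
Proof.
apply: poly_le_sum => m _.
rewrite (_ : (fun x => _) = fun x : 'rV[R]_n => m`!%:R^-1 *
  dirder (x *m E) (fun y => om y (unit_rows f)) m [::] (phi s).1); last first.
  by apply/funext => x; rewrite mulrC.
apply: poly_leZ; apply: (@poly_le_leq _ _ m); last exact: poly_le_dirder.
by rewrite -ltnS prednK.
Qed.

Lemma taylor_error (f : {ffun 'I_p -> 'I_n}) x : unit_cube x ->
  `|om (affine (phi s) x) (unit_rows f) - taylor_poly f x| <= (n%:R * (n%:R * d)) ^+ k * M.
Proof.
move=> x01.
have aE (t : R) : (phi s).1 + t *: (x *m E) = affine (phi s) (t *: x).
  by rewrite /affine scalemxAl.
have tx (t : R) : 0 <= t <= 1 -> unit_cube (t *: x).
  move=> /andP[t0 t1] i; rewrite mxE; have /andP[? ?] := x01 i.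
  by apply/andP; split; [exact: mulr_ge0|exact: mulr_ile1].
apply: (taylor_segment (om_smooth (unit_rows f))).
- by rewrite mulr_ge0// diam_ge0.
- move=> j; rewrite mxE (le_trans (ler_norm_sum _ _ _))//.
  apply: (@le_trans _ _ (\sum_(i < n) d)); last by rewrite sumr_const card_ord mulr_natl.
  apply: ler_sum => i _; rewrite normrM -[leRHS]mul1r ler_pM ?entry_le_diam//.
  by have /andP[? ?] := x01 i; rewrite ger0_norm.
- by move=> t t01; rewrite aE; apply/OU/cellO/tx.
- by move=> t sq t01 sk; rewrite aE; apply: HM => //; apply/cellO/tx.
Qed.

Lemma eta_local : exists gam : scell -> R,
  (forall c, fdim (dirface c) <> p -> gam c = 0) /\
  forall x v, eta s x v = \sum_c gam c * basis_form c (ref_coord s x) (v *m invmx E).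
Proof. exact: (Qspace_local k0 s Qeta). Qed.

Lemma eta_alt x : alternating_form (eta s x).
Proof.
have [gam [_ gE]] := eta_local.
rewrite (_ : eta s x = fun v => \sum_c (gam c * bernprod c (ref_coord s x)) *
    \det (v *m (invmx E *m (face_edges p (dirface c))^T))); last first.
  apply/funext => v; rewrite gE; apply: eq_bigr => c _.
  by rewrite /basis_form mulmxA mulrA.
by apply: alternating_sum => c _; exact/alternating_mulmxr/alternating_det.
Qed.

(** The integrals over the small cells parallel to dirface c0 only see the
    component of the form along that face, up to the factor det D that relates the
    edges of the parametrization to those of the face. *)
Lemma face_component_error (c0 : scell) x : fdim (dirface c0) = p -> unit_cube x ->
  `|eta s (affine (phi s) x) (face_edges p (dirface c0) *m E) -
    om (affine (phi s) x) (face_edges p (dirface c0) *m E)| <=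
  (Cdof + 1) * ((n ^ p)%:R * (d ^+ p * ((n%:R * (n%:R * d)) ^+ k * M))).
Proof.
move=> c0p x01; set FE := face_edges p (dirface c0); set W := FE *m E.
set e0 := (n%:R * (n%:R * d)) ^+ k * M.
have [gam [gam0 gamE]] := eta_local.
pose same (c : scell) := [forall i, is_edge (c i) == is_edge (c0 i)].
(* only the basis forms of cells parallel to c0 are visible on the edges of c0 *)
pose gam' c := if same c then gam c else 0.
have sameP c : same c -> forall i, is_edge (c i) = is_edge (c0 i).
  by move=> /forallP h i; exact/eqP.
have sameFE c : same c -> face_edges p (dirface c) = FE.
  by move=> /sameP h; apply: face_edges_eq => i; rewrite !dirface_None h.
have etaW y : eta s (affine (phi s) y) W = \sum_c gam' c * bernprod c y.
  rewrite gamE affK; apply: eq_bigr => c _; rewrite /W mulmxK ?phi_unit// /basis_form /gam'.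
  case: ifPn => [/sameFE ->|ns]; first by rewrite face_edges_mulT// det1 mulr1.
  have [/eqP cp|/eqP cp] := boolP (fdim (dirface c) == p); last by rewrite gam0// !mul0r.
  rewrite det_face_edges_neq ?mulr0 ?mul0r//.
  move: ns => /forallPn[i ci]; apply: (edge_set_neq (i0 := i)); first by rewrite c0p cp.
  by rewrite eq_sym.
rewrite etaW.
apply: (@component_bound s c0 (fun y => om (affine (phi s) y) W)
  (fun y => \sum_(f : {ffun 'I_p -> 'I_n}) (\prod_a W a (f a)) * taylor_poly f y) k.-1) => //.
- move=> y y01; rewrite (alt_expand W (om_alt (OU (cellO y01)))) -sumrB.
  rewrite (le_trans (ler_norm_sum _ _ _))//.
  apply: (@le_trans _ _ (\sum_(f : {ffun 'I_p -> 'I_n}) d ^+ p * e0)).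
    apply: ler_sum => f _; rewrite -mulrBr normrM ler_pM ?taylor_error//.
    rewrite normr_prod -[X in _ ^+ X](card_ord p) -prodr_const; apply: ler_prod => a _.
    rewrite normr_ge0 /W /FE; have [f0 [_ _ _ ->]] := face_edges_unit_rows (R := R) c0p.
    by rewrite unit_rows_mul entry_le_diam.
  by rewrite sumr_const -[X in _ *+ X]/(#|predT|) card_ffun !card_ord -[_ *+ _]mulr_natl.
- by apply: poly_le_sum => f _; apply: poly_leZ; exact: poly_le_taylor.
- by rewrite prednK.
- move=> c [i ci]; rewrite /gam' ifF//; apply/negP => /sameP h.
  by rewrite h eqxx in ci.
move=> c cc0; have cs : same c by apply/forallP => i; rewrite cc0.
have cp : fdim (dirface c) = p by rewrite (fdim_types cc0).
have [rE Ec] := ocell_ref k0 o s cp.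
have [_ [_ [_ _ _ Dpar _]]] := cell_parametrization k0 cp rE Ec.
set u := mcell s c in rE Ec Dpar *.
pose D := (ocell o u).2 *m invmx E *m FE^T.
have D0 : \det D != 0 by have := orient_det_neq0 k0 o s cp; rewrite /orient_det sameFE.
have uW : (ocell o u).2 = D *m W.
  move: Dpar; rewrite /= sameFE// -/D => /(congr1 (mulmx^~ E)).
  by rewrite mulmxKV ?phi_unit// /W mulmxA.
have uO t : unit_cube t -> Omega (affine (ocell o u) t).
  move=> t01; rewrite -(refK s (affine _ t)) ref_affine; apply: cellO.
  have : smallset c (affine (ref_param s (ocell o u)) t) by rewrite -Ec; exists t.
  exact: smallset_cube.
have affE t : affine (phi s) (affine (ref_param s (ocell o u)) t) = affine (ocell o u) t.
  by rewrite -ref_affine refK.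
have lipa : lipC (fun t => om (affine (phi s) (affine (ref_param s (ocell o u)) t)) W).
  rewrite (_ : (fun t => _) = fun t => om (affine (ocell o u) t) W); last first.
    by apply/funext => t; rewrite affE.
  apply: (@lipC_smooth _ _ _ Omega U (fun y => om y W)) => //; first exact: mesh_compact K.
split=> //; apply: (mulfI D0).
rewrite -!cube_integralZ//; last first.
  by apply: lipC_sum => c' _; apply/lipCZ/lipC_bernprod.
transitivity (integral_cell (ocell o u) (eta s)).
  apply: eq_cube_integral => t t01; rewrite -etaW affE uW.
  by rewrite (alt_mulmxl D W (eta_alt _)).
rewrite eta_int; last 2 first.
- exact: mcell_small.
- exact: mcell_cell.
apply: eq_cube_integral => t t01; rewrite affE uW.
by rewrite (alt_mulmxl D W (om_alt (OU (uO t t01)))).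
Qed.

(** The error is an alternating form G in the coordinates of the cube.  By
    [alt_avg] it is controlled by its values on p distinct unit vectors, which are
    the components along the faces, and by the p-minors of v E^-1. *)
Lemma interpolation_error (CT : R) x v : 0 < CT -> CT <= fullness s (cube_face n) ->
  unit_cube x -> pvolume v = 1 ->
  `|eta s (affine (phi s) x) v - om (affine (phi s) x) v| <=
  (n ^ p)%:R * ((n ^ p)%:R * ((n.-1)`!%:R / (CT * d)) ^+ p) *
  ((Cdof + 1) * ((n ^ p)%:R * (d ^+ p * ((n%:R * (n%:R * d)) ^+ k * M)))).
Proof.
move=> CT0 hCT x01 v1; set y := affine (phi s) x.
set B := (Cdof + 1) * _; set z := _ / (CT * d).
have d0 : 0 <= d by exact: diam_ge0.
have B0 : 0 <= B.
  rewrite /B !mulr_ge0 ?exprn_ge0 ?mulr_ge0//.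
  by rewrite addr_ge0.
pose G (w : 'M[R]_(p, n)) := 1 * eta s y (w *m E) + (-1) * om y (w *m E).
have aG : alternating_form G.
  apply: alternating_lin; apply: alternating_mulmxr; first exact: eta_alt.
  exact/om_alt/OU/cellO.
have -> : eta s y v - om y v = G (v *m invmx E).
  by rewrite /G mulmxKV ?phi_unit// mul1r mulN1r.
have Gsel (f : {ffun 'I_p -> 'I_n}) : `|G (unit_rows f)| <= B.
  have [/injectiveP fi|/injectivePn[a [b ab fab]]] := boolP (injectiveb f); last first.
    rewrite (aG.2 _ a b ab) ?normr0//.
    by apply/rowP => j; rewrite !mxE fab.
  (* any cell whose free directions are the values of f *)
  pose c0 : scell := [ffun i => if i \in codom f then inl (Ordinal k0) else inr ord0].
  have c0e i : is_edge (c0 i) = (i \in codom f) by rewrite ffunE; case: ifP.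
  have c0p : fdim (dirface c0) = p.
    rewrite /fdim card_classical_set -[RHS]card_ord -(card_codom fi).
    by apply: eq_card => i; rewrite !inE dirface_None c0e.
  pose FE : 'M[R]_(p, n) := face_edges p (dirface c0).
  pose D := unit_rows f *m FE^T : 'M[R]_p.
  have DE : unit_rows f = D *m FE.
    rewrite mulmx_face_edges// => a j; rewrite mxE; case: eqP => // <-.
    by move/eqP: (dirface_None c0 (f a)); rewrite c0e codom_f => /eqP/eqP ->.
  have DD : D *m D^T = 1%:M.
    rewrite /D trmx_mul trmxK mulmxA -/D -DE.
    by apply/matrixP => a b; rewrite mul_unit_rowsT !mxE (inj_eq fi).
  have D1 : `|\det D| = 1.
    have := congr1 (fun A : 'M[R]_p => \det A) DD.
    rewrite det_mulmx det_tr det1 -expr2 => /eqP; rewrite sqrf_eq1.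
    by case/orP => /eqP ->; rewrite ?normrN normr1.
  rewrite DE (alt_mulmxl D FE aG) normrM D1 mul1r /G mul1r mulN1r.
  exact: face_component_error.
have p0 : (0 : R) < p`!%:R by rewrite ltr0n fact_gt0.
rewrite -(@ler_pM2l _ p`!%:R)// -[X in X * `|_|](ger0_norm (ltW p0)) -normrM.
rewrite (alt_avg _ aG) (le_trans (ler_norm_sum _ _ _))//.
apply: (@le_trans _ _ (\sum_(f : {ffun 'I_p -> 'I_n}) ((n ^ p)%:R * (z ^+ p * p`!%:R)) * B)).
  apply: ler_sum => f _; rewrite normrM ler_pM//.
  rewrite -mulmxA; apply: det_mul_bound => // i a.
  by rewrite mul_unit_rowsT; exact: invmx_bound.
rewrite sumr_const -[X in _ *+ X]/(#|predT|) card_ffun !card_ord -[_ *+ _]mulr_natl.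
by rewrite le_eqVlt; apply/orP; left; apply/eqP; ring.
Qed.

End Error.

Theorem theorem4p3 (R : realType) (n p k : nat) (Omega : set 'rV[R]_n)
    (omega : pform R n p) (hp : (p <= n)%N) (hk : (1 <= k)%N)
    (homega : smooth_form Omega omega) :
  exists C : R,
    forall (h CTheta : R) (K : cubical_mesh Omega) (o : orientation K k p),
      0 < h -> 0 < CTheta ->
      (forall (s : ncell K) (tau : face n), diam (cell s tau) <= h) ->
      (forall (s : ncell K) (tau : face n), CTheta <= fullness s tau) ->
      forall (s : ncell K) (x : 'rV[R]_n), cell s (cube_face n) x ->
        comass (fun v => interpolation o (deRham o omega) s x v - omega x v)
          <= C / CTheta ^+ p * h ^+ k.
Proof.
have [K0|noK] := pselect (inhabited (cubical_mesh Omega)); last first.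
  by exists 0 => h CT K; case: noK.
have cO : compact Omega by case: K0 => K; exact: mesh_compact K.
have [U [om [[oU OU] om_alt om_smooth omE]]] := homega.
have [Cdof [Cdof0 HCdof]] := @dofs_bound R n k hk.
have /choice[M HM] : forall f : {ffun 'I_p -> 'I_n}, exists M : R, 0 <= M /\
    forall sq y, size sq = k -> Omega y -> `|iter_partial sq (fun x => om x (unit_rows f)) y| <= M.
  by move=> f; exact: smooth_bounded_order cO OU (om_smooth (unit_rows f)).
pose M1 := \sum_f M f.
have M10 : 0 <= M1 by apply: sumr_ge0 => f _; case: (HM f).
have HM1 (f : {ffun 'I_p -> 'I_n}) sq y : size sq = k -> Omega y ->
    `|iter_partial sq (fun x => om x (unit_rows f)) y| <= M1.
  move=> sk Oy; apply: le_trans ((HM f).2 sq y sk Oy) _.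
  by rewrite /M1 (bigD1 f)//= lerDl sumr_ge0// => g _; case: (HM g).
pose C := (n ^ p)%:R * ((n ^ p)%:R * (n.-1)`!%:R ^+ p) *
  ((Cdof + 1) * ((n ^ p)%:R * ((n%:R * n%:R) ^+ k * M1))).
have C0 : 0 <= C by rewrite !mulr_ge0 ?exprn_ge0// addr_ge0.
exists C => h CT K o h0 CT0 hd hf s x [xr xr01 <-].
have x01 : unit_cube xr by rewrite -face_set_cube_face.
set x1 := affine (phi s) xr.
have Ox : Omega x1 by apply: (@cell_sub _ _ _ _ s); exists xr.
have [Qe Ie] := interpolationP hk o (deRham o omega).
set eta := interpolation o _ in Qe Ie *.
have RHS0 : 0 <= C / CT ^+ p * h ^+ k.
  apply: mulr_ge0; last by rewrite exprn_ge0// ltW.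
  by apply: divr_ge0 => //; rewrite exprn_ge0// ltW.
have Ie' u : small_cells K k p u -> forall s, u `<=` cell s (cube_face n) ->
    integral_cell (ocell o u) (eta s) = integral_cell (ocell o u) om.
  move=> us s' uss; rewrite Ie// /deRham; apply: eq_cube_integral => t t01.
  apply: omE; apply: (@cell_sub _ _ _ _ s'); apply: uss.
  by have [_ /seteqP[sub _]] := ocellP o us; apply: sub; exists t.
have bound v : pvolume v = 1 -> `|eta s x1 v - omega x1 v| <= C / CT ^+ p * h ^+ k.
  move=> v1; rewrite omE//.
  have := interpolation_error hk Cdof0 HCdof OU om_alt om_smooth M10 HM1 Qe Ie'
    CT0 (hf s (cube_face n)) x01 v1.
  move/le_trans; apply; set d := diam _.
  have d0 : 0 <= d by exact: diam_ge0.
  (* the diameter can be 0 only if n = 0, and then p = 0 and all powers are 1 *)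
  have dp : ((n.-1)`!%:R / (CT * d)) ^+ p * d ^+ p = (n.-1)`!%:R ^+ p / CT ^+ p.
    have [->|pp] := posnP p; first by rewrite !expr0 divr1 mulr1.
    have dn0 : d != 0 by rewrite gt_eqF// diam_gt0// (leq_trans pp).
    rewrite -exprMn -expr_div_n; congr (_ ^+ _).
    by field; rewrite dn0 gt_eqF.
  apply: (@le_trans _ _ (C / CT ^+ p * d ^+ k)); last first.
    apply: ler_wpM2l; first by apply: divr_ge0 => //; rewrite exprn_ge0// ltW.
    by apply: lerXn2r; rewrite ?nnegrE//; [exact: ltW|exact: hd].
  rewrite le_eqVlt; apply/orP; left; apply/eqP.
  transitivity ((n ^ p)%:R * (n ^ p)%:R * ((Cdof + 1) * (n ^ p)%:R * (n%:R * n%:R) ^+ k * M1) *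
     (((n.-1)`!%:R / (CT * d)) ^+ p * d ^+ p) * d ^+ k).
    rewrite (_ : n%:R * (n%:R * d) = n%:R * n%:R * d); last by ring.
    by rewrite [(n%:R * n%:R * d) ^+ k]exprMn; ring.
  by rewrite dp /C; ring.
(* the set is not known to be nonempty here, and the supremum of the empty set is 0 *)
rewrite /comass; set A := [set _ | _ in _].
have Ab : ubound A (C / CT ^+ p * h ^+ k) by move=> _ [v v1 <-]; exact: bound.
have [->|/set0P A0] := eqVneq A set0; first by rewrite sup0.
exact: ge_sup.
Qed.
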